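(* Let $\lambda=(\lambda_1,\ldots,\lambda_l)$ be variables and $|\lambda|=\lambda_1+\cdots+\lambda_l$. The category $\mathcal{C}_\lambda$ is a module category over the monoidal category $\mathcal{C}_{|\lambda|}$, with action given by the tensor product formula described in the context. Moreover, if $\mu=(\mu_1,\ldots,\mu_l)$ is a composition of $d$, then the specialisation functor $F_d\otimes F_\mu:\mathcal{C}_{|\lambda|}\otimes\mathcal{C}_\lambda\to S_d\text{-mod}\otimes S_d\text{-mod}$ is compatible with the usual tensor structure of $S_d$-mod; that is, the action functor $\mathcal{C}_{|\lambda|}\otimes\mathcal{C}_\lambda\to\mathcal{C}_\lambda$ followed by $F_\mu$ agrees with $F_d\otimes F_\mu$ followed by the usual tensor product $S_d\text{-mod}\otimes S_d\text{-mod}\to S_d\text{-mod}$.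
   Context: **The category $\mathcal{C}_\lambda$.** Compositions are finite sequences of nonnegative integers, identified if they differ by trailing zeros. Let $\mathcal{R}_l$ be the ring of integer-valued polynomials in $\lambda_1,\ldots,\lambda_l$. Let $T_\lambda$ be the set of sequences $\alpha=(\lambda_1+\sigma_1,\ldots,\lambda_l+\sigma_l,\tau_1,\tau_2,\ldots)$ with $\sigma\in\mathbb{Z}^l$, $\tau$ a composition, $\sum_i\sigma_i+|\tau|=0$. For $\alpha,\beta\in T_\lambda$, $T_\lambda(\alpha,\beta)$ is the set of matrices $q=(q_{ij})$ (rows indexed by the positions of $\beta$, columns by those of $\alpha$) with $q_{ii}\in\lambda_i+\mathbb{Z}$ for $1\le i\le l$, all other entries in $\mathbb{Z}_{\ge0}$, row sums $\beta$, column sums $\alpha$. $\mathcal{C}_\lambda^{(0)}$ is the $\mathcal{R}_l$-linear category with objects $M^\alpha$ ($\alpha\in T_\lambda$), $\mathrm{Hom}(M^\alpha,M^\beta)$ free over $\mathcal{R}_l$ on symbols $\xi_q$, $q\in T_\lambda(\alpha,\beta)$, and composition, for $r\in T_\lambda(\beta,\gamma)$, $s\in T_\lambda(\alpha,\beta)$, $$\xi_r\xi_s=\sum_{q\in T_\lambda(\alpha,\gamma)}\Big(\sum_A\prod_{i,k}\frac{(\sum_j a_{ijk})!}{\prod_j a_{ijk}!}\Big)\xi_q,$$ over 3-tensors $A=(a_{ijk})$ with $a_{iii}\in\lambda_i+\mathbb{Z}$ for $1\le i\le l$, all other entries in $\mathbb{Z}_{\ge0}$, $\sum_k a_{ijk}=r_{ij}$,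 $\sum_j a_{ijk}=q_{ik}$, $\sum_i a_{ijk}=s_{jk}$ (multinomials read as polynomials: $N!/(N-b)!=N(N-1)\cdots(N-b+1)$). $\mathcal{C}_\lambda$ is its Karoubian envelope (finite direct sums, then splitting idempotents). **$\mathcal{C}_{|\lambda|}$.** This is the one-variable category (the case $l=1$, with variable $t$, index set $T_t$), with scalars extended along $\mathcal{R}_1\to\mathcal{R}_l$, $t\mapsto|\lambda|$; it is symmetric monoidal by the formulas below for $l=1$ (both factors in $\mathcal{C}_t$). **Action.** For $\alpha\in T_t$ (with $t=|\lambda|$) and $\beta\in T_\lambda$, $M^\alpha\otimes M^\beta=\bigoplus_\gamma M^\gamma$ over matrices $\gamma=(\gamma_{ij})$ (rows indexed by positions of $\alpha$, columns by positions of $\beta$) with row sums $\alpha$, column sums $\beta$, $\gamma_{1j}\in\lambda_j+\mathbb{Z}$ for $1\le j\le l$, all other entries in $\mathbb{Z}_{\ge0}$; $M^\gamma$ is the object labelled by the vector of entries of $\gamma$, listed with $\gamma_{11},\ldots,\gamma_{1l}$ first. For $\xi_p:M^\alpha\to M^{\alpha'}$ in $\mathcal{C}_{|\lambda|}$ and $\xi_q:M^\beta\to M^{\beta'}$ in $\mathcal{C}_\lambda$, the component $M^\gamma\to M^{\gamma'}$ of $\xi_p\otimes\xi_q$ is $\sum_T\xi_T$ over 4-tensors $T_{ijkl'}$ (matrices with rows indexed by $(i,j)$ and columns by $(k,l')$) with $T_{1j1j}\in\lambda_j+\mathbb{Z}$ for $1\le j\le l$, all other entries in $\mathbb{Z}_{\ge0}$,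 and $\sum_{k,l'}T_{ijkl'}=\gamma'_{ij}$, $\sum_{i,j}T_{ijkl'}=\gamma_{kl'}$, $\sum_{j,l'}T_{ijkl'}=p_{ik}$, $\sum_{i,k}T_{ijkl'}=q_{jl'}$. The action is extended to Karoubian envelopes. **Specialisation functors.** For a composition $\nu$ of $d$, $M^\nu$ is the permutation module of $S_d$ with basis the words $w=w_1\cdots w_d$ having $\nu_j$ letters equal to $j$, with $S_d$ permuting positions. For a nonnegative integer matrix $q$ with column sums $\nu$ and row sums $\nu'$, $\xi_q:M^\nu\to M^{\nu'}$ sends $w$ to the sum of all words $w'$ with $\#\{m: w_m=j,\,w'_m=i\}=q_{ij}$ for all $i,j$. For $\mu=(\mu_1,\dots,\mu_l)$ a composition of $d$, let $\phi_\mu$ be evaluation $\lambda\mapsto\mu$ (entrywise on vectors and matrices). $F_\mu:\mathcal{C}_\lambda\to S_d\text{-mod}$ sends $M^\alpha$ to $M^{\phi_\mu(\alpha)}$ if $\phi_\mu(\alpha)$ has no negative entries and to $0$ otherwise, and sends $C\xi_q$ to $\phi_\mu(C)\xi_{\phi_\mu(q)}$ (zero if $\phi_\mu(q)$ has a negative entry). $F_d:\mathcal{C}_{|\lambda|}\to S_d\text{-mod}$ is the case $l=1$, $t\mapsto d$ (scalars of $\mathcal{R}_l$ specialised by $\phi_\mu$). *)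

(* Defs.v *)
From HB Require Import structures.
From mathcomp Require Import all_boot all_order all_fingroup all_algebra finmap.
From mathcomp Require Import boolp classical_sets functions cardinality fsbigop.
From mathcomp Require Import generic_quotient ring_quotient.
From mathcomp.multinomials Require mpoly.

Set Implicit Arguments.
Unset Strict Implicit.
Unset Printing Implicit Defensive.

Import Order.TTheory GRing.Theory Num.Theory.

Local Open Scope classical_set_scope.
Local Open Scope ring_scope.

(** * Integer-valued polynomials *)

(* mpoly and monalg have clashing notations, hence this module and the later
   loading of monalg. *)
Module IntPoly.
Import mpoly.

Definition int_valued (l : nat) : pred {mpoly rat[l]} := fun p =>
  `[< forall x : 'I_l -> int, p.@[fun i => (x i)%:Q] \is a Num.int >].

Lemma int_valued_subring l : subring_closed (@int_valued l).
Proof.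
split.
- by apply/asboolP => x; rewrite meval1.
- move=> p q /asboolP hp /asboolP hq; apply/asboolP => x.
  by rewrite mevalB rpredB.
- move=> p q /asboolP hp /asboolP hq; apply/asboolP => x.
  by rewrite mevalM rpredM.
Qed.

HB.instance Definition _ l :=
  GRing.isSubringClosed.Build {mpoly rat[l]} (@int_valued l)
    (@int_valued_subring l).

Record intpoly (l : nat) :=
  Build_intpoly { ipval : {mpoly rat[l]}; _ : int_valued ipval }.

HB.instance Definition _ l := [isSub for @ipval l].
HB.instance Definition _ l := [Choice of intpoly l by <:].
HB.instance Definition _ l := [SubChoice_isSubComNzRing of intpoly l by <:].

Lemma int_binom (x : int) (b : nat) :
  (\prod_(m < b) (x%:Q - m%:Q)) / b`!%:Q \is a Num.int.
Proof.
pose P (y : rat) b := \prod_(m < b) (y - m%:Q).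
have PS y c : P (y + 1) c.+1 / c.+1`!%:Q = P y c.+1 / c.+1`!%:Q + P y c / c`!%:Q.
  have -> : P (y + 1) c.+1 = P y c.+1 + c.+1%:Q * P y c.
    rewrite /P big_ord_recl big_ord_recr /= subr0.
    under eq_bigr => i _.
      rewrite (_ : _ - _ = y - i%:Q); last first.
        by rewrite /bump leq0n PoszD rmorphD /= opprD addrA addrK.
      over.
    rewrite [X in _ = X + _]mulrC -mulrDl; congr (_ * _).
    by rewrite -[c.+1]addn1 PoszD rmorphD /= addrA subrK.
  rewrite mulrDl; congr (_ + _).
  rewrite factS PoszM rmorphM /= invfM mulrACA divff ?mul1r//.
  by rewrite intr_eq0.
rewrite -/(P x%:Q b); elim: b x => [|b IHb] x.
  by rewrite /P big_ord0 divr1.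
elim/int_rect: x => [|n IHn|n IHn].
- by rewrite /P big_ord_recl subr0 mul0r mul0r.
- have -> : (Posz n.+1)%:Q = (Posz n)%:Q + 1 by rewrite -addn1 PoszD rmorphD.
  by rewrite PS rpredD.
- have := PS (- Posz n.+1)%:Q b.
  have -> : (- Posz n.+1)%:Q + 1 = (- Posz n)%:Q.
    by rewrite -addn1 PoszD opprD rmorphD /= subrK.
  by move=> e; rewrite -(addrK (P (- Posz n.+1)%:Q b / b`!%:Q) (_ / _)) -e rpredB.
Qed.

Definition binom_mpoly (l : nat) (i : 'I_l) (n : int) (b : nat) :
    {mpoly rat[l]} :=
  (b`!%:Q)^-1 *: \prod_(m < b) ('X_i + (n%:Q - m%:Q)%:MP).

Lemma binom_mpoly_int l i n b : int_valued (@binom_mpoly l i n b).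
Proof.
apply/asboolP => x; rewrite mevalZ mulrC.
rewrite rmorph_prod /= (_ : \prod_(_ < _) _ =
  \prod_(m < b) ((x i + n)%:Q - m%:Q)); first exact: int_binom.
by apply: eq_bigr => m _; rewrite mevalD mevalXU mevalC rmorphD /= addrA.
Qed.

(* The binomial coefficient of [lambda_i + n] over [b]. *)
Definition ipbinom (l : nat) (i : 'I_l) (n : int) (b : nat) : intpoly l :=
  Build_intpoly (binom_mpoly_int i n b).

Definition sumvars (l : nat) : 1.-tuple {mpoly rat[l]} := [tuple \sum_(i < l) 'X_i].

Lemma subst_int l (p : intpoly 1) : int_valued (comp_mpoly (sumvars l) (ipval p)).
Proof.
case: p => p /= /asboolP hp; apply/asboolP => x.
rewrite comp_mpoly_meval (_ : meval _ _ = p.@[fun i : 'I_1 => (\sum_j x j)%:Q]) //.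
apply: meval_eq => i; rewrite (tnth_nth 0) ord1 /= raddf_sum /= rmorph_sum.
by apply: eq_bigr => j _; rewrite mevalXU.
Qed.

(* The ring morphism R_1 -> R_l with t |-> lambda_1 + ... + lambda_l. *)
Definition sumsubst (l : nat) (p : intpoly 1) : intpoly l :=
  Build_intpoly (subst_int l p).

Lemma sumsubst_zmod l : zmod_morphism (@sumsubst l).
Proof. by move=> p q; apply: val_inj; rewrite /= rmorphB. Qed.

Lemma sumsubst_monoid l : monoid_morphism (@sumsubst l).
Proof.
by split=> [|p q]; apply: val_inj; rewrite /= ?rmorph1 ?rmorphM.
Qed.

HB.instance Definition _ l := GRing.isZmodMorphism.Build _ _ (@sumsubst l)
  (@sumsubst_zmod l).
HB.instance Definition _ l := GRing.isMonoidMorphism.Build _ _ (@sumsubst l)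
  (@sumsubst_monoid l).

(* Evaluation at [mu]; the value is an integer, so it equals its numerator. *)
Definition ipeval (l : nat) (mu : l.-tuple nat) (p : intpoly l) : int :=
  numq (ipval p).@[fun i => (tnth mu i)%:Q].

End IntPoly.
Export IntPoly.

From mathcomp.multinomials Require Import monalg.

(** * Categories *)

Record precat := Precat {
  pob :> Type;
  hom : pob -> pob -> Type;
  idm : forall X, hom X X;
  comp : forall X Y Z, hom Y Z -> hom X Y -> hom X Z }.
Arguments idm {p} X.
Arguments comp {p X Y Z}.
Notation "g \oc f" := (comp g f) (at level 50, left associativity).

Record is_category (C : precat) : Prop := IsCategory {
  comp1m : forall (X Y : C) (f : hom X Y), idm Y \oc f = f;
  compm1 : forall (X Y : C) (f : hom X Y), f \oc idm X = f;
  compA : forall (X Y Z T : C) (h : hom Z T) (g : hom Y Z) (f : hom X Y),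
    h \oc (g \oc f) = h \oc g \oc f }.

Definition is_iso (C : precat) (X Y : C) (f : hom X Y) : Prop :=
  exists g : hom Y X, g \oc f = idm X /\ f \oc g = idm Y.

Definition prodcat (C D : precat) : precat :=
  @Precat (C * D) (fun X Y => (hom X.1 Y.1 * hom X.2 Y.2)%type)
    (fun X => (idm X.1, idm X.2))
    (fun X Y Z g f => (g.1 \oc f.1, g.2 \oc f.2)).

Record prefunctor (C D : precat) := Prefunctor {
  fob :> C -> D;
  fmap : forall X Y, hom X Y -> hom (fob X) (fob Y) }.
Arguments fmap {C D} p {X Y}.

Record is_functor (C D : precat) (F : prefunctor C D) : Prop := IsFunctor {
  fmap1 : forall X, fmap F (idm X) = idm (F X);
  fmapM : forall X Y Z (g : hom Y Z) (f : hom X Y),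
    fmap F (g \oc f) = fmap F g \oc fmap F f }.

Definition compfun (C D E : precat) (G : prefunctor D E) (F : prefunctor C D) :
    prefunctor C E :=
  @Prefunctor C E (fun X => G (F X)) (fun X Y f => fmap G (fmap F f)).

Definition prodfun (C D C' D' : precat) (F : prefunctor C C')
    (G : prefunctor D D') : prefunctor (prodcat C D) (prodcat C' D') :=
  @Prefunctor (prodcat C D) (prodcat C' D') (fun X => (F X.1, G X.2))
    (fun X Y f => (fmap F f.1, fmap G f.2)).

Definition naturally_isomorphic (C D : precat) (F G : prefunctor C D) : Prop :=
  exists eta : forall X, hom (F X) (G X),
    (forall X, is_iso (eta X)) /\
    (forall X Y (f : hom X Y), eta Y \oc fmap F f = fmap G f \oc eta X).

(* A bifunctor and its arguments, with explicit endpoints *)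
Definition bob (C D E : precat) (T : prefunctor (prodcat C D) E) (X : C) (Y : D) :
  E := T (X, Y).
Definition bmap (C D E : precat) (T : prefunctor (prodcat C D) E) (X X' : C)
    (Y Y' : D) (f : hom X X') (g : hom Y Y') : hom (bob T X Y) (bob T X' Y') :=
  @fmap _ _ T (X, Y) (X', Y') (f, g).

(** ** Monoidal and module categories *)

Record is_monoidal (C : precat) (T : prefunctor (prodcat C C) C) (U : C)
    (a : forall X Y Z, hom (bob T (bob T X Y) Z) (bob T X (bob T Y Z)))
    (lu : forall X, hom (bob T U X) X) (ru : forall X, hom (bob T X U) X) : Prop :=
  IsMonoidal {
  mon_cat : is_category C;
  mon_functor : is_functor T;
  mon_assoc_iso : forall X Y Z, is_iso (a X Y Z);
  mon_assoc_nat : forall X X' Y Y' Z Z' (f : hom X X') (g : hom Y Y') (h : hom Z Z'),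
    a X' Y' Z' \oc bmap T (bmap T f g) h = bmap T f (bmap T g h) \oc a X Y Z;
  mon_lunit_iso : forall X, is_iso (lu X);
  mon_lunit_nat : forall X X' (f : hom X X'), lu X' \oc bmap T (idm U) f = f \oc lu X;
  mon_runit_iso : forall X, is_iso (ru X);
  mon_runit_nat : forall X X' (f : hom X X'), ru X' \oc bmap T f (idm U) = f \oc ru X;
  mon_pentagon : forall W X Y Z,
    a W X (bob T Y Z) \oc a (bob T W X) Y Z =
    bmap T (idm W) (a X Y Z) \oc a W (bob T X Y) Z \oc bmap T (a W X Y) (idm Z);
  mon_triangle : forall X Y,
    bmap T (idm X) (lu Y) \oc a X U Y = bmap T (ru X) (idm Y) }.

(* The left module category [D] over [C], the latter with tensor product [T], unit [U],
   associator [a] and right unitor [ru]; the action is [A], with constraints [m], [n]. *)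
Record is_module_category (C : precat) (T : prefunctor (prodcat C C) C) (U : C)
    (a : forall X Y Z, hom (bob T (bob T X Y) Z) (bob T X (bob T Y Z)))
    (ru : forall X, hom (bob T X U) X)
    (D : precat) (A : prefunctor (prodcat C D) D)
    (m : forall X Y M, hom (bob A (bob T X Y) M) (bob A X (bob A Y M)))
    (n : forall M, hom (bob A U M) M) : Prop := IsModuleCategory {
  mod_cat : is_category D;
  mod_functor : is_functor A;
  mod_assoc_iso : forall X Y M, is_iso (m X Y M);
  mod_assoc_nat : forall X X' Y Y' M M' (f : hom X X') (g : hom Y Y') (h : hom M M'),
    m X' Y' M' \oc bmap A (bmap T f g) h = bmap A f (bmap A g h) \oc m X Y M;
  mod_unit_iso : forall M, is_iso (n M);
  mod_unit_nat : forall M M' (f : hom M M'), n M' \oc bmap A (idm U) f = f \oc n M;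
  mod_pentagon : forall X Y Z M,
    m X Y (bob A Z M) \oc m (bob T X Y) Z M =
    bmap A (idm X) (m Y Z M) \oc m X (bob T Y Z) M \oc bmap A (a X Y Z) (idm M);
  mod_triangle : forall X M,
    bmap A (idm X) (n M) \oc m X U M = bmap A (ru X) (idm M) }.

(** ** Linear categories, additive hulls and idempotent completions *)

Record linprecat (R : comNzRingType) := LinPrecat {
  lob : Type;
  lhom : lob -> lob -> lmodType R;
  lidm : forall X, lhom X X;
  lcomp : forall X Y Z, lhom Y Z -> lhom X Y -> lhom X Z }.
Arguments lidm {R l} X.
Arguments lcomp {R l X Y Z}.

Definition precat_of (R : comNzRingType) (C : linprecat R) : precat :=
  @Precat (lob C) (@lhom R C) (@lidm R C) (@lcomp R C).
Coercion precat_of : linprecat >-> precat.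

Record is_linear_category (R : comNzRingType) (C : linprecat R) : Prop :=
  IsLinearCategory {
  lin_cat : is_category C;
  lcompDl : forall X Y Z a (g g' : lhom Y Z) (f : lhom X Y),
    lcomp (a *: g + g') f = a *: lcomp g f + lcomp g' f :> @lhom R C X Z;
  lcompDr : forall X Y Z a (g : lhom Y Z) (f f' : lhom X Y),
    lcomp g (a *: f + f') = a *: lcomp g f + lcomp g f' :> @lhom R C X Z }.

Record is_bilinear_functor (R : comNzRingType) (A B C : linprecat R)
    (T : prefunctor (prodcat A B) C) : Prop := IsBilinearFunctor {
  bil_functor : is_functor T;
  bmapDl : forall (X X' : A) (Y Y' : B) a (f f' : lhom X X') (g : lhom Y Y'),
    bmap T (a *: f + f' : lhom X X') g =
    a *: (bmap T f g : lhom _ _) + (bmap T f' g : lhom _ _);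
  bmapDr : forall (X X' : A) (Y Y' : B) a (f : lhom X X') (g g' : lhom Y Y'),
    bmap T f (a *: g + g' : lhom Y Y') =
    a *: (bmap T f g : lhom _ _) + (bmap T f g' : lhom _ _) }.

Section DependentMatrix.
Variables (R : comNzRingType) (I J : Type) (V : I -> J -> lmodType R).

Definition dmat := forall i j, V i j.
HB.instance Definition _ := gen_eqMixin dmat.
HB.instance Definition _ := gen_choiceMixin dmat.

Lemma dmatP (f g : dmat) : (forall i j, f i j = g i j) -> f = g.
Proof. by move=> e; apply: functional_extensionality_dep => i;
  apply: functional_extensionality_dep. Qed.

Fact dmat_addA : associative (fun (f g : dmat) i j => f i j + g i j : V i j).
Proof. by move=> f g h; apply: dmatP => i j; rewrite addrA. Qed.
Fact dmat_addC : commutative (fun (f g : dmat) i j => f i j + g i j : V i j).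
Proof. by move=> f g; apply: dmatP => i j; rewrite addrC. Qed.
Fact dmat_add0 : left_id (fun i j => 0 : V i j) (fun (f g : dmat) i j => f i j + g i j).
Proof. by move=> f; apply: dmatP => i j; rewrite add0r. Qed.
Fact dmat_addN : left_inverse (fun i j => 0 : V i j) (fun (f : dmat) i j => - f i j)
  (fun (f g : dmat) i j => f i j + g i j).
Proof. by move=> f; apply: dmatP => i j; rewrite addNr. Qed.
HB.instance Definition _ := GRing.isZmodule.Build dmat
  dmat_addA dmat_addC dmat_add0 dmat_addN.

Definition dmat_scale (a : R) (f : dmat) : dmat := fun i j => a *: f i j.
Fact dmat_scaleA a b f : dmat_scale a (dmat_scale b f) = dmat_scale (a * b) f.
Proof. by apply: dmatP => i j; rewrite /dmat_scale scalerA. Qed.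
Fact dmat_scale1 : left_id 1 dmat_scale.
Proof. by move=> f; apply: dmatP => i j; rewrite /dmat_scale scale1r. Qed.
Fact dmat_scaleDr : right_distributive dmat_scale +%R.
Proof. by move=> a f g; apply: dmatP => i j; rewrite /dmat_scale scalerDr. Qed.
Fact dmat_scaleDl f : {morph dmat_scale^~ f : a b / a + b}.
Proof. by move=> a b; apply: dmatP => i j; rewrite /dmat_scale scalerDl. Qed.
HB.instance Definition _ := GRing.Zmodule_isLmodule.Build R dmat
  dmat_scaleA dmat_scale1 dmat_scaleDr dmat_scaleDl.

End DependentMatrix.

Section Hull.
Variables (R : comNzRingType) (C : linprecat R).

(* Formal finite direct sums of objects, and matrices of morphisms. *)
Record family := Family { fidx : finType; fam : fidx -> lob C }.
Arguments fam : clear implicits.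

Definition fam_hom (X Y : family) : lmodType R :=
  dmat (fun i j => lhom (fam X j) (fam Y i)).

Definition fam_id (X : family) : fam_hom X X := fun i j =>
  match @eqP _ i j with
  | ReflectT e => ecast k (lhom (fam X k) (fam X i)) e (lidm (fam X i))
  | ReflectF _ => 0
  end.

Definition fam_comp (X Y Z : family) (g : fam_hom Y Z) (f : fam_hom X Y) :
    fam_hom X Z :=
  fun i k => \sum_j lcomp (g i j) (f j k).

Definition hull : linprecat R := LinPrecat fam_id fam_comp.

End Hull.
Arguments fidx {R C}.
Arguments fam {R C} f i.

Lemma hull_linear (R : comNzRingType) (C : linprecat R) :
  is_linear_category C -> is_linear_category (hull C).
Proof.
move=> HC.
have cDl (X Y Z : C) (f : lhom X Y) (g g' : lhom Y Z) :
    lcomp (g + g') f = lcomp g f + lcomp g' f.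
  by have := lcompDl HC 1 g g' f; rewrite !scale1r.
have cDr (X Y Z : C) (f f' : lhom X Y) (g : lhom Y Z) :
    lcomp g (f + f') = lcomp g f + lcomp g f'.
  by have := lcompDr HC 1 g f f'; rewrite !scale1r.
have c0l (X Y Z : C) (f : lhom X Y) : lcomp (0 : lhom Y Z) f = 0.
  by apply: (addrI (lcomp 0 f)); rewrite -cDl !addr0.
have c0r (X Y Z : C) (g : lhom Y Z) : lcomp g (0 : lhom X Y) = 0.
  by apply: (addrI (lcomp g 0)); rewrite -cDr !addr0.
have csl (X Y Z : C) (J : finType) (f : lhom X Y) (g : J -> lhom Y Z) :
    lcomp (\sum_j g j) f = \sum_j lcomp (g j) f.
  exact: (big_morph (fun h => lcomp h f) (fun g g' => cDl _ _ _ f g g') (c0l _ _ _ f)).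
have csr (X Y Z : C) (J : finType) (f : J -> lhom X Y) (g : lhom Y Z) :
    lcomp g (\sum_j f j) = \sum_j lcomp g (f j).
  exact: (big_morph (lcomp g) (fun f f' => cDr _ _ _ f f' g) (c0r _ _ _ g)).
have idii (X : hull C) i : @fam_id R C X i i = lidm (fam X i).
  by rewrite /fam_id; case: eqP => // e; rewrite eq_axiomK.
have idij (X : hull C) i j : i != j -> @fam_id R C X i j = 0.
  by rewrite /fam_id; case: eqP.
have c1 := comp1m (lin_cat HC); have c2 := compm1 (lin_cat HC).
have c3 := compA (lin_cat HC).
split; first split.
- move=> X Y f; apply: dmatP => i j /=.
  rewrite /fam_comp (bigD1 i)//= idii big1 ?addr0; first exact: c1.
  by move=> k; rewrite eq_sym => ?; rewrite idij // c0l.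
- move=> X Y f; apply: dmatP => i j /=.
  rewrite /fam_comp (bigD1 j)//= idii big1 ?addr0; first exact: c2.
  by move=> k ?; rewrite idij // c0r.
- move=> X Y Z T h g f; apply: dmatP => i j /=; rewrite /fam_comp.
  under eq_bigr do rewrite csr.
  under [RHS]eq_bigr do rewrite csl.
  by rewrite exchange_big; do 2!apply: eq_bigr => ? _; exact: c3.
- move=> X Y Z a g g' f; apply: dmatP => i j; rewrite /= /fam_comp.
  rewrite -[RHS]/(a *: (\sum_k lcomp (g i k) (f k j)) + \sum_k lcomp (g' i k) (f k j)).
  by rewrite scaler_sumr -big_split; apply: eq_bigr => k _; exact: (lcompDl HC).
- move=> X Y Z a g f f'; apply: dmatP => i j; rewrite /= /fam_comp.
  rewrite -[RHS]/(a *: (\sum_k lcomp (g i k) (f k j)) + \sum_k lcomp (g i k) (f' k j)).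
  by rewrite scaler_sumr -big_split; apply: eq_bigr => k _; exact: (lcompDr HC).
Qed.

Section IdempotentCompletion.
Variables (R : comNzRingType) (C : linprecat R) (HC : is_linear_category C).

Record kob := Kob {
  kcar : lob C;
  kidem : lhom kcar kcar;
  kidemP : lcomp kidem kidem = kidem }.

Definition khom_pred (X Y : kob) : pred (lhom (kcar X) (kcar Y)) :=
  fun f => lcomp (lcomp (kidem Y) f) (kidem X) == f.

Lemma khom_submod X Y : submod_closed (@khom_pred X Y).
Proof.
have l0 (Z Z' : C) (h : lhom Z Z') (W : C) : lcomp (0 : lhom Z' W) h = 0.
  by have := lcompDl HC (-1) (0 : lhom Z' W) 0 h; rewrite scaler0 addr0 scaleN1r addNr.
have r0 (Z Z' : C) (h : lhom Z Z') (W : C) : lcomp h (0 : lhom W Z) = 0.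
  by have := lcompDr HC (-1) h (0 : lhom W Z) 0; rewrite scaler0 addr0 scaleN1r addNr.
split; first by rewrite /khom_pred -topredE /= r0 l0.
move=> a f g; rewrite -!topredE /khom_pred /= => /eqP ef /eqP eg.
by rewrite (lcompDr HC) (lcompDl HC) ef eg.
Qed.

HB.instance Definition _ X Y :=
  GRing.isSubmodClosed.Build R _ (@khom_pred X Y) (@khom_submod X Y).

Record khom (X Y : kob) := Khom { kval : lhom (kcar X) (kcar Y); _ : khom_pred kval }.

HB.instance Definition _ X Y := [isSub for @kval X Y].
HB.instance Definition _ X Y := [Choice of khom X Y by <:].
HB.instance Definition _ X Y := [SubChoice_isSubLmodule of khom X Y by <:].

(* The morphism [X -> Y] cut out of a morphism between the underlying objects. *)
Lemma kcut_subproof (X Y : kob) (f : lhom (kcar X) (kcar Y)) :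
  khom_pred (X := X) (Y := Y) (lcomp (lcomp (kidem Y) f) (kidem X)).
Proof.
have c3 := compA (lin_cat HC); rewrite /khom_pred /comp /= in c3 *.
by rewrite -!c3 kidemP !c3 kidemP.
Qed.
Definition kcut (X Y : kob) (f : lhom (kcar X) (kcar Y)) : khom X Y :=
  Khom (kcut_subproof f).

Lemma kid_subproof (X : kob) : khom_pred (kidem X).
Proof. by rewrite /khom_pred !kidemP. Qed.

Lemma kcomp_subproof (X Y Z : kob) (g : khom Y Z) (f : khom X Y) :
  khom_pred (X := X) (Y := Z) (lcomp (kval g) (kval f)).
Proof.
have c3 := compA (lin_cat HC); rewrite /comp /= in c3.
case: g f => g /= /eqP eg [f /= /eqP ef]; rewrite /khom_pred.
by rewrite -{1}eg -{1}ef -!c3 kidemP (c3 _ _ _ _ (kidem Z)) kidemP !c3 eg -!c3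
  (c3 _ _ _ _ (kidem Y)) ef.
Qed.

Definition kar : linprecat R :=
  @LinPrecat R kob khom (fun X => Khom (kid_subproof X))
    (fun X Y Z g f => Khom (kcomp_subproof g f)).

Lemma kar_linear : is_linear_category kar.
Proof.
have c3 := compA (lin_cat HC); rewrite /comp /= in c3.
split; first split.
- move=> X Y [f /= ef]; apply: val_inj => /=.
  by rewrite -{1}(eqP ef) !c3 kidemP (eqP ef).
- move=> X Y [f /= ef]; apply: val_inj => /=.
  by rewrite -{1}(eqP ef) -!c3 kidemP !c3 (eqP ef).
- by move=> X Y Z T h g f; apply: val_inj; exact: c3.
- by move=> X Y Z a g g' f; apply: val_inj => /=; exact: (lcompDl HC).
- by move=> X Y Z a g f f'; apply: val_inj => /=; exact: (lcompDr HC).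
Qed.

End IdempotentCompletion.

Definition karoubi (R : comNzRingType) (C : linprecat R) (HC : is_linear_category C) :
  linprecat R := kar (hull_linear HC).

Section ExtendBifunctor.
Variables (R : comNzRingType) (A B C : linprecat R).
Variables (hA : is_linear_category A) (hB : is_linear_category B).
Variables (hC : is_linear_category C).
Variables (T : prefunctor (prodcat A B) C) (HT : is_functor T).

Lemma kbif_ob_subproof (X : kar hA) (Y : kar hB) :
  lcomp (bmap T (kidem X) (kidem Y) : lhom _ _) (bmap T (kidem X) (kidem Y)) =
  bmap T (kidem X) (kidem Y).
Proof.
have := @fmapM _ _ T HT (kcar X, kcar Y) (kcar X, kcar Y) (kcar X, kcar Y)
  (kidem X, kidem Y) (kidem X, kidem Y).
by rewrite /comp /= !kidemP => <-.
Qed.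

Definition kbif_ob (X : kar hA) (Y : kar hB) : kar hC := Kob (kbif_ob_subproof X Y).

Lemma kbif_map_subproof (X X' : kar hA) (Y Y' : kar hB)
    (f : lhom X X') (g : lhom Y Y') :
  khom_pred (X := kbif_ob X Y) (Y := kbif_ob X' Y') (bmap T (kval f) (kval g)).
Proof.
case: f g => f /= ef [g /= eg]; rewrite /khom_pred /= /bmap.
have M := fmapM HT; rewrite /comp /= in M.
by rewrite -!M /= (eqP ef) (eqP eg).
Qed.

(* (X, e) # (Y, f) = (X # Y, e # f), where # stands for [T] *)
Definition kbif : prefunctor (prodcat (kar hA) (kar hB)) (kar hC) :=
  @Prefunctor (prodcat (kar hA) (kar hB)) (kar hC)
    (fun XY => kbif_ob XY.1 XY.2)
    (fun XY XY' fg => Khom (kbif_map_subproof fg.1 fg.2)).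

End ExtendBifunctor.

(** * The category C_lambda *)

(* Positions are numbered from 0.  Entries lying in [lambda_i + Z] are stored as their
   integer offset from [lambda_i]; this happens at position [i < l] of a vector, at
   position [(i, i)], [i < l], of a matrix and at position [(i, i, i)], [i < l], of a
   3-tensor.  Hence an offset 0 there does not mean that the entry vanishes.  Since the
   entries [lambda_i] occur once on each side, row and column sums may be compared
   through the offsets. *)

Record wt (l : nat) := Wt {
  wtval :> {fsfun nat -> int with 0};
  wtP : `[< (forall i, (l <= i)%N -> 0 <= wtval i) /\
            \sum_(i \in [set: nat]) wtval i = 0 >] }.
HB.instance Definition _ l := [isSub for @wtval l].
HB.instance Definition _ l := [Choice of wt l by <:].

(* [lmat a b] is T_lambda(a, b): row sums [b], column sums [a]. *)
Definition is_lmat (l : nat) (a b : wt l) (q : {fsfun nat * nat -> int with 0}) : Prop :=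
  [/\ forall i j, ~~ ((i == j) && (i < l)%N) -> 0 <= q (i, j),
      forall i, \sum_(j \in [set: nat]) q (i, j) = b i
    & forall j, \sum_(i \in [set: nat]) q (i, j) = a j].

Record lmat (l : nat) (a b : wt l) := Lmat {
  lmatval :> {fsfun nat * nat -> int with 0};
  lmatP : `[< is_lmat a b lmatval >] }.
HB.instance Definition _ l a b := [isSub for @lmatval l a b].
HB.instance Definition _ l a b := [Choice of @lmat l a b by <:].

Section Composition.
Variable l : nat.
Implicit Type A : {fsfun nat * nat * nat -> int with 0}.

Definition is_tensor3 (r q s : {fsfun nat * nat -> int with 0}) A : Prop :=
  [/\ forall i j k, ~~ [&& i == j, j == k & (i < l)%N] -> 0 <= A (i, j, k),
      forall i j, \sum_(k \in [set: nat]) A (i, j, k) = r (i, j),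
      forall i k, \sum_(j \in [set: nat]) A (i, j, k) = q (i, k)
    & forall j k, \sum_(i \in [set: nat]) A (i, j, k) = s (j, k)].

(* The multinomial coefficient (sum_j A_ijk)! / prod_j A_ijk!.  When [i = k < l], so that
   N := sum_j A_iji and A_iii involve lambda_i, it is, with b := N - A_iii,
   N(N-1)...(N-b+1) / prod_(j != i) A_iji! = binom(N, b) * (b! / prod_(j != i) A_iji!). *)
Definition tensor_factor A (i k : nat) : intpoly l :=
  match (insub i : option 'I_l), i == k with
  | Some x, true =>
      let N := \sum_(j \in [set: nat]) A (i, j, i) in
      let b := `|\sum_(j \in [set j | j != i]) A (i, j, i)|%N in
      ipbinom x N b *
        (b`! %/ \big[muln/1%N]_(j \in [set j | j != i]) (`|A (i, j, i)|%N)`!)%:R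
  | _, _ =>
      ((`|\sum_(j \in [set: nat]) A (i, j, k)|%N)`! %/
        \big[muln/1%N]_(j \in [set: nat]) (`|A (i, j, k)|%N)`!)%:R
  end.

Definition tensor_coef A : intpoly l :=
  \big[*%R/1]_(ik \in [set: nat * nat]) tensor_factor A ik.1 ik.2.

Variables (R : comNzRingType) (phi : {rmorphism intpoly l -> R}).

(* The coefficient of xi_q in xi_r xi_s is the image under [phi] of a sum over 3-tensors *)
Definition xi_comp (a b c : wt l) (r : lmat b c) (s : lmat a b) : {malg R[lmat a c]} :=
  \sum_(q \in [set: lmat a c])
    << phi (\sum_(A \in [set A | is_tensor3 r q s A]) tensor_coef A) *g q >>.

Definition C0_comp (a b c : wt l) (g : {malg R[lmat b c]}) (f : {malg R[lmat a b]}) :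
    {malg R[lmat a c]} :=
  \sum_(r <- msupp g) \sum_(s <- msupp f) (g@_r * f@_s) *: xi_comp r s.

(* The sum of the xi_q with [q] supported on the graph [G] (rows first).  For [G] the graph
   of a partial bijection there is at most one such [q], and it identifies [a] with [b]
   by renumbering the positions. *)
Definition relabel (G : nat -> nat -> Prop) (a b : wt l) : {malg R[lmat a b]} :=
  \sum_(q \in [set q : lmat a b | forall i j, q (i, j) != 0 -> G i j])
    (<< q >> : {malg R[lmat a b]}).

(* The category C_lambda^(0), with scalars extended along [phi] *)
Definition C0 : linprecat R :=
  @LinPrecat R (wt l) (fun a b => {malg R[lmat a b]}) (fun a => relabel eq a a) C0_comp.

End Composition.
Arguments relabel {l R} G a b.

(** ** The action *)

(* The numbering of the positions [(i, j)] of a matrix [gamma] by which it is read as a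
   vector; the positions [(0, j)], [j < l], come first.  It is injective; the entries of
   the vector at the numbers which are not reached vanish, since entries beyond [l] are
   nonnegative and all entries have offset sum 0. *)
Definition pos (l : nat) (ij : nat * nat) : nat :=
  if (ij.1 == 0%N) && (ij.2 < l)%N then ij.2 else (l + choice.pickle ij)%N.

Section Action.
Variables (l : nat) (R : comNzRingType).

(* The labels [v] of the matrices [gamma_ij = v (pos l (i, j))] with row sums [a] and
   column sums [b] *)
Definition act_index (a : wt 1) (b : wt l) : set (wt l) :=
  [set v | (forall i, \sum_(j \in [set: nat]) v (pos l (i, j)) = a i) /\
           (forall j, \sum_(i \in [set: nat]) v (pos l (i, j)) = b j)].

(* The 4-tensors [T_ijkj' = u (pos l (i, j), pos l (k, j'))] occurring in the component
   [v -> v'] of [xi_p # xi_q] (# stands for the action).  The conditions on their signs, and on the sums yielding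
   [v] and [v'], are contained in [u : lmat v v']. *)
Definition act_tensor (a a' : wt 1) (b b' : wt l) (p : lmat a a') (q : lmat b b')
    (v v' : wt l) : set (lmat v v') :=
  [set u | (forall i k, \sum_(jj \in [set: nat * nat])
               u (pos l (i, jj.1), pos l (k, jj.2)) = p (i, k)) /\
           (forall j j', \sum_(ik \in [set: nat * nat])
               u (pos l (ik.1, j), pos l (ik.2, j')) = q (j, j'))].

Arguments act_tensor {a a' b b'} p q v v'.

Definition act_component (a a' : wt 1) (b b' : wt l)
    (f : {malg R[lmat a a']}) (g : {malg R[lmat b b']}) (v v' : wt l) :
    {malg R[lmat v v']} :=
  \sum_(p <- msupp f) \sum_(q <- msupp g)
    (f@_p * g@_q) *: \sum_(u \in act_tensor p q v v') (<< u >> : {malg R[lmat v v']}).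

Variables (phi1 : {rmorphism intpoly 1 -> R}) (phi : {rmorphism intpoly l -> R}).
Local Notation Ct := (C0 phi1).
Local Notation Cl := (C0 phi).

Definition act_ob (X : hull Ct) (Y : hull Cl) : hull Cl :=
  @Family R Cl
    {ij : fidx X * fidx Y & fset_set (act_index (fam X ij.1) (fam Y ij.2))}
    (fun x => val (tagged x)).

Definition act_map (X X' : hull Ct) (Y Y' : hull Cl) (f : hom X X') (g : hom Y Y') :
    hom (act_ob X Y) (act_ob X' Y') :=
  fun x' x => act_component (f (tag x').1 (tag x).1) (g (tag x').2 (tag x).2) _ _.

Definition action : prefunctor (prodcat (hull Ct) (hull Cl)) (hull Cl) :=
  @Prefunctor (prodcat (hull Ct) (hull Cl)) (hull Cl)
    (fun XY => act_ob XY.1 XY.2) (fun XY XY' fg => act_map fg.1 fg.2).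

Lemma wt0_subproof (n : nat) :
  `[< (forall i, (n <= i)%N -> 0 <= ([fsfun] : {fsfun nat -> int with 0}) i) /\
      \sum_(i \in [set: nat]) ([fsfun] : {fsfun nat -> int with 0}) i = 0 >].
Proof.
apply/asboolP; split=> [i _|]; first by rewrite fsfunE.
by rewrite fsbig1 // => i _; rewrite fsfunE.
Qed.
Definition wt0 n : wt n := Wt (wt0_subproof n).

(* The unit object M^(t) *)
Definition unit_ob : hull Ct := @Family R Ct unit (fun _ => wt0 1).

End Action.

(** ** Associativity and unit constraints *)

Section Constraints.
Variables (l : nat) (R : comNzRingType).
Variables (phi1 : {rmorphism intpoly 1 -> R}) (phi : {rmorphism intpoly l -> R}).
Local Notation Ct := (C0 phi1).
Local Notation Cl := (C0 phi).

(* The summands of (X # Y) # Z and of X # (Y # Z) are both labelled by 3-tensors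
   [x_ijk], of which the entries are numbered differently. *)
Definition assoc_mx (X Y : hull Ct) (Z : hull Cl) :
    lhom (act_ob (act_ob X Y) Z : lob (hull Cl)) (act_ob X (act_ob Y Z)) :=
  fun z x =>
    if [&& (tag (tag x).1).1 == (tag z).1, (tag (tag x).1).2 == (tag (tag z).2).1
         & (tag x).2 == (tag (tag z).2).2]
    then relabel (fun n m => exists i j k,
           n = pos l (i, pos l (j, k)) /\ m = pos l (pos 1 (i, j), k)) _ _
    else 0.

Definition lunit_mx (Y : hull Cl) : lhom (act_ob (unit_ob phi1) Y : lob (hull Cl)) Y :=
  fun y x =>
    if (tag x).2 == y then relabel (fun n m => m = pos l (0%N, n)) _ _ else 0.

Definition runit_mx (X : hull Ct) : lhom (act_ob X (unit_ob phi1) : lob (hull Ct)) X :=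
  fun y x =>
    if (tag x).1 == y then relabel (fun n m => m = pos 1 (n, 0%N)) _ _ else 0.

Hypotheses (Ht : is_linear_category Ct) (Hl : is_linear_category Cl).
Hypotheses HA : is_functor (action phi1 phi).

Definition kaction : prefunctor (prodcat (karoubi Ht) (karoubi Hl)) (karoubi Hl) :=
  kbif (hull_linear Ht) (hull_linear Hl) (hull_linear Hl) HA.

Lemma kunit_subproof :
  lcomp (lidm (unit_ob phi1)) (lidm (unit_ob phi1)) = lidm (unit_ob phi1) :> lhom _ _.
Proof. exact: (comp1m (lin_cat (hull_linear Ht))). Qed.

Definition kunit : karoubi Ht := Kob kunit_subproof.

End Constraints.
Arguments assoc_mx {l R phi1 phi} X Y Z.
Arguments lunit_mx {l R} phi1 {phi} Y.
Arguments runit_mx {R phi1} X.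

Arguments kaction {l R phi1 phi} Ht Hl HA.
Arguments kunit {R phi1} Ht.

Section KConstraints.
Variables (l : nat) (R : comNzRingType).
Variables (phi1 : {rmorphism intpoly 1 -> R}) (phi : {rmorphism intpoly l -> R}).
Hypotheses (Ht : is_linear_category (C0 phi1)) (Hl : is_linear_category (C0 phi)).
Hypotheses (HT : is_functor (action phi1 phi1)) (HA : is_functor (action phi1 phi)).
Local Notation T := (kaction Ht Ht HT).
Local Notation A := (kaction Ht Hl HA).

Definition kassoc (X Y : karoubi Ht) (Z : karoubi Hl) :
    hom (bob A (bob T X Y) Z) (bob A X (bob A Y Z)) :=
  kcut (hull_linear Hl) (X := bob A (bob T X Y) Z) (Y := bob A X (bob A Y Z))
    (assoc_mx (kcar X) (kcar Y) (kcar Z)).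

Definition klunit (Y : karoubi Hl) : hom (bob A (kunit Ht) Y) Y :=
  kcut (hull_linear Hl) (X := bob A (kunit Ht) Y) (Y := Y) (lunit_mx phi1 (kcar Y)).

Definition krunit (X : karoubi Ht) : hom (bob T X (kunit Ht)) X :=
  kcut (hull_linear Ht) (X := bob T X (kunit Ht)) (Y := X) (runit_mx (kcar X)).

End KConstraints.
Arguments kassoc {l R phi1 phi} Ht Hl HT HA X Y Z.
Arguments klunit {l R phi1 phi} Ht Hl HA Y.
Arguments krunit {R phi1} Ht HT X.

(** * Modules over the symmetric group *)

Section LinearExtension.
Variables (K : choiceType) (V : zmodType) (b : K -> V).

Definition mlin (x : {malg int[K]}) : V := \sum_(k <- msupp x) b k *~ x@_k.

Lemma mlinEw (D : {fset K}) x : (msupp x `<=` D)%fset ->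
  mlin x = \sum_(k <- D) b k *~ x@_k.
Proof.
move=> xD; apply: big_fset_incl => // k _ kx.
by rewrite (mcoeff_outdom kx) mulr0z.
Qed.

Lemma mlin_zmod : zmod_morphism mlin.
Proof.
move=> x y; pose D := (msupp x `|` msupp y)%fset.
rewrite (@mlinEw D x) ?fsubsetUl// (@mlinEw D y) ?fsubsetUr//.
rewrite (@mlinEw D) ?msuppB_le// -sumrB; apply: eq_bigr => k _.
by rewrite mcoeffB mulrzBr.
Qed.

HB.instance Definition _ := GRing.isZmodMorphism.Build _ _ mlin mlin_zmod.

Lemma mlinU k : mlin << k >> = b k.
Proof. by rewrite /mlin msuppU oner_eq0 big_seq_fset1 mcoeffUU mulr1z. Qed.

End LinearExtension.

Lemma malg_ext (K : choiceType) (V : zmodType) (f g : {malg int[K]} -> V) :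
  {morph f : x y / x - y} -> {morph g : x y / x - y} ->
  (forall k, f << k >> = g << k >>) -> f =1 g.
Proof.
move=> fB gB e x.
pose f' := [the {additive _ -> _} of HB.pack_for {additive _ -> _} f
  (GRing.isZmodMorphism.Build _ _ f fB)].
pose g' := [the {additive _ -> _} of HB.pack_for {additive _ -> _} g
  (GRing.isZmodMorphism.Build _ _ g gB)].
rewrite -[f]/(f' : _ -> _) -[g]/(g' : _ -> _) [x]monalgE !raddf_sum.
apply: eq_bigr => k _.
have -> : << x@_k *g k >> = << k >> *~ x@_k.
  by apply/malgP => k'; rewrite raddfMz /= !mcoeffU; case: eqP => _; rewrite ?mulr0n ?mul0rz // !mulr1n intz.
by rewrite !raddfMz /= e.
Qed.

(* The product of 'S_d is (g * h) m = h (g m). *)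
Record sdmod (d : nat) := SdMod {
  sdcar :> zmodType;
  sdact : 'S_d -> sdcar -> sdcar;
  sdactB : forall g, {morph sdact g : x y / x - y};
  sdact1 : forall x, sdact 1%g x = x;
  sdactM : forall g h x, sdact (g * h)%g x = sdact g (sdact h x) }.

Record sdhom (d : nat) (M N : sdmod d) := SdHom {
  sdfun :> M -> N;
  sdfunB : {morph sdfun : x y / x - y};
  sdfunJ : forall g x, sdfun (sdact g x) = sdact g (sdfun x) }.

#[local] Obligation Tactic := idtac.

Program Definition sd_id d (M : sdmod d) : sdhom M M := @SdHom d M M id _ _.
Next Obligation. by []. Qed.
Next Obligation. by []. Qed.

Program Definition sd_comp d (M N P : sdmod d) (g : sdhom N P) (f : sdhom M N) :
  sdhom M P := @SdHom d M P (fun x => g (f x)) _ _.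
Next Obligation. by move=> * x y; rewrite !sdfunB. Qed.
Next Obligation. by move=> * /=; rewrite !sdfunJ. Qed.

Definition Sdmod (d : nat) : precat := Precat (@sd_id d) (@sd_comp d).

(** ** Tensor products *)

Local Open Scope quotient_scope.

Section TensorProduct.
Variable M N : zmodType.

Definition bilin_subgroup (S : set {malg int[(M * N)%type]}) : Prop :=
  [/\ S 0, forall x y, S x -> S y -> S (x - y),
      forall m m' n, S (<< (m + m', n) >> - << (m, n) >> - << (m', n) >>)
    & forall m n n', S (<< (m, n + n') >> - << (m, n) >> - << (m, n') >>)].

(* The subgroup generated by the bilinearity relations *)
Definition bilin_rel : pred {malg int[(M * N)%type]} :=
  fun x => `[< forall S, bilin_subgroup S -> S x >].

Lemma bilin_rel_zmod : zmod_closed bilin_rel.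
Proof.
split; first by apply/asboolP => S [].
move=> x y /asboolP hx /asboolP hy; apply/asboolP => S HS.
by case: (HS) => _ h _ _; apply: h; [apply: hx|apply: hy].
Qed.
HB.instance Definition _ := GRing.isZmodClosed.Build _ bilin_rel bilin_rel_zmod.

Definition tensor : zmodType :=
  Quotient.quot (GRing.ZmodClosed.clone {malg int[(M * N)%type]} bilin_rel _).

Definition tpure (m : M) (n : N) : tensor := \pi_tensor << (m, n) >>.

End TensorProduct.

Section TensorMap.
Variables (M N M' N' : zmodType) (f : M -> M') (g : N -> N').
Hypotheses (fB : {morph f : x y / x - y}) (gB : {morph g : x y / x - y}).

Definition tmap0 : {malg int[(M * N)%type]} -> {malg int[(M' * N')%type]} :=
  mlin (fun mn => << (f mn.1, g mn.2) >>).

(* [f # g], given by m # n |-> f m # g n *)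
Definition tmap (x : tensor M N) : tensor M' N' := \pi_(tensor M' N') (tmap0 (repr x)).

Lemma tmap0_rel x : bilin_rel x -> bilin_rel (tmap0 x).
Proof.
have f0 : f 0 = 0 by have := fB 0 0; rewrite !subrr.
have g0 : g 0 = 0 by have := gB 0 0; rewrite !subrr.
have fD a b : f (a + b) = f a + f b.
  by rewrite -{1}[b]opprK fB -[- b]sub0r fB f0 sub0r opprK.
have gD a b : g (a + b) = g a + g b.
  by rewrite -{1}[b]opprK gB -[- b]sub0r gB g0 sub0r opprK.
move=> /asboolP hx; apply/asboolP => S [S0 SB Sl Sr].
apply: (hx [set y | S (tmap0 y)]); split => /=.
- by rewrite /tmap0 raddf0.
- by move=> y z Sy Sz; rewrite /tmap0 raddfB; apply: SB.
- by move=> m m' n; rewrite /tmap0 !raddfB /= !mlinU /= fD.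
- by move=> m n n'; rewrite /tmap0 !raddfB /= !mlinU /= gD.
Qed.

Lemma tmap_pi x : tmap (\pi_(tensor M N) x) = \pi_(tensor M' N') (tmap0 x).
Proof.
apply/eqP; rewrite -Quotient.idealrBE /tmap0 -raddfB; apply: tmap0_rel.
by rewrite -[bilin_rel _]/(_ \in bilin_rel (N := N)) Quotient.idealrBE reprK.
Qed.

Lemma tmapB : {morph tmap : x y / x - y}.
Proof.
move=> x y; rewrite -[x]reprK -[y]reprK -raddfB !tmap_pi.
by rewrite /tmap0 !raddfB.
Qed.

End TensorMap.

Lemma tensor_ext (M N V : zmodType) (f g : tensor M N -> V) :
  {morph f : x y / x - y} -> {morph g : x y / x - y} ->
  (forall m n, f (tpure m n) = g (tpure m n)) -> f =1 g.
Proof.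
move=> fB gB e x; rewrite -[x]reprK.
apply: (@malg_ext _ _ (f \o \pi_(tensor M N)) (g \o \pi_(tensor M N))) => [y z|y z|[m n]] /=.
- by rewrite raddfB fB.
- by rewrite raddfB gB.
- exact: e.
Qed.

Lemma tmap_pure (M N M' N' : zmodType) (f : M -> M') (g : N -> N') m n :
  {morph f : x y / x - y} -> {morph g : x y / x - y} ->
  tmap f g (tpure m n) = tpure (f m) (g n).
Proof. by move=> fB gB; rewrite tmap_pi // /tmap0 mlinU. Qed.

Section SdTensor.
Variable d : nat.

Program Definition sd_tensor_ob (M N : sdmod d) : sdmod d :=
  @SdMod d (tensor M N) (fun g => tmap (sdact g) (sdact g)) _ _ _.
Next Obligation. by move=> M N g; apply: tmapB; exact: sdactB. Qed.
Next Obligation.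
move=> M N x; apply: (@tensor_ext _ _ _ _ id) => // [|m n].
  by apply: tmapB; exact: sdactB.
by rewrite tmap_pure ?sdact1 //; exact: sdactB.
Qed.
Next Obligation.
move=> M N g h x.
have tB k := @tmapB _ _ _ _ _ _ (@sdactB d M k) (@sdactB d N k).
apply: (@tensor_ext _ _ _ _ (tmap (sdact g) (sdact g) \o tmap (sdact h) (sdact h)))
  => [|y z|m n] /=; first exact: tB.
- by rewrite !tB.
- by rewrite !tmap_pure ?sdactM //; exact: sdactB.
Qed.

Program Definition sd_tensor_map (M M' N N' : sdmod d) (f : sdhom M M') (g : sdhom N N') :
    sdhom (sd_tensor_ob M N) (sd_tensor_ob M' N') :=
  @SdHom d _ _ (tmap f g) _ _.
Next Obligation. by move=> *; apply: tmapB; exact: sdfunB. Qed.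
Next Obligation.
move=> M M' N N' f g k x /=.
have tB := @tmapB _ _ _ _ _ _ (@sdactB d M k) (@sdactB d N k).
have tB' := @tmapB _ _ _ _ _ _ (@sdactB d M' k) (@sdactB d N' k).
have fB := @tmapB _ _ _ _ _ _ (sdfunB f) (sdfunB g).
apply: (@tensor_ext _ _ _ (tmap f g \o tmap (sdact k) (sdact k))
  (tmap (sdact k) (sdact k) \o tmap f g)) => [y z|y z|m n] /=.
- by rewrite tB fB.
- by rewrite fB tB'.
- by rewrite !tmap_pure ?sdfunJ //; (exact: sdactB || exact: sdfunB).
Qed.

(* The usual tensor product: diagonal action on the tensor product over Z *)
Definition sd_tensor : prefunctor (prodcat (Sdmod d) (Sdmod d)) (Sdmod d) :=
  @Prefunctor (prodcat (Sdmod d) (Sdmod d)) (Sdmod d)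
    (fun MN => sd_tensor_ob MN.1 MN.2) (fun MN MN' fg => sd_tensor_map fg.1 fg.2).

End SdTensor.

(** ** Permutation modules *)

Lemma finite_support_ext (I : choiceType) (V W : zmodType) (D : set I)
    (F : I -> V) (G : I -> W) : (forall i, F i != 0) -> (forall i, G i != 0) ->
  finite_support 0 D F = finite_support 0 D G.
Proof.
move=> F0 G0; rewrite /finite_support !unlock; congr (_ (fset_set _)); apply/seteqP.
by split=> u [Du _]; split=> //=; apply/eqP.
Qed.

Section PermutationModule.
Variables (d : nat) (K : choiceType) (act : 'S_d -> K -> K).
Hypotheses (act1 : forall k, act 1%g k = k).
Hypotheses (actM : forall g h k, act (g * h)%g k = act g (act h k)).

Definition perm_act (g : 'S_d) : {malg int[K]} -> {malg int[K]} :=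
  mlin (fun k => << act g k >>).

Program Definition perm_mod : sdmod d := @SdMod d {malg int[K]} perm_act _ _ _.
Next Obligation. by move=> g x y; rewrite /perm_act raddfB. Qed.
Next Obligation.
move=> x; apply: (@malg_ext _ _ (perm_act 1%g) id) => // [y z|k].
  by rewrite /perm_act raddfB.
by rewrite /perm_act mlinU act1.
Qed.
Next Obligation.
move=> g h.
have E : perm_act (g * h)%g =1 (perm_act g \o perm_act h).
  apply: malg_ext => [y z|y z|k].
  - exact: raddfB.
  - by rewrite /= /perm_act !raddfB.
  - by rewrite /= /perm_act !mlinU actM.
exact: E.
Qed.

End PermutationModule.

(* Words with [nu j] letters equal to [j]; there is none if some [nu j] is negative, so that
   the permutation module they span is then 0. *)
Record word (d : nat) (nu : nat -> int) := Word {
  wordval :> {ffun 'I_d -> nat};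
  wordP : `[< forall j, #|[pred m | wordval m == j]|%:Z = nu j >] }.
HB.instance Definition _ d nu := [isSub for @wordval d nu].
HB.instance Definition _ d nu := [Choice of @word d nu by <:].

Lemma word_act_subproof d nu (g : 'S_d) (w : word d nu) :
  `[< forall j, #|[pred m | [ffun m => w (g m)] m == j]|%:Z = nu j >].
Proof.
case: w => w /= /asboolP hw; apply/asboolP => j; rewrite -hw; congr Posz.
rewrite -!sum1_card [RHS](reindex_inj (@perm_inj _ g)).
by apply: eq_bigl => m; rewrite !inE ffunE.
Qed.
Definition word_act d nu (g : 'S_d) (w : word d nu) : word d nu :=
  Word (word_act_subproof g w).

Lemma word_act1 d nu (w : word d nu) : word_act 1%g w = w.
Proof. by apply/val_inj/ffunP => m; rewrite /= ffunE perm1. Qed.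

Lemma word_actM d nu g h (w : word d nu) :
  word_act (g * h)%g w = word_act g (word_act h w).
Proof. by apply/val_inj/ffunP => m; rewrite /= !ffunE permM. Qed.

(** ** Specialisation functors *)

Section Specialisation.
Variables (l d : nat) (mu : l.-tuple nat).

(* The entries of [phi_mu(a)] and [phi_mu(q)] *)
Definition spec_wt (a : wt l) (i : nat) : int := (nth 0%N mu i)%:Z + a i.
Definition spec_mat (a b : wt l) (q : lmat a b) (i j : nat) : int :=
  (if i == j then nth 0%N mu i else 0%N)%:Z + q (i, j).

(* The words [w'] occurring in xi_{phi_mu(q)}(w); there is none if [phi_mu(q)] has a
   negative entry. *)
Definition word_rel (a b : wt l) (q : lmat a b) (w : word d (spec_wt a)) :
    set (word d (spec_wt b)) :=
  [set w' | forall i j,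
     #|[pred m | (w m == j) && (w' m == i)]|%:Z = spec_mat q i j].

(* [C0 phi] has scalars in [R]; they are specialised along [ev]. *)
Variables (R : comNzRingType) (phi : {rmorphism intpoly l -> R}) (ev : R -> int).
Local Notation Cl := (C0 phi).

Definition fam_word (X : hull Cl) : choiceType :=
  {i : fidx X & word d (spec_wt (fam X i))}.

Definition fam_word_act (X : hull Cl) (g : 'S_d) (w : fam_word X) : fam_word X :=
  Tagged (fun i => word d (spec_wt (fam X i))) (word_act g (tagged w)).

Lemma fam_word_act1 X (w : fam_word X) : fam_word_act 1%g w = w.
Proof. by case: w => i w; rewrite /fam_word_act word_act1. Qed.
Lemma fam_word_actM X g h (w : fam_word X) :
  fam_word_act (g * h)%g w = fam_word_act g (fam_word_act h w).
Proof. by case: w => i w; rewrite /fam_word_act word_actM. Qed.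

(* The direct sum of the permutation modules of the members of the family [X] *)
Definition spec_ob (X : hull Cl) : Sdmod d :=
  perm_mod (@fam_word_act1 X) (@fam_word_actM X).

Definition spec_basis (X Y : hull Cl) (f : lhom X Y) (w : fam_word X) :
    {malg int[fam_word Y]} :=
  \sum_(i : fidx Y) \sum_(q <- msupp (f i (tag w)))
    (\sum_(w' \in word_rel q (tagged w))
       (<< Tagged (fun i => word d (spec_wt (fam Y i))) w' >> : {malg int[fam_word Y]}))
    *~ ev (f i (tag w))@_q.

Lemma spec_basisJ X Y (f : lhom X Y) (g : 'S_d) (w : fam_word X) :
  spec_basis f (fam_word_act g w) = perm_act (@fam_word_act Y) g (spec_basis f w).
Proof.
rewrite /perm_act /spec_basis raddf_sum; apply: eq_bigr => i _.
rewrite raddf_sum; apply: eq_bigr => q _; rewrite raddfMz; congr (_ *~ _).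
case: w q => j w q; rewrite /= in q *.
rewrite raddf_sum.
have bij : set_bij (word_rel q w) (word_rel q (word_act g w)) (word_act g).
  have Hg h (v : word d (spec_wt (fam X j))) (w' : word d (spec_wt (fam Y i))) :
      word_rel q v w' -> word_rel q (word_act h v) (word_act h w').
    move=> hv i' j'; rewrite -hv; congr Posz.
    rewrite -!sum1_card [RHS](reindex_inj (@perm_inj _ h)).
    by apply: eq_bigl => m; rewrite !inE !ffunE.
  split.
  - by move=> w' hw'; apply: Hg.
  - move=> u v _ _ e; rewrite -[u]word_act1 -[v]word_act1 -(mulVg g).
    by rewrite !word_actM e.
  - move=> w' hw'; exists (word_act g^-1%g w'); last by rewrite -word_actM mulgV word_act1.
    by have := Hg g^-1%g _ _ hw'; rewrite -word_actM mulVg word_act1.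
rewrite (reindex_fsbig _ _ _ _ bij).
rewrite (_ : finite_support 0 (word_rel q w) _ = finite_support 0 (word_rel q w)
  (fun w' => << Tagged (fun i => word d (spec_wt (fam Y i))) w' >> :
     {malg int[fam_word Y]})); last first.
  by apply: finite_support_ext => w'; rewrite monalgU_eq0 oner_eq0.
by apply: eq_bigr => w' _; rewrite /= mlinU.
Qed.

Program Definition spec_map (X Y : hull Cl) (f : hom X Y) : sdhom (spec_ob X) (spec_ob Y) :=
  @SdHom d (spec_ob X) (spec_ob Y) (mlin (spec_basis f)) _ _.
Next Obligation. by move=> X Y f x y; rewrite raddfB. Qed.
Next Obligation.
move=> X Y f g x; apply: (@malg_ext _ _ (mlin (spec_basis f) \o perm_act (@fam_word_act X) g)
  (perm_act (@fam_word_act Y) g \o mlin (spec_basis f))) => [y z|y z|w] /=.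
- by rewrite /perm_act !raddfB.
- by rewrite /perm_act !raddfB.
- by rewrite {1}/perm_act !mlinU spec_basisJ.
Qed.

Definition spec : prefunctor (hull Cl) (Sdmod d) :=
  @Prefunctor (hull Cl) (Sdmod d) spec_ob spec_map.

End Specialisation.

(** ** Extension of functors to S_d-modules to idempotent completions *)

Section SplitExtension.
Variables (d : nat) (M : sdmod d) (e : sdhom M M).

Definition fixed_pred : pred M := fun x => e x == x.

Lemma fixed_zmod : zmod_closed fixed_pred.
Proof.
split=> [|x y]; rewrite -!topredE /fixed_pred /=.
  by have := sdfunB e 0 0; rewrite !subrr => ->.
by move=> /eqP ex /eqP ey; rewrite sdfunB ex ey.
Qed.
HB.instance Definition _ := GRing.isZmodClosed.Build M fixed_pred fixed_zmod.

(* For an idempotent [e] this is the image of [e]. *)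
Record fixed := Fixed { fixval : M; _ : fixed_pred fixval }.
HB.instance Definition _ := [isSub for fixval].
HB.instance Definition _ := [Choice of fixed by <:].
HB.instance Definition _ := [SubChoice_isSubZmodule of fixed by <:].

Lemma fixed_act_subproof g (x : fixed) : fixed_pred (sdact g (fixval x)).
Proof. by case: x => x /= /eqP ex; rewrite /fixed_pred sdfunJ ex. Qed.

Program Definition fixed_mod : sdmod d :=
  @SdMod d fixed (fun g x => Fixed (fixed_act_subproof g x)) _ _ _.
Next Obligation. by move=> g x y; apply: val_inj; rewrite /= sdactB. Qed.
Next Obligation. by move=> x; apply: val_inj; rewrite /= sdact1. Qed.
Next Obligation. by move=> g h x; apply: val_inj; rewrite /= sdactM. Qed.

End SplitExtension.

Section ExtendSdmod.
Variables (d : nat) (R : comNzRingType) (C : linprecat R) (HC : is_linear_category C).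
Variables (F : prefunctor C (Sdmod d)) (HF : is_functor F).

Lemma kext_map_subproof (X Y : kar HC) (f : lhom X Y) (x : fixed (fmap F (kidem X))) :
  fixed_pred (fmap F (kidem Y)) (sdfun (fmap F (kval f)) (fixval x)).
Proof.
case: f x => f /= /eqP ef [x /= /eqP ex]; rewrite /fixed_pred /=; apply/eqP.
have M1 := congr1 (fun h => sdfun h x)
  (fmapM HF (lcomp (kidem Y) f : hom (kcar X : C) _) (kidem X)).
have M2 := congr1 (fun h => sdfun h x) (fmapM HF (kidem Y) (f : hom (kcar X : C) _)).
by rewrite /comp /= in M1 M2; rewrite -M2 -{1}ex -M1 ef.
Qed.

Program Definition kext_map (X Y : kar HC) (f : hom X Y) :
    sdhom (fixed_mod (fmap F (kidem X))) (fixed_mod (fmap F (kidem Y))) :=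
  @SdHom d _ _ (fun x => Fixed (kext_map_subproof f x)) _ _.
Next Obligation. by move=> X Y f x y; apply: val_inj; rewrite /= sdfunB. Qed.
Next Obligation. by move=> X Y f g x; apply: val_inj; rewrite /= sdfunJ. Qed.

Definition kext : prefunctor (kar HC) (Sdmod d) :=
  @Prefunctor (kar HC) (Sdmod d) (fun X => fixed_mod (fmap F (kidem X))) kext_map.

End ExtendSdmod.

(** * The categories of the statement *)

Section Instances.
Variable l : nat.

Definition phi_id : {rmorphism intpoly l -> intpoly l} := idfun.
Definition phi_sum : {rmorphism intpoly 1 -> intpoly l} := @sumsubst l.

Definition C0_lambda : linprecat (intpoly l) := C0 phi_id.
Definition C0_sum : linprecat (intpoly l) := C0 phi_sum.

Definition hull_tensor : prefunctor (prodcat (hull C0_sum) (hull C0_sum)) (hull C0_sum) :=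
  action phi_sum phi_sum.
Definition hull_action :
    prefunctor (prodcat (hull C0_sum) (hull C0_lambda)) (hull C0_lambda) :=
  action phi_sum phi_id.

(* [F_d] and [F_mu], before idempotent completion; the scalars are specialised at [mu] in
   both cases. *)
Definition hull_Fd (d : nat) (mu : l.-tuple nat) : prefunctor (hull C0_sum) (Sdmod d) :=
  spec d [tuple d] phi_sum (ipeval mu).
Definition hull_Fmu (d : nat) (mu : l.-tuple nat) : prefunctor (hull C0_lambda) (Sdmod d) :=
  spec d mu phi_id (ipeval mu).

End Instances.

(* Main.v *)
From HB Require Import structures.
From mathcomp Require Import all_boot all_order all_fingroup all_algebra finmap.
From mathcomp Require Import boolp classical_sets functions cardinality fsbigop.
From mathcomp Require Import generic_quotient ring_quotient.
From mathcomp.multinomials Require mpoly.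
From mathcomp Require Import zify.
Require Import Defs.

(** Morphisms of C_lambda are tested on words.  A composition [mu] of [d] and a ring map from
    the scalars to Z extending evaluation at [mu] turn a morphism [a -> b] into the integer
    matrix whose entry at a pair of words [(w, w')] is the value of its coefficient at the
    joint matrix of [w] and [w'], which counts the positions with given letters ([wmat]).
    Three facts carry the proof.

    Composition becomes the product of matrices ([wmat_comp]): for fixed outer words, the
    intermediate words with prescribed joint matrices are sorted by the 3-tensor of their
    triple counts, and a product of multinomial coefficients counts those with a given
    3-tensor ([eval_tensor_coef]).  Hence the specialisations are functors ([spec_functor]).

    The action becomes the tensor product ([wmat_act], [spec_act]): a pair of words with
    letters [i] and [j] is the same as a word whose letters are the pairs [(i, j)], and the
    4-tensors in the formula for the action are the joint matrices of such words of pairs.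

    The specialisations are jointly faithful ([spec_faithful]): every label of a morphism is
    the joint matrix of two words as soon as [mu] is large enough to make its entries
    nonnegative ([realise_lmat]), and an integer-valued polynomial vanishing at all large
    points is zero ([intpoly_eq0]).

    Every axiom on finite direct sums (category, functoriality of the action, naturality and
    invertibility of the constraints, pentagon, triangle) therefore reduces to an identity
    between maps of words, where the associator only rebrackets ((x, y), z) into (x, (y, z))
    and the unitors drop a constant word ([hull_module], [hull_monoidal]).

    Faithfulness fails for C_{|lambda|} when [l = 0], the variable t being specialised to 0.
    But then the scalars are a quotient of R_1, objects do not depend on the scalars and
    morphisms lift, so the monoidal structure descends from the one-variable case
    ([hull_monoidal_bc]).

    The passage to idempotent completions is formal: natural constraints commute with the
    idempotents, so cutting them down preserves compositions ([cut_comp], [kar_module]).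
    Likewise a family of biadditive, equivariant and natural pairings
    F_d(X) x F_mu(Y) -> F_mu(X # Y) exhibiting the target as the tensor product for formal
    sums does so after splitting idempotents ([tensor_compatible]); pairing of words is such
    a family. *)

Set Implicit Arguments.
Unset Strict Implicit.
Unset Printing Implicit Defensive.

Import Order.TTheory GRing.Theory Num.Theory.

Local Open Scope classical_set_scope.
Local Open Scope ring_scope.

(** * Values of integer-valued polynomials *)

Module IntPolyEval.
Import mpoly.

Section Eval.
Variables (l : nat) (mu : l.-tuple nat).

Lemma ipeval_Q (p : intpoly l) :
  (ipeval mu p)%:Q = (ipval p).@[fun i => (tnth mu i)%:Q].
Proof.
rewrite /ipeval; case: p => p hp /=; move/asboolP: hp => hp.
exact/numqK/(hp (fun i => tnth mu i)).
Qed.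

Lemma ipeval_zmod : zmod_morphism (ipeval mu).
Proof.
move=> p q; apply: (@intr_inj rat).
by rewrite rmorphB /= !ipeval_Q /= mevalB.
Qed.

Lemma ipeval_monoid : monoid_morphism (ipeval mu).
Proof.
split=> [|p q]; apply: (@intr_inj rat).
  by rewrite ipeval_Q /= meval1.
by rewrite rmorphM /= !ipeval_Q /= mevalM.
Qed.

HB.instance Definition _ := GRing.isZmodMorphism.Build _ _ (ipeval mu) ipeval_zmod.
HB.instance Definition _ := GRing.isMonoidMorphism.Build _ _ (ipeval mu) ipeval_monoid.

Lemma ipeval_binom (i : 'I_l) (n : int) (b m : nat) :
  (tnth mu i)%:Z + n = m%:Z -> ipeval mu (ipbinom i n b) = 'C(m, b)%:Z.
Proof.
move=> e; apply: (@intr_inj rat); rewrite ipeval_Q /= /binom_mpoly mevalZ.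
rewrite rmorph_prod /=.
have -> : \prod_(k < b) meval (fun i => (tnth mu i)%:Q) ('X_i + (n%:Q - k%:Q)%:MP_[l]) =
   \prod_(k < b) (m%:Q - k%:Q).
  apply: eq_bigr => k _; rewrite mevalD mevalXU mevalC.
  by rewrite addrA -e rmorphD.
have ffE : forall c, \prod_(k < c) (m%:Q - k%:Q) = (m ^_ c)%:Q.
  elim=> [|c IH]; first by rewrite big_ord0 ffactn0.
  rewrite big_ord_recr /= IH ffactnSr PoszM rmorphM /=.
  case: (leqP c m) => h; first by rewrite -subzn // rmorphB.
  by rewrite ffact_small // !mul0r.
rewrite ffE -bin_ffact PoszM rmorphM /= mulrC mulfK //.
by rewrite intr_eq0 -lt0n fact_gt0.
Qed.

End Eval.

Lemma ipeval_sumsubst l (mu : l.-tuple nat) (p : intpoly 1) d : sumn mu = d ->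
  ipeval mu (sumsubst l p) = ipeval [tuple d] p.
Proof.
move=> <-; apply: (@intr_inj rat); rewrite !ipeval_Q /= comp_mpoly_meval.
apply: meval_eq => i; rewrite (tnth_nth 0) !ord1 /= raddf_sum /=.
under eq_bigr do rewrite mevalXU.
rewrite (tnth_nth 0%N) /= sumnE big_tuple.
rewrite [RHS](_ : _ = (\sum_(i < l) (tnth mu i)%:Z)%:~R) ?rmorph_sum //.
Qed.

Lemma sumsubst1 (p : intpoly 1) : sumsubst 1 p = p.
Proof.
apply: val_inj => /=; rewrite -[RHS]comp_mpoly_id; congr comp_mpoly.
apply: eq_from_tnth => i; rewrite !(tnth_nth 0) ord1 /= big_ord1.
by rewrite enum_ordSl /=.
Qed.

Lemma digits_inj (B n : nat) (f g : 'I_n -> nat) :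
  (forall i, f i < B)%N -> (forall i, g i < B)%N ->
  (\sum_(i < n) f i * B ^ i = \sum_(i < n) g i * B ^ i)%N -> f =1 g.
Proof.
elim: n f g => [|n IH] f g fB gB; first by move=> _ [].
have E (h : 'I_n.+1 -> nat) : (\sum_(i < n.+1) h i * B ^ i =
    h ord0 + B * \sum_(i < n) h (lift ord0 i) * B ^ i)%N.
  rewrite big_ord_recl muln1; congr addn; rewrite big_distrr /=.
  by apply: eq_bigr => i _; rewrite /bump /= add1n expnS mulnCA.
rewrite !E => e.
have B0 : (0 < B)%N by apply: leq_trans (fB ord0).
have e0 : f ord0 = g ord0.
  have := congr1 (modn^~ B) e.
  by rewrite /= ![(_ + B * _)%N]addnC ![(B * _)%N]mulnC !modnMDl !modn_small.
move: e; rewrite e0 => /addnI /eqP; rewrite eqn_pmul2l // => /eqP e.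
move=> i; case: (unliftP ord0 i) => [j|] -> //.
exact: (IH (fun i => f (lift ord0 i)) (fun i => g (lift ord0 i))).
Qed.

(** The Kronecker substitution x_i = t^(B^i), with [B] above all degrees, keeps the monomials
    of [p] apart, and a polynomial in t vanishing at all large integers is zero. *)
Lemma mpoly_eq0_of_roots l (p : {mpoly rat[l]}) (N : nat) :
  (forall mu : l.-tuple nat, (forall i, N <= tnth mu i)%N ->
     p.@[fun i => (tnth mu i)%:Q] = 0) -> p = 0.
Proof.
move=> hp; apply/eqP; rewrite -msupp_eq0; apply/eqP.
case E : (msupp p) => [//|m s]; exfalso.
have mp : m \in msupp p by rewrite E inE eqxx.
pose B := msize p; pose code (m : 'X_{1..l}) := (\sum_(i < l) m i * B ^ i)%N.
have cinj : {in msupp p &, injective code}.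
  move=> m1 m2 h1 h2 e; apply/mnmP.
  have lt m' i : m' \in msupp p -> (m' i < B)%N.
    move=> /msize_mdeg_lt; apply: leq_ltn_trans.
    by rewrite mdegE (bigD1 i) //= leq_addr.
  by apply: digits_inj e => i; apply: lt.
pose P : {poly rat} := \sum_(m <- msupp p) p@_m *: 'X^(code m).
have PE (x : rat) : P.[x] = p.@[fun i => x ^+ (B ^ i)].
  rewrite mevalE horner_sum; apply: eq_bigr => m' _.
  rewrite hornerZ hornerXn; congr (_ * _); rewrite -prodrXr.
  by apply: eq_bigr => i _; rewrite -exprM mulnC.
have Pm : P`_(code m) = p@_m.
  rewrite coef_sum (bigD1_seq m) ?msupp_uniq //= coefZ coefXn eqxx mulr1.
  rewrite big_seq_cond big1 ?addr0 // => m' /andP[h1 h2].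
  rewrite coefZ coefXn; case: eqP => [e|]; last by rewrite mulr0.
  by rewrite (cinj _ _ mp h1 e) eqxx in h2.
have P0 : P != 0.
  apply/eqP => e; move: Pm; rewrite e coef0 => /esym /eqP.
  by rewrite mcoeff_eq0 mp.
pose s0 := [seq k%:R | k <- iota N.+1 (size P)] : seq rat.
have u0 : uniq s0.
  by rewrite map_inj_uniq ?iota_uniq //; exact: (mulrIn (oner_neq0 rat)).
have r0 : all (root P) s0.
  apply/allP => _ /mapP[k kin ->]; rewrite mem_iota in kin.
  rewrite /root PE; apply/eqP.
  rewrite -[RHS](hp [tuple (k ^ (B ^ i))%N | i < l]); last first.
    move=> i; rewrite tnth_mktuple; case/andP: kin => kN _.
    have B0 : (0 < B ^ i)%N.
      by rewrite expn_gt0 (leq_ltn_trans _ (msize_mdeg_lt mp)).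
    apply: (@leq_trans (k ^ 1)%N); first by rewrite expn1; apply: ltnW.
    by case: (k) kN => // k' _; apply: leq_pexp2l.
  by apply: meval_eq => i; rewrite tnth_mktuple -natrX.
by have := max_poly_roots P0 r0 u0; rewrite size_map size_iota ltnn.
Qed.

Lemma intpoly_eq0 l (p : intpoly l) (N : nat) :
  (forall mu : l.-tuple nat, (forall i, N <= tnth mu i)%N -> ipeval mu p = 0) ->
  p = 0.
Proof.
move=> hp; apply: val_inj => /=; apply: (@mpoly_eq0_of_roots _ _ N) => mu hmu.
by rewrite -ipeval_Q hp.
Qed.

(** A polynomial in no variables is a constant, so it comes from a constant in R_1. *)
Lemma sumsubst0_surj (p : intpoly 0) : exists q, sumsubst 0 q = p.
Proof.
have const (r : {mpoly rat[0]}) : r = (r@_0%MM)%:MP.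
  apply/mpolyP => m; rewrite mcoeffC.
  have -> : m = 0%MM by apply/mnmP; case.
  by rewrite eqxx mulr1.
have c_int : int_valued (((ipval p)@_0%MM)%:MP_[1]).
  case: p => p /= /asboolP hp; apply/asboolP => x; rewrite mevalC.
  by have := hp (fun=> 0); rewrite {1}[p]const mevalC.
by exists (Build_intpoly c_int); apply: val_inj; rewrite /= comp_mpolyC -const.
Qed.

End IntPolyEval.
Export IntPolyEval.

From mathcomp.multinomials Require Import monalg.

(** * Counting functions with prescribed fibre sizes *)

Section Multinomial.
Local Open Scope nat_scope.
Variables (K J : finType).

Definition fibre_count (d : nat) (c : {ffun 'I_d -> K}) (f : {ffun 'I_d -> J})
    (k : K) (j : J) : nat := \sum_(x < d) ((c x == k) && (f x == j)).

Definition ffun_cons (T : Type) (d : nat) (j : T) (f : {ffun 'I_d -> T}) :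
    {ffun 'I_d.+1 -> T} :=
  [ffun x => oapp f j (unlift ord0 x)].

Lemma ffun_cons_bij d :
  bijective (fun jf : J * {ffun 'I_d -> J} => ffun_cons jf.1 jf.2).
Proof.
exists (fun f : {ffun 'I_d.+1 -> J} => (f ord0, [ffun x : 'I_d => f (lift ord0 x)])).
- case=> j f; rewrite /ffun_cons /= ffunE unlift_none; congr pair.
  by apply/ffunP => x; rewrite !ffunE liftK.
- move=> f; apply/ffunP => x; rewrite ffunE /=.
  by case: unliftP => [y|] -> //=; rewrite ffunE.
Qed.

(** Induction on [d], by choosing the value [j0] of [f] at the first position: this lowers
    the entry (c0, j0) of [m] by one, where c0 is the class of that position, so these [f]
    contribute the fraction m(c0, j0) / sum_j m(c0, j) of the right-hand side. *)
Lemma multinomial_count d (c : {ffun 'I_d -> K}) (m : K -> J -> nat) :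
  (forall k, \sum_j m k j = \sum_(x < d) (c x == k)) ->
  (\sum_(f : {ffun 'I_d -> J}) [forall k, forall j, fibre_count c f k j == m k j]) *
    (\prod_k \prod_j (m k j)`!) = \prod_k (\sum_(x < d) (c x == k))`!.
Proof.
elim: d c m => [|d IH] c m mc.
  have m0 k j : m k j = 0.
    have := mc k; rewrite big_ord0 => /eqP; rewrite sum_nat_eq0 => /forallP /(_ j).
    by move/implyP/(_ isT)/eqP.
  rewrite [RHS]big1 => [|k _]; last by rewrite big_ord0.
  rewrite [X in _ * X]big1 ?muln1 => [|k _]; last by rewrite big1 // => j _; rewrite m0.
  under eq_bigr => f _.
    rewrite (_ : [forall k, _]); last first.
      by apply/forallP => k; apply/forallP => j; rewrite m0 /fibre_count big_ord0.
    over.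
  by rewrite sum1_card card_ffun card_ord expn0.
pose c0 := c ord0; pose c' := [ffun x => c (lift ord0 x)] : {ffun 'I_d -> K}.
have cE k : \sum_(x < d.+1) (c x == k) = (c0 == k) + \sum_(x < d) (c' x == k).
  by rewrite big_ord_recl; congr addn; apply: eq_bigr => x _; rewrite ffunE.
have fE j f k j' : fibre_count c (ffun_cons j f) k j' =
    ((c0 == k) && (j == j')) + fibre_count c' f k j'.
  rewrite /fibre_count big_ord_recl !ffunE unlift_none /=; congr addn.
  by apply: eq_bigr => x _; rewrite !ffunE liftK.
pose m' j0 k j := m k j - ((c0 == k) && (j0 == j)).
have m'E j0 k j : m c0 j0 > 0 -> m k j = ((c0 == k) && (j0 == j)) + m' j0 k j.
  rewrite /m' => p; rewrite subnKC //; case: eqP => // <-; case: eqP => // <-.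
  exact: p.
rewrite (reindex _ (onW_bij _ (ffun_cons_bij d))) /=.
rewrite -(pair_bigA _ (fun j f => [forall k, forall j', fibre_count c (ffun_cons j f) k j' == m k j'] : nat)) /=.
rewrite big_distrl /=.
have step j0 : (\sum_(f : {ffun 'I_d -> J})
     [forall k, forall j', fibre_count c (ffun_cons j0 f) k j' == m k j']) *
     (\prod_k \prod_j (m k j)`!) = m c0 j0 * \prod_k (\sum_(x < d) (c' x == k))`!.
  case: (posnP (m c0 j0)) => p.
    rewrite p mul0n big1 // => f _.
    rewrite (_ : [forall k, _] = false) //; apply/negP => /forallP /(_ c0) /forallP /(_ j0).
    by rewrite fE p !eqxx.
  rewrite -(IH c' (m' j0)); last first.
    move=> k; apply: (@addnI (c0 == k)); rewrite -cE -mc.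
    under [RHS]eq_bigr do rewrite (m'E j0) //.
    rewrite big_split /=; congr addn.
    case: (c0 == k) => /=; last by rewrite big1.
    by rewrite (bigD1 j0) //= eqxx big1 ?addn0 // => j; rewrite eq_sym; case: eqP.
  have -> : \prod_k \prod_j (m k j)`! = m c0 j0 * \prod_k \prod_j (m' j0 k j)`!.
    rewrite (bigD1 c0) //= [in RHS](bigD1 c0) //= mulnA; congr muln; last first.
      apply: eq_bigr => k kc; apply: eq_bigr => j _; rewrite /m' eq_sym (negbTE kc).
      by rewrite subn0.
    rewrite (bigD1 j0) //= [in RHS](bigD1 j0) //= mulnA; congr muln; last first.
      by apply: eq_bigr => j jj; rewrite /m' eqxx eq_sym (negbTE jj) subn0.
    by rewrite /m' !eqxx /= subn1; case: (m c0 j0) p.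
  rewrite mulnCA; congr (_ * (_ * _)); apply: eq_bigr => f _; congr nat_of_bool.
  apply: eq_forallb => k; apply: eq_forallb => j.
  by rewrite fE (m'E j0) // eqn_add2l.
under eq_bigr do rewrite step.
rewrite -big_distrl /= mc; apply/esym.
rewrite (bigD1 c0) //= cE eqxx add1n factS [in RHS](bigD1 c0) //= mulnA.
congr muln; apply: eq_bigr => k kc.
by rewrite cE eq_sym (negbTE kc).
Qed.

End Multinomial.

(** * Finitely supported sums and functions *)

Lemma fsbigT_ord (R : Type) (idx : R) (op : Monoid.com_law idx) (n : nat) (f : nat -> R) :
  (forall i, (n <= i)%N -> f i = idx) ->
  \big[op/idx]_(i \in [set: nat]) f i = \big[op/idx]_(i < n) f i.
Proof.
move=> f0; rewrite -(big_mkord xpredT) [RHS]fsbig_seq ?iota_uniq //; apply/esym.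
apply: (fsbig_widen _ [set: nat]) => // i [_ /= ni]; apply: f0; rewrite leqNgt.
by apply/negP => h; apply: ni; rewrite /= mem_index_iota.
Qed.

Arguments fsbigT_ord {R idx op n f}.

Lemma fsbigT_ord2 (R : Type) (idx : R) (op : Monoid.com_law idx) (n : nat)
    (f : nat * nat -> R) :
  (forall i j, (n <= i)%N || (n <= j)%N -> f (i, j) = idx) ->
  \big[op/idx]_(x \in [set: nat * nat]) f x =
  \big[op/idx]_(i < n) \big[op/idx]_(j < n) f (val i, val j).
Proof.
move=> f0; rewrite pair_bigA /=.
have [s us ms] : exists2 s : seq (nat * nat), uniq s &
    s = [seq (val x.1, val x.2) | x : 'I_n * 'I_n].
  exists [seq (val x.1, val x.2) | x : 'I_n * 'I_n] => //.
  by rewrite map_inj_uniq ?enum_uniq // => -[i j] [i' j'] /= [] /val_inj -> /val_inj ->.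
have sP i j : (i < n)%N -> (j < n)%N -> (i, j) \in s.
  by move=> hi hj; rewrite ms; apply/mapP; exists (Ordinal hi, Ordinal hj); rewrite ?mem_enum.
transitivity (\big[op/idx]_(x <- s) f x); last by rewrite ms big_map big_enum.
rewrite [RHS]fsbig_seq //; apply/esym/(fsbig_widen _ [set: nat * nat]) => // -[i j] [_ /= ij].
apply: f0; apply/negPn; rewrite negb_or -!ltnNge; apply/negP => /andP[hi hj].
exact/ij/sP.
Qed.

Arguments fsbigT_ord2 {R idx op n f}.

Lemma sum_Posz (I : Type) (r : seq I) (P : pred I) (F : I -> nat) :
  \sum_(i <- r | P i) (F i)%:Z = (\sum_(i <- r | P i) F i)%N.
Proof. exact/esym/(big_morph Posz PoszD). Qed.

Lemma prod_Posz (I : Type) (r : seq I) (P : pred I) (F : I -> nat) :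
  \prod_(i <- r | P i) (F i)%:Z = (\prod_(i <- r | P i) F i)%N.
Proof. exact/esym/(big_morph Posz PoszM). Qed.

Lemma fsfun_bound (f : {fsfun nat -> int with 0}) :
  exists n, forall i, (n <= i)%N -> f i = 0.
Proof.
exists (\max_(i <- finsupp f) i.+1)%N => i ni; apply: fsfun_dflt.
apply/negP => h; have := @leq_bigmax_seq _ _ xpredT (fun i => i.+1) _ h isT.
by rewrite ltnNge ni.
Qed.

Lemma fsfun_bound2 (f : {fsfun nat * nat -> int with 0}) :
  exists n, forall i j, (n <= i)%N || (n <= j)%N -> f (i, j) = 0.
Proof.
exists (\max_(x <- finsupp f) (x.1 + x.2).+1)%N => i j ni; apply: fsfun_dflt.
apply/negP => h; have := @leq_bigmax_seq _ _ xpredT (fun x : nat * nat => (x.1 + x.2).+1) _ h isT.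
by move: ni; set M := (\max_(_ <- _) _)%N => /=; lia.
Qed.

Lemma fsum_fibres (T : finType) (K : choiceType) (P : pred T) (h : T -> K) :
  \sum_(k \in [set: K]) #|[pred x | P x && (h x == k)]|%:Z = #|P|%:Z.
Proof.
rewrite (fsbigTE [fset h x | x in T]%fset); last first.
  move=> k nk; congr Posz; apply/eqP/pred0P => x /=; apply/negP => /andP[_ /eqP e].
  by case/negP: nk; apply/imfsetP; exists x.
under eq_bigr do rewrite -sum1_card big_mkcond /= -natz natr_sum.
rewrite exchange_big /= -sum1_card -natz natr_sum [RHS]big_mkcond /=.
apply: eq_bigr => x _.
rewrite (big_fsetD1 (h x)) ?in_imfset //= !inE eqxx andbT.
rewrite big_seq big1 ?addr0 => [|k]; last first.
  by rewrite !inE => /andP[/negbTE]; rewrite eq_sym => -> _; rewrite andbF.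
by rewrite -[x \in P]/(P x); case: (P x).
Qed.

Lemma fsumB (K : choiceType) (D : {fset K}) (f g : K -> int) :
  (forall k, k \notin D -> f k = 0) -> (forall k, k \notin D -> g k = 0) ->
  \sum_(k \in [set: K]) (f k - g k) =
  \sum_(k \in [set: K]) f k - \sum_(k \in [set: K]) g k.
Proof.
move=> fD gD; rewrite (fsbigTE D _ fD) (fsbigTE D _ gD) -sumrB (fsbigTE D) // => k kD.
by rewrite fD // gD // subr0.
Qed.

Lemma fsum_single (K : choiceType) (f : K -> int) (k0 : K) :
  (forall k, k != k0 -> f k = 0) -> \sum_(k \in [set: K]) f k = f k0.
Proof.
move=> f0; rewrite (fsbigTE [fset k0]%fset) ?big_seq_fset1 // => k.
by rewrite inE => /f0.
Qed.

(** The classes of [h] partition the positions satisfying [P]. *)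
Lemma sum_count_sub (T : finType) (K : choiceType) (P : pred T) (h : T -> K) (D : {fset K})
    (g : K -> int) : (forall k, k \notin D -> g k = 0) ->
  \sum_(k \in [set: K]) (#|[pred m | P m && (h m == k)]|%:Z - g k) =
  #|P|%:Z - \sum_(k \in [set: K]) g k.
Proof.
move=> gD; rewrite -(fsum_fibres P h); apply: (@fsumB _ (D `|` [fset h m | m in T])%fset) => k.
  rewrite inE negb_or => /andP[_ hk]; congr Posz; apply/eqP/pred0P => m /=.
  apply/negP => /andP[_ /eqP e]; case/negP: hk; apply/imfsetP; by exists m.
by rewrite inE negb_or => /andP[/gD].
Qed.

(** Such functions are determined by the signs and absolute values of their entries on [D]. *)
Lemma finite_fsfun_box (K : choiceType) (D : {fset K}) (M : nat)
    (S : set {fsfun K -> int with 0}) :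
  (forall f, S f -> forall k, (k \notin D -> f k = 0) /\ (`|f k| <= M)%N) ->
  finite_set S.
Proof.
move=> hS; pose code (f : {fsfun K -> int with 0}) : {ffun D -> bool * 'I_M.+1} :=
  [ffun k => (0 <= f (val k), inord `|f (val k)|%N)].
have inj : set_inj S code.
  move=> f g /set_mem Sf /set_mem Sg e; apply/fsfunP => k.
  case: (boolP (k \in D)) => kD; last by rewrite (hS f _ _).1 // (hS g _ _).1.
  have := congr1 (fun c : {ffun D -> bool * 'I_M.+1} => c [` kD]%fset) e.
  rewrite !ffunE /= => -[e1 /(congr1 val)].
  rewrite /= !inordK ?ltnS ?(hS _ _ k).2 //.
  by move: e1; lia.
by rewrite -(eq_finite_set (inj_card_eq inj)); exact: finite_finset.
Qed.

(** * Structure constants at a composition *)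

Lemma multinomial_dvd (J : finType) (m : J -> nat) :
  (\prod_j (m j)`! %| (\sum_j m j)`!)%N.
Proof.
move: {2}(\sum_j m j)%N (erefl (\sum_j m j)%N) => D mD.
pose c : {ffun 'I_D -> unit} := [ffun=> tt].
have cD k : (\sum_(x < D) (c x == k))%N = D.
  by rewrite -[RHS]card_ord -sum1_card; apply: eq_bigr => x _; case: (c x) k => -[].
have := @multinomial_count unit J D c (fun _ => m).
rewrite !(big_pred1 tt); try by case.
rewrite cD mD => h; apply/dvdnP; eexists; exact/esym/h.
Qed.

Lemma fsfun_bound3 (f : {fsfun nat * nat * nat -> int with 0}) :
  exists n, forall i j k, [|| (n <= i)%N, (n <= j)%N | (n <= k)%N] -> f (i, j, k) = 0.
Proof.
exists (\max_(x <- finsupp f) (x.1.1 + x.1.2 + x.2).+1)%N => i j k ni; apply: fsfun_dflt.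
apply/negP => h.
have := @leq_bigmax_seq _ _ xpredT (fun x : nat * nat * nat => (x.1.1 + x.1.2 + x.2).+1) _ h isT.
by move: ni; set M := (\max_(_ <- _) _)%N => /=; lia.
Qed.

Lemma tensor_factor1 l (A : {fsfun nat * nat * nat -> int with 0}) i k :
  (forall j, A (i, j, k) = 0) -> tensor_factor l A i k = 1.
Proof.
move=> A1; have e1 (B : set nat) : \big[muln/1%N]_(j \in B) (`|A (i, j, k)|%N)`! = 1%N.
  by rewrite fsbig1 // => j _; rewrite A1.
have e0 (B : set nat) : \sum_(j \in B) A (i, j, k) = 0.
  by rewrite fsbig1 // => j _; rewrite A1.
rewrite /tensor_factor e0 e1 /= divn1.
case: insubP => [x _ xi|_] //; case: eqP => // ik; subst k.
rewrite !e0 e1 /= divn1 mulr1; apply: val_inj => /=.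
by rewrite /binom_mpoly big_ord0 fact0 invr1 scale1r.
Qed.

Lemma nth_mu_default l (mu : l.-tuple nat) j : (l <= j)%N -> nth 0%N mu j = 0%N.
Proof. by move=> lj; rewrite nth_default // size_tuple. Qed.

(** Here [spA] lists the actual entries of the fibre (i, k) of a 3-tensor, its offsets being
    completed by [mu], and [n] is their sum.  When they are nonnegative the factor is the
    multinomial coefficient n! / prod_j spA(j)!.  The only entry that may be negative is
    spA(i) with i = k < l, and then the factor binom(n, b), b = n - spA(i) > n, vanishes. *)
Section Factors.
Variables (l : nat) (mu : l.-tuple nat) (A : {fsfun nat * nat * nat -> int with 0}).
Variables (i k N n : nat).
Hypothesis lN : (l <= N)%N.
Hypothesis AN : forall j, (N <= j)%N -> A (i, j, k) = 0.
Hypothesis nE : n%:Z = \sum_(j \in [set: nat]) A (i, j, k) +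
  (if i == k then nth 0%N mu i else 0%N)%:Z.
Hypothesis A0 : forall j, ~~ [&& i == j, j == k & (i < l)%N] -> 0 <= A (i, j, k).

Let spA j : int := A (i, j, k) + (if (i == j) && (j == k) then nth 0%N mu i else 0%N)%:Z.

Lemma sum_spA : n%:Z = \sum_(j < N) spA j.
Proof.
rewrite nE (fsbigT_ord AN) /spA big_split /=; congr (_ + _).
case: (ltnP i N) => iN.
  rewrite (bigD1 (Ordinal iN)) //= eqxx big1 ?addr0 // => j.
  by rewrite -val_eqE /= eq_sym; case: eqP.
rewrite nth_mu_default ?(leq_trans lN) // if_same big1 // => j _.
by rewrite if_same.
Qed.

Lemma generic_factor (g : nat -> nat) :
  (forall j, j < N -> A (i, j, k) = (g j)%:Z)%N ->
  ((`|\sum_(j \in [set: nat]) A (i, j, k)|%N)`! %/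
        \big[muln/1%N]_(j \in [set: nat]) (`|A (i, j, k)|%N)`! *
    (\prod_(j < N) (g j)`!) = (\sum_(j < N) g j)`!)%N.
Proof.
move=> gE; rewrite (fsbigT_ord AN) (fsbigT_ord (n := N)) => [|j /AN -> //].
under eq_bigr do rewrite gE ?ltn_ord //.
rewrite (eq_bigr (fun j : 'I_N => (g j)`!)) => [|j _]; last by rewrite gE ?ltn_ord.
rewrite sum_Posz absz_nat divnK //.
exact: multinomial_dvd.
Qed.

Lemma eval_tensor_factor : (forall j, 0 <= spA j) ->
  ipeval mu (tensor_factor l A i k) * (\prod_(j < N) (`|spA j|%N)`!)%:Z = n`!%:Z.
Proof.
move=> sp0; rewrite /tensor_factor.
have generic : ~~ ((i == k) && (i < l)%N) ->
   ipeval mu ((`|\sum_(j \in [set: nat]) A (i, j, k)|%N)`! %/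
        \big[muln/1%N]_(j \in [set: nat]) (`|A (i, j, k)|%N)`!)%:R *
    (\prod_(j < N) (`|spA j|%N)`!)%:Z = n`!%:Z.
  move=> ik; have sE j : spA j = A (i, j, k).
    rewrite /spA; case: ifP => [/andP[/eqP e1 /eqP e2]|]; last by rewrite addr0.
    by rewrite nth_mu_default ?addr0 //; move: ik; rewrite e1 e2 eqxx /= -leqNgt.
  rewrite rmorph_nat natz -PoszM (generic_factor (g := fun j => `|spA j|%N)); last first.
    by move=> j _; rewrite -sE gez0_abs.
  congr Posz; congr (_`!); apply/eqP; rewrite -eqz_nat sum_spA -natz natr_sum.
  by apply/eqP/eq_bigr => j _; rewrite natz gez0_abs.
case: insubP => [x xl xi|il]; last first.
  by apply: generic; rewrite negb_and il orbT.
case: (boolP (i == k)) => [/eqP ik|ik]; last by apply: generic; rewrite negb_and ik.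
have sumS := sum_spA; subst k; rewrite {generic}.
have iN : (i < N)%N by apply: leq_trans lN.
pose g j := if j == i then 0%N else `|A (i, j, i)|%N.
have gE j : j != i -> A (i, j, i) = (g j)%:Z.
  move=> ji; rewrite /g (negbTE ji) gez0_abs // A0 //.
  by rewrite eq_sym (negbTE ji).
have g0 j : (N <= j)%N -> (g j)%:Z = 0.
  by move=> Nj; rewrite -gE ?AN // neq_ltn (leq_trans iN Nj) orbT.
have sumE : \sum_(j \in [set j | j != i]) A (i, j, i) = (\sum_(j < N) g j)%N.
  rewrite fsbig_mkcond; transitivity (\sum_(j \in [set: nat]) (g j)%:Z).
    apply: eq_fsbigr => j _; rewrite /patch mem_setE.
    by case: ifP => /= [/gE //|]; rewrite /g => /negbFE ->.
  by rewrite (fsbigT_ord g0) sum_Posz.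
have prodE : \big[muln/1%N]_(j \in [set j | j != i]) (`|A (i, j, i)|%N)`! =
    (\prod_(j < N) (g j)`!)%N.
  rewrite fsbig_mkcond; transitivity (\big[muln/1%N]_(j \in [set: nat]) (g j)`!).
    apply: eq_fsbigr => j _; rewrite /patch mem_setE.
    by case: ifP => /= [/gE ->//|]; rewrite /g => /negbFE ->.
  by rewrite (fsbigT_ord (n := N)) // => j /g0 [->].
rewrite sumE prodE rmorphM rmorph_nat absz_nat natz /=.
have nE' : (tnth mu x)%:Z + \sum_(j \in [set: nat]) A (i, j, i) = n%:Z.
  by rewrite nE eqxx addrC (tnth_nth 0%N) xi.
rewrite (ipeval_binom _ nE') -!PoszM; congr Posz.
pose b := (\sum_(j < N) g j)%N; rewrite -/b.
have sb : n%:Z = spA i + b%:Z.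
  rewrite sumS (bigD1 (Ordinal iN)) //=; congr (_ + _).
  rewrite /b -sum_Posz [RHS](bigD1 (Ordinal iN)) //= (_ : g i = 0%N) ?add0r; last first.
    by rewrite /g eqxx.
  apply: eq_bigr => j; rewrite -val_eqE /= => ji.
  by rewrite /spA eq_sym (negbTE ji) addr0 gE.
have nb : n = (`|spA i|%N + b)%N.
  by apply/eqP; rewrite -eqz_nat PoszD gez0_abs // sb.
have -> : (\prod_(j < N) (`|spA j|%N)`! = (`|spA i|%N)`! * \prod_(j < N) (g j)`!)%N.
  rewrite (bigD1 (Ordinal iN)) //= [in RHS](bigD1 (Ordinal iN)) //= /g eqxx fact0 mul1n.
  congr muln; apply: eq_bigr => j; rewrite -val_eqE /= => ji.
  by rewrite /spA eq_sym (negbTE ji) addr0 (gE _ ji) /g (negbTE ji).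
have bn : (b <= n)%N by rewrite nb leq_addl.
rewrite -(bin_fact bn) -!mulnA; congr muln.
rewrite mulnCA divnK ?multinomial_dvd // mulnC.
by congr (_ * _`!)%N; rewrite nb addnK.
Qed.

Lemma eval_tensor_factor0 : i = k -> spA i < 0 -> ipeval mu (tensor_factor l A i k) = 0.
Proof.
move=> ik; have sumS := sum_spA; subst k => spi; rewrite /tensor_factor eqxx.
have ai : ~~ (i < l)%N -> False.
  move=> il; have := @A0 i; rewrite eqxx (negbTE il) => /(_ isT).
  by move: spi; rewrite /spA eqxx /=; lia.
case: insubP => [x xl xi|/ai //].
have iN : (i < N)%N by apply: leq_trans lN.
have nE' : (tnth mu x)%:Z + \sum_(j \in [set: nat]) A (i, j, i) = n%:Z.
  by rewrite nE eqxx addrC (tnth_nth 0%N) xi.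
rewrite rmorphM /= (ipeval_binom _ nE') bin_small ?mul0r //.
pose g j := if j == i then 0 else A (i, j, i).
have gE j : j != i -> spA j = g j.
  by move=> ji; rewrite /g /spA (negbTE ji) eq_sym (negbTE ji) addr0.
have -> : \sum_(j \in [set j | j != i]) A (i, j, i) = \sum_(j < N) g j.
  rewrite fsbig_mkcond -(fsbigT_ord (f := g)) => [|j Nj]; last first.
    by rewrite /g; case: eqP => // _; apply: AN.
  apply: eq_fsbigr => j _; rewrite /patch mem_setE /g.
  by case: ifP => [/negbTE ->|/negbFE ->].
have sb : n%:Z = spA i + \sum_(j < N) g j.
  rewrite sumS (bigD1 (Ordinal iN)) //=; congr (_ + _).
  rewrite [RHS](bigD1 (Ordinal iN)) //= /g eqxx add0r.
  by apply: eq_bigr => j; rewrite -val_eqE /= => ji; rewrite gE // /g (negbTE ji).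
by move: (\sum_(j < N) _) sb spi => b; lia.
Qed.

End Factors.

(** * Joint matrices of words *)

Lemma fsfun_seqE (K : choiceType) (s : seq K) (F : K -> int) k :
  (forall k, k \notin s -> F k = 0) ->
  ([fsfun k in [fset x | x in s]%fset => F k] : {fsfun K -> int with 0}) k = F k.
Proof. by move=> F0; rewrite fsfunE inE /=; case: ifP => // /negbT /F0. Qed.

Section Words.
Variables (l d : nat) (mu : l.-tuple nat).
Implicit Types w : {ffun 'I_d -> nat}.

Definition diag_mu (b : bool) (i : nat) : int := (if b then nth 0%N mu i else 0%N)%:Z.

Lemma diag_mu_ge (b : bool) i : (l <= i)%N -> diag_mu b i = 0.
Proof. by move=> li; rewrite /diag_mu nth_mu_default // if_same. Qed.

Lemma diag_mu_false i : diag_mu false i = 0. Proof. by []. Qed.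

Lemma diag_muF (b : bool) i : ~~ b -> diag_mu b i = 0.
Proof. by rewrite /diag_mu => /negbTE ->. Qed.

Definition jcount w w' (i j : nat) : nat := #|[pred m | (w m == j) && (w' m == i)]|.

Definition jcount3 w w' w'' (i j k : nat) : nat :=
  #|[pred m | [&& w'' m == i, w' m == j & w m == k]]|.

(** The matrix counting the positions with given letters, stored like a morphism label: on
    the diagonal the entry of [mu] is subtracted. *)
Definition jmat w w' : {fsfun nat * nat -> int with 0} :=
  [fsfun ij in [fset x | x in [seq (w' m, w m) | m : 'I_d] ++ [seq (i, i) | i <- iota 0 l]]%fset
   => (jcount w w' ij.1 ij.2)%:Z - diag_mu (ij.1 == ij.2) ij.1].

Definition jten w w' w'' : {fsfun nat * nat * nat -> int with 0} :=
  [fsfun x in [fset x | x in [seq (w'' m, w' m, w m) | m : 'I_d] ++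
                 [seq (i, i, i) | i <- iota 0 l]]%fset
   => (jcount3 w w' w'' x.1.1 x.1.2 x.2)%:Z -
      diag_mu ((x.1.1 == x.1.2) && (x.1.2 == x.2)) x.1.1].

Lemma diag_mu_notin (T : eqType) (s : seq T) (f : nat -> T) (x : T) (b : bool) i :
  x \notin s ++ [seq f i | i <- iota 0 l] -> (b -> x = f i) -> diag_mu b i = 0.
Proof.
rewrite mem_cat negb_or => /andP[_ h] hb; case: (ltnP i l) => il; last exact: diag_mu_ge.
rewrite diag_muF //; apply/negP => /hb e; case/negP: h; rewrite e map_f //.
by rewrite mem_iota.
Qed.

Lemma jmatE w w' i j : jmat w w' (i, j) = (jcount w w' i j)%:Z - diag_mu (i == j) i.
Proof.
rewrite fsfun_seqE // => -[{}i {}j] h /=.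
rewrite (diag_mu_notin h) => [|/eqP -> //]; rewrite subr0; congr Posz.
apply/eqP/pred0P => m /=; apply/negP => /andP[/eqP e1 /eqP e2].
case/negP: h; rewrite mem_cat; apply/orP; left; apply/mapP; exists m.
  by rewrite mem_enum.
by rewrite e1 e2.
Qed.

Lemma jtenE w w' w'' i j k :
  jten w w' w'' (i, j, k) = (jcount3 w w' w'' i j k)%:Z - diag_mu ((i == j) && (j == k)) i.
Proof.
rewrite fsfun_seqE // => -[[{}i {}j] {}k] h /=.
rewrite (diag_mu_notin h) => [|/andP[/eqP -> /eqP ->] //]; rewrite subr0; congr Posz.
apply/eqP/pred0P => m /=; apply/negP => /and3P[/eqP e1 /eqP e2 /eqP e3].
case/negP: h; rewrite mem_cat; apply/orP; left; apply/mapP; exists m.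
  by rewrite mem_enum.
by rewrite e1 e2 e3.
Qed.

(** Summing a joint count over one letter forgets that letter; the offsets follow. *)
Lemma offset_sum (P : pred 'I_d) (h : 'I_d -> nat) (e : bool) (x i : nat) :
  \sum_(k \in [set: nat]) (#|[pred m | P m && (h m == k)]|%:Z - diag_mu (e && (x == k)) i) =
  #|P|%:Z - diag_mu e i.
Proof.
rewrite (@sum_count_sub _ _ P h [fset x]%fset (fun k => diag_mu (e && (x == k)) i)) => [|k]; last first.
  by rewrite inE eq_sym => h'; rewrite diag_muF // negb_and h' orbT.
congr (_ - _); rewrite (fsum_single (k0 := x)) ?eqxx ?andbT // => k.
by rewrite eq_sym => /negbTE ->; rewrite andbF.
Qed.

Lemma eq_cardZ (P Q : pred 'I_d) : P =1 Q -> #|P|%:Z = #|Q|%:Z.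
Proof. by move=> e; rewrite (eq_card (B := Q)). Qed.

Lemma jmat_row w w' i : \sum_(j \in [set: nat]) jmat w w' (i, j) =
  #|[pred m | w' m == i]|%:Z - diag_mu true i.
Proof.
rewrite -(offset_sum [pred m | w' m == i] w true i).
apply: eq_fsbigr => j _; rewrite jmatE; congr (_ - _).
by apply: eq_cardZ => m /=; rewrite andbC.
Qed.

Lemma jmat_col w w' j : \sum_(i \in [set: nat]) jmat w w' (i, j) =
  #|[pred m | w m == j]|%:Z - diag_mu true j.
Proof.
rewrite -(offset_sum [pred m | w m == j] w' true j).
apply: eq_fsbigr => i _; rewrite jmatE; congr (_ - _).
by rewrite eq_sym; case: eqP => [->|_] //; rewrite diag_muF // diag_muF.
Qed.

Lemma jten_sumk w w' w'' i j :
  \sum_(k \in [set: nat]) jten w w' w'' (i, j, k) = jmat w' w'' (i, j).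
Proof.
rewrite jmatE -(offset_sum _ w (i == j) j).
apply: eq_fsbigr => k _; rewrite jtenE; congr (_ - _).
by apply: eq_cardZ => m /=; rewrite andbA (andbC (w'' m == i)).
Qed.

Lemma jten_sumj w w' w'' i k :
  \sum_(j \in [set: nat]) jten w w' w'' (i, j, k) = jmat w w'' (i, k).
Proof.
rewrite jmatE -(offset_sum _ w' (i == k) i).
apply: eq_fsbigr => j _; rewrite jtenE; congr (_ - _).
  by apply: eq_cardZ => m /=; rewrite andbCA andbC -!andbA; do !bool_congr.
by congr diag_mu; case: (i =P j) => [->|_]; rewrite ?andbT ?andbF.
Qed.

Lemma jten_sumi w w' w'' j k :
  \sum_(i \in [set: nat]) jten w w' w'' (i, j, k) = jmat w w' (j, k).
Proof.
rewrite jmatE -(offset_sum _ w'' (j == k) j).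
apply: eq_fsbigr => i _; rewrite jtenE; congr (_ - _).
  by apply: eq_cardZ => m /=; rewrite andbC [in RHS](andbC (w m == k)).
by rewrite andbC (eq_sym i); case: (j =P i) => [->|_]; rewrite ?andbT ?andbF.
Qed.

Definition has_type (w : {ffun 'I_d -> nat}) (a : wt l) : Prop :=
  forall j, #|[pred m | w m == j]|%:Z = spec_wt mu a j.

Lemma jmat_ge0 w w' i j : ~~ ((i == j) && (i < l)%N) -> 0 <= jmat w w' (i, j).
Proof.
rewrite jmatE negb_and => /orP[ij|il]; first by rewrite diag_muF // subr0.
by rewrite diag_mu_ge ?subr0 // leqNgt.
Qed.

Lemma jten_ge0 w w' w'' i j k : ~~ [&& i == j, j == k & (i < l)%N] ->
  0 <= jten w w' w'' (i, j, k).
Proof.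
rewrite jtenE andbA negb_and => /orP[ij|il]; first by rewrite diag_muF // subr0.
by rewrite diag_mu_ge ?subr0 // leqNgt.
Qed.

Lemma jmat_lmat a b w w' : has_type w a -> has_type w' b -> is_lmat a b (jmat w w').
Proof.
move=> ha hb; split=> [i j||]; first exact: jmat_ge0.
- by move=> i; rewrite jmat_row hb /spec_wt /diag_mu addrC addKr.
- by move=> j; rewrite jmat_col ha /spec_wt /diag_mu addrC addKr.
Qed.

Lemma lmat_jmat a b w w' : is_lmat a b (jmat w w') -> has_type w a /\ has_type w' b.
Proof.
case=> _ hr hc; split=> j.
- by rewrite /spec_wt -hc jmat_col /diag_mu addrC subrK.
- by rewrite /spec_wt -hr jmat_row /diag_mu addrC subrK.
Qed.

Lemma jten_tensor3 w w' w'' :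
  is_tensor3 l (jmat w' w'') (jmat w w'') (jmat w w') (jten w w' w'').
Proof.
split=> [i j k|i j|i k|j k]; first exact: jten_ge0.
- exact: jten_sumk.
- exact: jten_sumj.
- exact: jten_sumi.
Qed.

Lemma word_type (a : wt l) (w : word d (spec_wt mu a)) : has_type w a.
Proof. exact: (asboolW (wordP w)). Qed.

(** ** Enumerating words *)

(** Words with letters below [N] are functions to ['I_N], for which sums over all functions
    are available; [N] bounds the letters of every word of type [a]. *)
Definition word_bound (a : wt l) (N : nat) :=
  (l <= N)%N /\ forall i, (N <= i)%N -> a i = 0.

Lemma word_boundP a : exists N, word_bound a N.
Proof.
have [n hn] := fsfun_bound a; exists (l + n)%N; split; first exact: leq_addr.
by move=> i /(leq_trans (leq_addl l n)); exact: hn.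
Qed.

Lemma word_bound_leq a N N' : word_bound a N -> (N <= N')%N -> word_bound a N'.
Proof.
move=> [h1 h2] h; split; first exact: leq_trans h.
by move=> i /(leq_trans h); exact: h2.
Qed.

Lemma has_type_lt w a N m : has_type w a -> word_bound a N -> (w m < N)%N.
Proof.
move=> wa [lN aN]; rewrite ltnNge; apply/negP => Nw.
have := wa (w m); rewrite /spec_wt nth_mu_default ?(leq_trans lN) // aN // addr0 => -[].
by move/eqP; apply/negP/pred0Pn; exists m => /=.
Qed.

Definition letters_up N (f : {ffun 'I_d -> 'I_N}) : {ffun 'I_d -> nat} :=
  [ffun m => f m : nat].

Lemma letters_upP N w : (forall m, w m < N)%N -> exists f : {ffun 'I_d -> 'I_N}, letters_up f = w.
Proof.
move=> h; exists [ffun m => Ordinal (h m)]; apply/ffunP => m.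
by rewrite !ffunE.
Qed.

Lemma letters_up_inj N : injective (@letters_up N).
Proof.
move=> f g /ffunP e; apply/ffunP => m; apply: val_inj.
by have := e m; rewrite !ffunE.
Qed.

Lemma finite_words a : finite_set [set: word d (spec_wt mu a)].
Proof.
have [N aN] := word_boundP a.
apply: (@sub_finite_set _ _ ((fun w : word d (spec_wt mu a) => w : {ffun 'I_d -> nat}) @^-1`
   (@letters_up N @` [set: {ffun 'I_d -> 'I_N}]))).
  move=> w _ /=; have [m|f fw] := @letters_upP N w; last by exists f.
  exact: has_type_lt (word_type w) aN.
apply: finite_preimage; first by move=> w w' _ _; apply: val_inj.
exact/finite_image/finite_finset.
Qed.

Definition words (a : wt l) : {fset word d (spec_wt mu a)} := fset_set [set: word d (spec_wt mu a)].

Lemma in_words a (w : word d (spec_wt mu a)) : w \in words a.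
Proof. by rewrite in_fset_set ?inE //; exact: finite_words. Qed.

Lemma big_words (R : Type) (idx : R) (op : Monoid.com_law idx) a N (F : {ffun 'I_d -> nat} -> R) :
  word_bound a N -> (forall w, ~ has_type w a -> F w = idx) ->
  \big[op/idx]_(v <- words a) F v = \big[op/idx]_(f : {ffun 'I_d -> 'I_N}) F (letters_up f).
Proof.
move=> aN F0.
pose s := [seq letters_up f | f : {ffun 'I_d -> 'I_N}].
have us : uniq s by rewrite map_inj_uniq ?enum_uniq //; exact: letters_up_inj.
transitivity (\big[op/idx]_(w <- s) F w); last by rewrite big_map big_enum.
transitivity (\big[op/idx]_(w <- [seq (val v : {ffun 'I_d -> nat}) | v <- words a]) F w).
  by rewrite big_map.
rewrite fsbig_seq; last by rewrite map_inj_uniq ?fset_uniq //; exact: val_inj.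
rewrite [RHS]fsbig_seq //; apply: fsbig_widen.
- move=> _ /= /mapP[w _ ->]; have [m|f fw] := @letters_upP N w.
    exact: has_type_lt (word_type w) aN.
  by apply/mapP; exists f; rewrite ?mem_enum.
- move=> w [_ /= nw]; apply: F0 => wa; apply: nw; apply/mapP.
  have h : `[< has_type w a >] by apply/asboolP.
  by exists (Word h); rewrite ?in_words.
Qed.

End Words.
Arguments big_words {l d mu R idx op a N F}.

(** * Finiteness of the composition sums *)

Lemma le_fsum (f : nat -> int) N k0 : (forall k, (N <= k)%N -> f k = 0) ->
  (forall k, 0 <= f k) -> f k0 <= \sum_(k \in [set: nat]) f k.
Proof.
move=> fN f0; rewrite (fsbigT_ord fN); case: (ltnP k0 N) => [h|/fN ->]; last first.
  by apply: sumr_ge0.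
by rewrite (bigD1 (Ordinal h)) //= lerDl; apply: sumr_ge0.
Qed.

Lemma fsfun_le (K : choiceType) (f : {fsfun K -> int with 0}) : exists M, forall k, (`|f k| <= M)%N.
Proof.
exists (\max_(k <- finsupp f) `|f k|)%N => k; case: (boolP (k \in finsupp f)) => h.
  exact: (@leq_bigmax_seq _ _ xpredT (fun k => `|f k|%N) _ h isT).
by rewrite fsfun_dflt.
Qed.

Section Tensors.
Variables (l : nat) (a b c : wt l) (r : lmat b c) (s : lmat a b).

(** All entries of [A] but the A_iii, i < l, are bounded by the entry of [r] or [s] to which
    they contribute; A_iii is then determined by r_ii. *)
Lemma tensor_bounded : exists n M : nat, forall q A, is_tensor3 l r q s A ->
  (forall i j k, [|| (n <= i)%N, (n <= j)%N | (n <= k)%N] -> A (i, j, k) = 0) /\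
  (forall x, (`|A x| <= M)%N).
Proof.
have [n1 r0] := fsfun_bound2 r; have [n2 s0] := fsfun_bound2 s.
have [M1 rM] := fsfun_le r; have [M2 sM] := fsfun_le s.
pose n := (l + n1 + n2)%N; exists n, (M1 + M2 + n * M2)%N => q A [A0 Ar _ As].
have [N AN] := fsfun_bound3 A.
have rle i j k : ~~ ((i == j) && (i < l)%N) -> 0 <= A (i, j, k) <= r (i, j).
  move=> ij; have h0 k' : 0 <= A (i, j, k').
    by apply: A0; apply: contra ij => /and3P[-> _ ->].
  rewrite h0 -Ar; apply: (@le_fsum _ N) => // k' Nk.
  by apply: AN; rewrite Nk !orbT.
have sle i j k : ~~ ((j == k) && (j < l)%N) -> 0 <= A (i, j, k) <= s (j, k).
  move=> jk; have h0 i' : 0 <= A (i', j, k).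
    by apply: A0; apply: contra jk => /and3P[/eqP -> -> ->].
  rewrite h0 -As; apply: (@le_fsum (fun i => A (i, j, k)) N) => // k' Nk.
  by apply: AN; rewrite Nk.
have An i j k : [|| (n <= i)%N, (n <= j)%N | (n <= k)%N] -> A (i, j, k) = 0.
  rewrite /n orbA => /orP[h|h].
    have /andP[h1 h2] : 0 <= A (i, j, k) <= r (i, j) by apply: rle; apply/negP; lia.
    by apply/eqP; rewrite eq_le h1 andbT (le_trans h2) // r0 //; lia.
  have /andP[h1 h2] : 0 <= A (i, j, k) <= s (j, k) by apply: sle; apply/negP; lia.
  by apply/eqP; rewrite eq_le h1 andbT (le_trans h2) // s0 //; lia.
split=> // -[[i j] k].
case: (boolP ((i == j) && (i < l)%N)) => [/andP[/eqP ij il]|/(rle i j k) /andP[h1 h2]]; last first.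
  by have := rM (i, j); move: h1 h2; set y := A _; set z := r _; lia.
subst j; case: (boolP ((i == k) && (i < l)%N)) => [/andP[/eqP ik _]|/(sle i i k) /andP[h1 h2]]; last first.
  by have := sM (i, k); move: h1 h2; set y := A _; set z := s _; lia.
subst k; have := Ar i i; rewrite (fsbigT_ord (n := n)); last first.
  by move=> k nk; apply: An; rewrite nk !orbT.
have iln : (i < n)%N by rewrite /n; lia.
rewrite (bigD1 (Ordinal iln)) //= => e.
have le : 0 <= \sum_(k < n | k != Ordinal iln) A (i, i, val k) <= (n * M2)%N%:Z.
  have h (k : 'I_n) : k != Ordinal iln -> 0 <= A (i, i, val k) <= M2%:Z.
    move=> ki; have /andP[h1 h2] : 0 <= A (i, i, val k) <= s (i, val k).
      by apply: sle; rewrite eq_sym -(inj_eq val_inj) /= in ki *; rewrite (negbTE ki).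
    move: h1 h2 (sM (i, val k)); set y := A _; set z := s _ => h1 h2 h3.
    by rewrite h1 /=; lia.
  rewrite sumr_ge0 => [|k /h /andP[]//]; apply: (@le_trans _ _ (\sum_(k < n) M2%:Z)).
    rewrite [X in _ <= X](bigID (fun k => k != Ordinal iln)) /= -[X in X <= _]addr0 lerD //.
      by apply: ler_sum => k /h /andP[].
    by apply: sumr_ge0.
  by rewrite sum_Posz sum_nat_const card_ord.
have := rM (i, i); move: (\sum_(_ < _ | _) _) e le => S e le.
by move: e; set y := A (i, i, i); set z := r (i, i); lia.
Qed.

Lemma finite_tensors q : finite_set [set A | is_tensor3 l r q s A].
Proof.
have [n [M h]] := tensor_bounded.
pose S := allpairs pair (allpairs pair (iota 0 n) (iota 0 n)) (iota 0 n).
apply: (@finite_fsfun_box _ [fset x | x in S]%fset M) => A hA x.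
have [h1 h2] := h _ _ hA; split=> //; case: x => [[i j] k]; rewrite inE => nS.
apply: h1; apply/negPn; rewrite !negb_or -!ltnNge; apply: contra nS => /and3P[hi hj hk].
by apply: allpairs_f; [apply: allpairs_f|]; rewrite mem_iota.
Qed.

Lemma finite_products :
  finite_set [set q : lmat a c | exists A, is_tensor3 l r q s A].
Proof.
have [n [M h]] := tensor_bounded.
pose S := allpairs pair (iota 0 n) (iota 0 n).
have fin := @finite_fsfun_box _ [fset x | x in S]%fset (n * M)%N
  [set q | exists A, is_tensor3 l r q s A].
apply: (@sub_finite_set _ _ ((fun q : lmat a c => q : {fsfun _ -> _ with 0}) @^-1`
   [set q | exists A, is_tensor3 l r q s A])) => //.
apply: finite_preimage; first by move=> q q' _ _; exact: val_inj.
apply: fin => q [A hA] [i k]; have [h1 h2] := h _ _ hA; case: hA => _ _ hq _.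
have qE : q (i, k) = \sum_(j < n) A (i, val j, k).
  by rewrite -hq (fsbigT_ord (n := n)) // => j nj; apply: h1; rewrite nj orbT.
split.
  rewrite inE => nS; rewrite qE big1 // => j _; apply: h1.
  have : ~~ ((i < n) && (k < n))%N.
    apply: contra nS => /andP[hi hk].
    by apply: allpairs_f; rewrite mem_iota.
  by rewrite negb_and -!leqNgt => /orP[] ->; rewrite ?orbT.
rewrite qE -lez_nat abszE (le_trans (ler_norm_sum _ _ _)) //.
apply: (@le_trans _ _ (\sum_(j < n) M%:Z)); last by rewrite sum_Posz sum_nat_const card_ord.
by apply: ler_sum => j _; rewrite -abszE lez_nat.
Qed.

Definition struct_const (q : {fsfun nat * nat -> int with 0}) : intpoly l :=
  \sum_(A \in [set A | is_tensor3 l r q s A]) tensor_coef l A.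

(** The defining sum over all [q] has finite support because every [q] with a nonzero term is
    a marginal of one of the finitely many 3-tensors. *)
Lemma xi_compE (R : comNzRingType) (phi : {rmorphism intpoly l -> R}) (q : lmat a c) :
  (xi_comp phi r s)@_q = phi (struct_const q).
Proof.
pose F (q : lmat a c) := << phi (struct_const q) *g q >>.
have [D D0] : exists D : {fset lmat a c}, forall q', q' \notin D -> F q' = 0.
  exists (fset_set [set q : lmat a c | exists A, is_tensor3 l r q s A]) => q'.
  rewrite in_fset_set; last exact: finite_products.
  rewrite notin_setE /= => h; rewrite /F /struct_const fsbig1 ?raddf0 ?monalgU0 //.
  by move=> A hA; case: h; exists A.
have FE q' : (F q')@_q = phi (struct_const q') *+ (q' == q) by rewrite mcoeffU.
rewrite /xi_comp -/F (fsbigTE D) // raddf_sum /=.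
under eq_bigr do rewrite FE.
case: (boolP (q \in D)) => hq.
  rewrite (bigD1_seq q) ?fset_uniq //= eqxx big1 ?addr0 // => q' /negbTE ->.
  by [].
rewrite big_seq big1 => [|q' hq']; last first.
  by case: eqP => // e; move: hq; rewrite -e hq'.
by have := FE q; rewrite eqxx D0 // mcoeff0 => ->.
Qed.

End Tensors.

(** * Structure constants count intermediate words *)

Section CountWords.
Variables (l d : nat) (mu : l.-tuple nat).
Implicit Types w : {ffun 'I_d -> nat}.

(** Given the outer words, the positions are classified by their pair of outer letters
    (i, k), and an intermediate word with triple counts [A] distributes each class among the
    letters [j] in A_ijk parts: the number of these words is the product of the multinomial
    coefficients of the classes.  If a diagonal entry of [A] is negative at [mu], there is no
    such word and the corresponding factor vanishes. *)
Lemma eval_tensor_coef w w'' (A : {fsfun nat * nat * nat -> int with 0}) N :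
  (forall i j k, ~~ [&& i == j, j == k & (i < l)%N] -> 0 <= A (i, j, k)) ->
  (forall i k, \sum_(j \in [set: nat]) A (i, j, k) = jmat mu w w'' (i, k)) ->
  (l <= N)%N -> (forall m, w m < N)%N -> (forall m, w'' m < N)%N ->
  (forall i j k, [|| (N <= i)%N, (N <= j)%N | (N <= k)%N] -> A (i, j, k) = 0) ->
  ipeval mu (tensor_coef l A) =
  (\sum_(f : {ffun 'I_d -> 'I_N}) (jten mu w (letters_up f) w'' == A))%N.
Proof.
move=> A0 AQ lN wN w''N AN.
have nE i k : (jcount w w'' i k)%:Z = \sum_(j \in [set: nat]) A (i, j, k) +
    (if i == k then nth 0%N mu i else 0%N)%:Z.
  by rewrite AQ jmatE /diag_mu subrK.
have ANj i k j : (N <= j)%N -> A (i, j, k) = 0 by move=> h; apply: AN; rewrite h orbT.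
pose spA i j k : int := A (i, j, k) + diag_mu mu ((i == j) && (j == k)) i.
have jtenA f : (jten mu w (letters_up f) w'' == A) <->
    forall i j k, (jcount3 w (letters_up f) w'' i j k)%:Z = spA i j k.
  split=> [/eqP e i j k|h]; first by rewrite /spA -e jtenE subrK.
  by apply/eqP/fsfunP => -[[i j] k]; rewrite jtenE h addrK.
rewrite /tensor_coef (fsbigT_ord2 (n := N)); last first.
  by move=> i k h; apply: tensor_factor1 => j; apply: AN; case/orP: h => ->; rewrite ?orbT.
rewrite rmorph_prod /=; under eq_bigr do rewrite rmorph_prod /=.
have [neg|pos] := pselect (exists i, spA i i i < 0).
  case: neg => i spi.
  have il : (i < l)%N.
    rewrite ltnNge; apply/negP => li; move: spi; rewrite /spA diag_mu_ge // addr0 ltNge.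
    by rewrite A0 // ltnNge li !andbF.
  have iN := leq_trans il lN.
  rewrite (bigD1 (Ordinal iN)) //= [X in X * _](bigD1 (Ordinal iN)) //=.
  rewrite (@eval_tensor_factor0 l mu A i i N _ lN (ANj i i) (nE i i)) ?mul0r //; last first.
    by move=> j h; apply: A0; exact: h.
  rewrite big1 // => f _; case: eqP => // e; move: spi.
  have /jtenA h : jten mu w (letters_up f) w'' == A by rewrite e.
  by rewrite -h.
have sp0 i j k : 0 <= spA i j k.
  case: (boolP ((i == j) && (j == k))) => [/andP[/eqP ? /eqP ?]|ijk].
    by subst; rewrite leNgt; apply/negP => h; apply: pos; exists k.
  by rewrite /spA diag_muF // addr0 A0 // andbA negb_and ijk.
pose J := ('I_N * 'I_N)%type.
pose c : {ffun 'I_d -> J} := [ffun m => (Ordinal (w''N m), Ordinal (wN m))].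
pose mm (ik : J) (j : 'I_N) := `|spA (val ik.1) (val j) (val ik.2)|%N.
have cE (ik : J) : (\sum_(x < d) (c x == ik))%N = jcount w w'' (val ik.1) (val ik.2).
  rewrite /jcount -sum1_card [RHS]big_mkcond; apply: eq_bigr => x _.
  rewrite ffunE /= inE /= andbC; case: ik => i k /=.
  by rewrite xpair_eqE -!val_eqE /=; case: (_ && _).
have mmE (ik : J) : (\sum_j mm ik j)%N = (\sum_(x < d) (c x == ik))%N.
  rewrite cE; apply/eqP; rewrite -eqz_nat -sum_Posz.
  rewrite (sum_spA lN (ANj _ _) (nE _ _)); apply/eqP/eq_bigr => j _.
  by rewrite /mm gez0_abs.
have fac (ik : J) : ipeval mu (tensor_factor l A (val ik.1) (val ik.2)) *
    (\prod_j (mm ik j)`!)%N%:Z = ((jcount w w'' (val ik.1) (val ik.2))`!)%:Z.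
  apply: (eval_tensor_factor lN (ANj _ _) (nE _ _)) => [j|j].
    exact: A0.
  exact: sp0.
rewrite pair_bigA /=.
have nz : ((\prod_(ik : J) \prod_j (mm ik j)`!)%N%:Z : int) != 0.
  rewrite eqz_nat -lt0n prodn_gt0 // => ik; rewrite prodn_gt0 // => j.
  exact: fact_gt0.
apply: (mulIf nz).
rewrite -prod_Posz -big_split /=; under eq_bigr do rewrite fac -cE.
rewrite !prod_Posz -(multinomial_count mmE) PoszM; congr (Posz _ * _).
apply: eq_bigr => f _; congr nat_of_bool.
have fcE (ik : J) j : fibre_count c f ik j =
    jcount3 w (letters_up f) w'' (val ik.1) (val j) (val ik.2).
  rewrite /fibre_count /jcount3 -sum1_card [RHS]big_mkcond; apply: eq_bigr => x _.
  rewrite !ffunE /= inE /= ffunE; case: ik => i k /=.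
  rewrite -[f x == j](inj_eq val_inj) xpair_eqE -!val_eqE /= -andbA.
  by rewrite [(w x == _) && _]andbC; case: (_ && _).
apply/idP/idP.
- move/forallP => h; apply/jtenA => i j k.
  case: (boolP [&& (i < N)%N, (j < N)%N & (k < N)%N]) => [/and3P[hi hj hk]|nijk].
    have /forallP/(_ (Ordinal hj))/eqP := h (Ordinal hi, Ordinal hk).
    by rewrite fcE /= => ->; rewrite /mm gez0_abs.
  have nijk' : [|| (N <= i)%N, (N <= j)%N | (N <= k)%N].
    by move: nijk; rewrite !negb_and -!leqNgt.
  rewrite /spA AN // add0r.
  have -> : diag_mu mu ((i == j) && (j == k)) i = 0.
    case: (ltnP i l) => il; last exact: diag_mu_ge.
    rewrite diag_muF //; apply: contraL nijk' => /andP[/eqP <- /eqP <-].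
    by rewrite !orbb -ltnNge (leq_trans il).
  congr Posz; apply/eqP/pred0P => m /=; apply/negP => /and3P[/eqP e1 /eqP e2 /eqP e3].
  by case/negP: nijk; rewrite -e1 -e2 -e3 w''N wN ffunE ltn_ord.
- move/jtenA => h; apply/forallP => ik; apply/forallP => j.
  by rewrite fcE /mm -h absz_nat.
Qed.

(** Every intermediate word determines one 3-tensor, its triple counts. *)
Lemma count_words (a b c : wt l) (r : lmat b c) (s : lmat a b) w w'' :
  has_type mu w a -> has_type mu w'' c ->
  ipeval mu (struct_const r s (jmat mu w w'')) =
  \sum_(w' <- words d mu b) ((jmat mu w w' == s) && (jmat mu w' w'' == r))%:R.
Proof.
move=> wa w''c.
pose G w' : int := ((jmat mu w w' == s) && (jmat mu w' w'' == r))%:R.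
have [Na aN] := word_boundP a; have [Nb bN] := word_boundP b.
have [Nc cN] := word_boundP c; have [n [M hM]] := tensor_bounded r s.
pose N := (Na + Nb + Nc + n)%N.
have bN' : word_bound b N by apply: word_bound_leq bN _; rewrite /N; lia.
rewrite (big_words (F := G) bN') => [|w' nw']; last first.
  rewrite /G; case: andP => // -[/eqP e _]; case: nw'.
  by apply: (lmat_jmat (a := a) (w := w) (mu := mu) _).2; rewrite e; exact: (asboolW (lmatP s)).
rewrite /struct_const fsbig_finite; last exact: finite_tensors.
rewrite rmorph_sum /=.
have E A : A \in fset_set [set A | is_tensor3 l r (jmat mu w w'') s A] ->
   ipeval mu (tensor_coef l A) =
   \sum_(f : {ffun 'I_d -> 'I_N}) (jten mu w (letters_up f) w'' == A)%:R.
  rewrite in_fset_set; last exact: finite_tensors.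
  rewrite inE /= => hA; have [h1 _] := hM _ _ hA; case: hA => hA1 _ hA2 _.
  rewrite (@eval_tensor_coef w w'' A N) // => [||m|m|i j k h].
  - by rewrite -sum_Posz; apply: eq_bigr => f _; rewrite natz.
  - case: bN' => //.
  - by apply: leq_trans (has_type_lt m wa aN) _; rewrite /N; lia.
  - by apply: leq_trans (has_type_lt m w''c cN) _; rewrite /N; lia.
  - by apply: h1; move: h; rewrite /N; lia.
rewrite big_seq (eq_bigr _ E) -big_seq exchange_big /=; apply: eq_bigr => f _.
rewrite /G; set T := jten mu w _ w''.
have TP : (T \in fset_set [set A | is_tensor3 l r (jmat mu w w'') s A]) =
    ((jmat mu w (letters_up f) == s) && (jmat mu (letters_up f) w'' == r)).
  rewrite in_fset_set; last exact: finite_tensors.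
  apply/idP/andP => [|[/eqP e1 /eqP e2]]; rewrite inE /=.
    case=> _ h1 _ h2; split; apply/eqP/fsfunP => -[j k].
      by rewrite -h2 jten_sumi.
    by rewrite -h1 jten_sumk.
  have := jten_tensor3 mu w (letters_up f) w''.
  by rewrite e1 e2.
rewrite -TP; case: (boolP (T \in _)) => hT.
  rewrite (bigD1_seq T) ?fset_uniq //= eqxx big1 ?addr0 // => A.
  by rewrite eq_sym => /negbTE ->.
rewrite big_seq big1 // => A hA; case: eqP => // e; by rewrite -e (negbTE hT) in hA.
Qed.

End CountWords.

(** * Matrix coefficients on words *)

Lemma mcoeff_indicator (R : comNzRingType) (K : choiceType) (S : set K) (k : K) :
  finite_set S ->
  (\sum_(q \in S) (<< q >> : {malg R[K]}))@_k = (`[< S k >])%:R.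
Proof.
move=> fS; have -> : \sum_(q \in S) (<< q >> : {malg R[K]}) =
    \sum_(q <- fset_set S) (<< q >> : {malg R[K]}).
  exact: (fsbig_finite _ _ fS).
rewrite raddf_sum /=; under eq_bigr do rewrite mcoeffU.
have Sk : (k \in fset_set S) = `[< S k >].
  by rewrite in_fset_set //; apply/idP/asboolP; rewrite inE.
rewrite -Sk; case: (boolP (k \in _)) => h.
  by rewrite (bigD1_seq k) ?fset_uniq //= eqxx big1 ?addr0 // => q /negbTE ->.
by rewrite big_seq big1 // => q hq; case: eqP => // e; rewrite -e hq in h.
Qed.

Section XCoef.
Variables (R : comNzRingType) (l : nat) (a b : wt l).
Implicit Types f g : {malg R[lmat a b]}.

(** Matrices of pairs of words are not given as elements of [lmat a b]; off that set the
    coefficient is 0. *)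
Definition coef_at f (Q : {fsfun nat * nat -> int with 0}) : R :=
  if insub Q is Some q then f@_q else 0.

Lemma coef_atE f (q : lmat a b) : coef_at f q = f@_q.
Proof. by rewrite /coef_at valK. Qed.

Lemma coef_at_lmat f Q (h : is_lmat a b Q) :
  exists2 q : lmat a b, lmatval q = Q & coef_at f Q = f@_q.
Proof.
have h' : `[< is_lmat a b Q >] by apply/asboolP.
by exists (Lmat h') => //; rewrite -coef_atE.
Qed.

Lemma coef_at_linear (Q : {fsfun nat * nat -> int with 0}) x f g :
  coef_at (x *: f + g) Q = x * coef_at f Q + coef_at g Q.
Proof.
rewrite /coef_at; case: insub => [q|]; last by rewrite mulr0 addr0.
by rewrite mcoeffD mcoeffZ.
Qed.

Lemma coef_at0 Q : coef_at 0 Q = 0.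
Proof. by rewrite /coef_at; case: insub => // q; rewrite mcoeff0. Qed.

Lemma coef_atD Q : {morph coef_at^~ Q : f g / f + g}.
Proof. by move=> f g; have := coef_at_linear Q 1 f g; rewrite scale1r mul1r. Qed.

Lemma coef_atZ Q x f : coef_at (x *: f) Q = x * coef_at f Q.
Proof. by have := coef_at_linear Q x f 0; rewrite coef_at0 !addr0. Qed.

Lemma coef_at_sum (I : Type) (r : seq I) (P : pred I) (F : I -> {malg R[lmat a b]}) Q :
  coef_at (\sum_(i <- r | P i) F i) Q = \sum_(i <- r | P i) coef_at (F i) Q.
Proof. exact: (big_morph (coef_at^~ Q) (coef_atD Q) (coef_at0 Q)). Qed.

Lemma coef_at_supp f Q : coef_at f Q = \sum_(q <- msupp f) f@_q * (Q == lmatval q)%:R.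
Proof.
rewrite {1}[f]monalgE coef_at_sum; apply: eq_bigr => q _.
rewrite /coef_at; case: insubP => [q' _ q'Q|nQ].
  by rewrite mcoeffU -q'Q (inj_eq val_inj) eq_sym; case: eqP; rewrite ?mulr1 ?mulr0.
by case: eqP => [e|_]; [rewrite e lmatP in nQ|rewrite mulr0].
Qed.

End XCoef.

Section Evaluate.
Variables (l d : nat) (mu : l.-tuple nat) (R : comNzRingType).
Variables (phi : {rmorphism intpoly l -> R}) (ev : {rmorphism R -> int}).
Hypothesis evphi : forall x, ev (phi x) = ipeval mu x.
Local Notation Cl := (C0 phi).
Implicit Types w : {ffun 'I_d -> nat}.

Definition wmat (a b : wt l) (f : {malg R[lmat a b]}) w w' : int :=
  ev (coef_at f (jmat mu w w')).

(** At a joint matrix the structure constants count intermediate words, which are summed over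
    in the product of matrices. *)
Lemma wmat_comp (a b c : wt l) (g : lhom (b : lob Cl) c) (f : lhom (a : lob Cl) b) w w'' :
  has_type mu w a -> has_type mu w'' c ->
  wmat (lcomp g f) w w'' = \sum_(w' <- words d mu b) wmat g w' w'' * wmat f w w'.
Proof.
move=> wa w''c; have Ql := jmat_lmat wa w''c.
rewrite /wmat /= /C0_comp coef_at_sum rmorph_sum.
have E (r : lmat b c) (s : lmat a b) : ev (coef_at ((g@_r * f@_s) *: xi_comp phi r s) (jmat mu w w'')) =
   \sum_(w' <- words d mu b) (ev g@_r * (jmat mu w' w'' == r)%:R) * (ev f@_s * (jmat mu w w' == s)%:R).
  rewrite coef_atZ; have [q qQ ->] := coef_at_lmat (xi_comp phi r s) Ql.
  rewrite xi_compE rmorphM /= evphi qQ count_words // rmorphM big_distrr /=.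
  apply: eq_bigr => w' _; rewrite mulrACA; congr (_ * _).
  by rewrite -natrM mulnb andbC.
transitivity (\sum_(r <- msupp g) \sum_(s <- msupp f)
  ev (coef_at ((g@_r * f@_s) *: xi_comp phi r s) (jmat mu w w''))).
  by apply: eq_bigr => r _; rewrite coef_at_sum rmorph_sum.
apply: etrans; first by apply: eq_bigr => r _; apply: eq_bigr => s _; exact: E.
under eq_bigr do rewrite exchange_big /=.
rewrite exchange_big /=; apply: eq_bigr => w' _.
rewrite [coef_at g _]coef_at_supp [coef_at f _]coef_at_supp !rmorph_sum /= big_distrl /=.
apply: eq_bigr => r _; rewrite big_distrr /=; apply: eq_bigr => s _.
by rewrite !rmorphM !rmorph_nat.
Qed.

Lemma wmat_sum (a b : wt l) (I : Type) (r : seq I) (P : pred I) (F : I -> {malg R[lmat a b]}) w w' :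
  wmat (\sum_(i <- r | P i) F i) w w' = \sum_(i <- r | P i) wmat (F i) w w'.
Proof. by rewrite /wmat coef_at_sum rmorph_sum. Qed.

Lemma wmat0 (a b : wt l) w w' : wmat (0 : {malg R[lmat a b]}) w w' = 0.
Proof. by rewrite /wmat coef_at0 rmorph0. Qed.

(** ** Relabellings *)

(** The graph of a partial map carries at most one matrix with given row sums. *)
Lemma finite_relabel (G : nat -> nat -> Prop) (a b : wt l) :
  (forall n m m', G n m -> G n m' -> m = m') ->
  finite_set [set q : lmat a b | forall i j, q (i, j) != 0 -> G i j].
Proof.
move=> Gf; set S := [set q : lmat a b | _].
have SE (q : lmat a b) : S q -> forall i j, q (i, j) = if `[< G i j >] then b i else 0.
  move=> Sq i j; case: asboolP => g; last first.
    by apply/eqP; apply: contrapT => /negP h; apply: g; exact: Sq.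
  have [_ <- _] := asboolW (lmatP q).
  rewrite (fsbigTE [fset j]%fset) ?big_seq_fset1 // => j'; rewrite inE => jj.
  apply/eqP; apply: contraNT jj => /Sq g'; apply/eqP; exact: Gf g' g.
have [[q Sq]|nS] := pselect (exists q, S q); last first.
  by rewrite (_ : S = set0) //; apply/seteqP; split=> // q Sq; case: nS; exists q.
apply: (@sub_finite_set _ _ [set q]); last exact: finite_set1.
move=> q' Sq'; apply: val_inj; apply/fsfunP => -[i j].
by rewrite (SE _ Sq) (SE _ Sq').
Qed.

(** The joint matrix of [w] and [w'] is supported on the graph exactly when, at every
    position, it relates the two letters.  The diagonal condition covers the letters below
    [l], whose offsets may be nonzero without any position carrying them. *)
Lemma wmat_relabel (G : nat -> nat -> Prop) (a b : wt l) w w' :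
  (forall n m m', G n m -> G n m' -> m = m') -> (forall i, (i < l)%N -> G i i) ->
  has_type mu w a -> has_type mu w' b ->
  wmat (relabel G a b) w w' = (`[< forall m, G (w' m) (w m) >])%:R.
Proof.
move=> Gf Gd wa w'b.
rewrite /wmat; have [q qQ ->] := coef_at_lmat (relabel (R := R) G a b) (jmat_lmat wa w'b).
rewrite /relabel mcoeff_indicator; last exact: finite_relabel.
rewrite rmorph_nat; congr ((nat_of_bool _)%:R); apply/asboolP/asboolP => /=.
- move=> h m; apply: contrapT => nG; apply: (nG).
  apply: h; rewrite qQ jmatE.
  have jc : (jcount w w' (w' m) (w m))%:Z != 0.
    by rewrite eqz_nat; apply/negP => /pred0P/(_ m); rewrite /= !eqxx.
  case: (w' m =P w m) => [e|ne]; last by rewrite diag_mu_false subr0.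
  rewrite diag_mu_ge ?subr0 // leqNgt; apply/negP => hl; apply: nG.
  by rewrite -e; apply: Gd.
- move=> h i j; rewrite qQ jmatE.
  have [[m /andP[/eqP <- /eqP <-]]|no] := pselect (exists m, (w m == j) && (w' m == i)).
    by move=> _; exact: h.
  have -> : jcount w w' i j = 0%N.
    by apply/eqP/pred0P => m /=; apply/negP => hm; apply: no; exists m.
  rewrite sub0r oppr_eq0; case: (i =P j) => [<-|]; last by rewrite diag_mu_false eqxx.
  by case: (ltnP i l) => [/Gd //|il]; rewrite diag_mu_ge // eqxx.
Qed.

End Evaluate.

(** * The specialisation functors *)

Lemma sdhom_ext d (M N : sdmod d) (f g : sdhom M N) : sdfun f =1 sdfun g -> f = g.
Proof.
case: f g => f fB fJ [g gB gJ] /= e; have {}e : f = g by apply/funext.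
by subst g; congr SdHom; exact: Prop_irrelevance.
Qed.

Section SpecFunctor.
Variables (l d : nat) (mu : l.-tuple nat) (R : comNzRingType).
Variables (phi : {rmorphism intpoly l -> R}) (ev : {rmorphism R -> int}).
Hypothesis evphi : forall x, ev (phi x) = ipeval mu x.
Local Notation Cl := (C0 phi).

Definition wtag (X : hull Cl) (i : fidx X) (w : word d (spec_wt mu (fam X i))) : fam_word d mu X :=
  Tagged (fun i => word d (spec_wt mu (fam X i))) w.

Lemma word_relE (a b : wt l) (q : lmat a b) (w : word d (spec_wt mu a))
  (w' : word d (spec_wt mu b)) : word_rel q w w' <-> jmat mu w w' = q.
Proof.
split=> [h|e i j].
  apply/fsfunP => -[i j]; rewrite jmatE [X in X - _](h i j) /spec_mat /diag_mu.
  by rewrite addrC addKr.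
by rewrite /spec_mat -e jmatE /diag_mu addrC subrK.
Qed.

Lemma sum_word_rel (V : zmodType) (a b : wt l) (q : lmat a b) (w : word d (spec_wt mu a))
    (F : word d (spec_wt mu b) -> V) :
  \sum_(w' \in word_rel q w) F w' =
  \sum_(w' <- words d mu b) F w' *~ (jmat mu w w' == q)%:R.
Proof.
rewrite fsbig_mkcond (fsbigTE (words d mu b)) => [|w']; last by rewrite in_words.
apply: eq_bigr => w' _; rewrite /patch.
have -> : (w' \in word_rel q w) = (jmat mu w w' == q).
  by apply/idP/eqP; rewrite inE => /word_relE.
by case: ifP => _; rewrite ?mulr1z.
Qed.

Lemma spec_basisE (X Y : hull Cl) (f : lhom X Y) (w : fam_word d mu X) :
  spec_basis ev f w = \sum_(i : fidx Y) \sum_(w' <- words d mu (fam Y i))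
    << wtag w' >> *~ wmat mu ev (f i (tag w)) (tagged w) w'.
Proof.
rewrite /spec_basis; apply: eq_bigr => i _.
under eq_bigr do rewrite sum_word_rel.
under eq_bigr do rewrite mulrz_suml.
rewrite exchange_big /=; apply: eq_bigr => w' _.
rewrite /wmat coef_at_supp rmorph_sum /= mulrz_sumr.
by apply: eq_bigr => q _; rewrite -mulrzA rmorphM rmorph_nat mulrC.
Qed.

Lemma mcoeff_spec_basis (X Y : hull Cl) (f : lhom X Y) (w : fam_word d mu X) i
    (w' : word d (spec_wt mu (fam Y i))) :
  (spec_basis ev f w)@_(wtag w') = wmat mu ev (f i (tag w)) (tagged w) w'.
Proof.
rewrite spec_basisE raddf_sum /= (bigD1 i) //= [X in _ + X]big1 ?addr0 => [|k ki]; last first.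
  rewrite raddf_sum big1 // => v _; rewrite raddfMz /= mcoeffU.
  by case: eqP => [/(congr1 tag) /= e|_]; [rewrite e eqxx in ki|rewrite mul0rz].
rewrite raddf_sum /=.
transitivity (\sum_(v <- words d mu (fam Y i)) wmat mu ev (f i (tag w)) (tagged w) v *+ (v == w')).
  apply: eq_bigr => v _; rewrite (raddfMz (mcoeff (wtag w'))) /= mcoeffU.
  rewrite (_ : (wtag v == wtag w') = (v == w')); first by case: (v == w'); rewrite ?intz // mul0rz.
  by apply/eqP/eqP => [e|-> //]; exact: eq_from_Tagged e.
rewrite (bigD1_seq w') ?in_words ?fset_uniq //= eqxx big1 ?addr0 // => v /negbTE -> //.
Qed.

Lemma spec_functor : is_functor (spec d mu phi ev).
Proof.
split.
- move=> X; apply: sdhom_ext; apply: malg_ext => [x y|x y|w] //=; first by rewrite raddfB.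
  rewrite mlinU; case: w => j w; rewrite spec_basisE (bigD1 j) //=.
  rewrite [X in _ + X]big1 ?addr0 => [|i ij]; last first.
    rewrite big1 // => v _; rewrite /fam_id /=; case: eqP => [e|_]; first by rewrite e eqxx in ij.
    by rewrite wmat0.
  have idj : @fam_id _ Cl X j j = relabel eq (fam X j) (fam X j).
    by rewrite /fam_id; case: eqP => // e; rewrite eq_axiomK.
  rewrite idj (bigD1_seq w) ?in_words ?fset_uniq //=.
  have W (v : word d (spec_wt mu (fam X j))) : wmat mu ev (relabel eq (fam X j) (fam X j)) w v = (w == v)%:R.
    rewrite wmat_relabel; [|by move=> n m m' -> ->|by []|exact: word_type|exact: word_type].
    congr ((nat_of_bool _)%:R); apply/asboolP/eqP => [h|-> //].
    by apply/val_inj/ffunP => m; rewrite h.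
  rewrite W eqxx big1 ?addr0 => [|v]; first by rewrite mulr1z.
  by rewrite W eq_sym => /negbTE ->.
- move=> X Y Z g f; apply: sdhom_ext; apply: malg_ext => [x y|x y|w] //=.
  + by rewrite raddfB.
  + by rewrite !raddfB.
  rewrite !mlinU spec_basisE [spec_basis ev f w]spec_basisE raddf_sum.
  pose F i (w'' : word d (spec_wt mu (fam Z i))) k (w' : word d (spec_wt mu (fam Y k))) :
      {malg int[fam_word d mu Z]} :=
    << wtag w'' >> *~ (wmat mu ev (g i k) w' w'' * wmat mu ev (f k (tag w)) (tagged w) w').
  transitivity (\sum_i \sum_(w'' <- words d mu (fam Z i)) \sum_k
      \sum_(w' <- words d mu (fam Y k)) F i w'' k w').
    apply: eq_bigr => i _; apply: eq_bigr => w'' _.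
    rewrite /fam_comp wmat_sum mulrz_sumr; apply: eq_bigr => k _.
    rewrite wmat_comp; [|exact: evphi|exact: word_type|exact: word_type].
    by rewrite mulrz_sumr.
  transitivity (\sum_k \sum_(w' <- words d mu (fam Y k)) \sum_i
      \sum_(w'' <- words d mu (fam Z i)) F i w'' k w'); last first.
    apply: eq_bigr => k _; rewrite raddf_sum; apply: eq_bigr => w' _.
    rewrite (raddfMz (mlin (spec_basis ev g))) /= mlinU spec_basisE mulrz_suml; apply: eq_bigr => i _.
    by rewrite mulrz_suml; apply: eq_bigr => w'' _; rewrite /F mulrzA.
  under eq_bigr do rewrite exchange_big /=.
  rewrite exchange_big /=; apply: eq_bigr => k _.
  under eq_bigr do rewrite exchange_big /=.
  by rewrite exchange_big.
Qed.

End SpecFunctor.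

(** * Bilinear extension *)

Section BilinearExtension.
Variables (R : comNzRingType) (V : lmodType R).

Definition lext (K : choiceType) (B : K -> V) (f : {malg R[K]}) : V :=
  \sum_(k <- msupp f) f@_k *: B k.

Lemma lextEw (K : choiceType) (B : K -> V) (D : {fset K}) f :
  (msupp f `<=` D)%fset -> lext B f = \sum_(k <- D) f@_k *: B k.
Proof.
move=> fD; apply: big_fset_incl => // k _ kf.
by rewrite (mcoeff_outdom kf) scale0r.
Qed.

Lemma lext_linear (K : choiceType) (B : K -> V) x f g :
  lext B (x *: f + g) = x *: lext B f + lext B g.
Proof.
pose D := (msupp f `|` msupp g `|` msupp (x *: f + g))%fset.
have [fD gD hD] : [/\ msupp f `<=` D, msupp g `<=` D & msupp (x *: f + g) `<=` D]%fset.
  by split; apply/fsubsetP => k; rewrite !inE => ->; rewrite ?orbT.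
rewrite (lextEw B fD) (lextEw B gD) (lextEw B hD).
rewrite scaler_sumr -big_split; apply: eq_bigr => k _ /=.
by rewrite mcoeffD mcoeffZ scalerDl scalerA.
Qed.

Definition bext (K L : choiceType) (B : K -> L -> V) (f : {malg R[K]}) (g : {malg R[L]}) : V :=
  \sum_(k <- msupp f) \sum_(j <- msupp g) (f@_k * g@_j) *: B k j.

Lemma bextE (K L : choiceType) (B : K -> L -> V) f g :
  bext B f g = lext (fun k => lext (B k) g) f.
Proof.
by apply: eq_bigr => k _; rewrite scaler_sumr; apply: eq_bigr => j _; rewrite scalerA.
Qed.

Lemma bextC (K L : choiceType) (B : K -> L -> V) f g :
  bext B f g = bext (fun j k => B k j) g f.
Proof.
rewrite /bext exchange_big /=; apply: eq_bigr => j _; apply: eq_bigr => k _.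
by rewrite mulrC.
Qed.

Lemma bext_linearl (K L : choiceType) (B : K -> L -> V) x f f' g :
  bext B (x *: f + f') g = x *: bext B f g + bext B f' g.
Proof. by rewrite !bextE lext_linear. Qed.

Lemma bext_linearr (K L : choiceType) (B : K -> L -> V) x f g g' :
  bext B f (x *: g + g') = x *: bext B f g + bext B f g'.
Proof. by rewrite !(bextC B) bext_linearl. Qed.

End BilinearExtension.

(** * Faithfulness of the specialisations *)

Lemma card_nth (T : Type) (x0 : T) (P : pred T) (s : seq T) d : size s = d ->
  #|[pred m : 'I_d | P (nth x0 s m)]| = count P s.
Proof.
move=> <-; rewrite -sum1_card -sum1_count big_mkcond [RHS]big_mkcond (big_nth x0) big_mkord.
by apply: eq_bigr => i _; rewrite inE.
Qed.

(** Write down, for every entry of the matrix, as many positions with that pair of letters as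
    the entry says; the offsets sum to 0, so the length is that of [mu]. *)
Lemma realise_lmat l (mu : l.-tuple nat) (a b : wt l) (q : lmat a b) :
  (forall i j, 0 <= spec_mat mu q i j) ->
  exists w w' : {ffun 'I_(sumn mu) -> nat}, jmat mu w w' = q.
Proof.
move=> sp0; have [n0 q0] := fsfun_bound2 q; pose n := (n0 + l)%N.
have qn i j : (n <= i)%N || (n <= j)%N -> q (i, j) = 0 by move=> h; apply: q0; rewrite /n in h; lia.
pose s (x : nat * nat) := `|spec_mat mu q x.1 x.2|%N.
have sE i j : (s (i, j))%:Z = q (i, j) + diag_mu mu (i == j) i.
  by rewrite /s gez0_abs // /spec_mat addrC.
have s0 i j : (n <= i)%N || (n <= j)%N -> s (i, j) = 0%N.
  move=> h; apply/eqP; rewrite -eqz_nat sE qn // add0r.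
  case: (i =P j) => [e|_] //; rewrite diag_mu_ge //; rewrite /n in h; lia.
pose box := allpairs pair (iota 0 n) (iota 0 n).
have box_uniq : uniq box by apply: allpairs_uniq; rewrite ?iota_uniq // => -[? ?] [? ?].
pose L := flatten [seq nseq (s x) x | x <- box].
have boxP x : (x \in box) = (x.1 < n)%N && (x.2 < n)%N.
  case: x => i j; apply/allpairsP/andP => [[[i' j'] [h1 h2 [-> ->]]]|[h1 h2]].
    by move: h1 h2; rewrite !mem_iota.
  by exists (i, j); rewrite !mem_iota.
have cL x : count_mem x L = s x.
  rewrite count_flatten -map_comp sumnE big_map.
  under eq_bigr do rewrite /= count_nseq.
  case: (boolP (x \in box)) => hx.
    rewrite (bigD1_seq x) //= eqxx mul1n big1 ?addn0 // => y.
    by rewrite /= => /negbTE ->.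
  rewrite big_seq big1 => [|y hy]; last first.
    rewrite /=; case: (y =P x) => [e|//]; by rewrite -e hy in hx.
  by case: x hx => i j; rewrite boxP negb_and -!leqNgt => /s0 ->.
have sL : size L = sumn mu.
  apply/eqP; rewrite -eqz_nat size_flatten /shape -map_comp sumnE big_map.
  under eq_bigr do rewrite /= size_nseq.
  rewrite big_allpairs -sum_Posz.
  have iotaE (F : nat -> int) : \sum_(i <- iota 0 n) F i = \sum_(i < n) F i.
    by rewrite -(big_mkord xpredT) /index_iota subn0.
  rewrite iotaE; apply/eqP.
  transitivity (\sum_(i < n) \sum_(j < n) (q (val i, val j) + diag_mu mu (val i == val j) i)).
    apply: eq_bigr => i _; rewrite -sum_Posz iotaE.
    by apply: eq_bigr => j _; rewrite sE.
  have [_ hr _] := asboolW (lmatP q); have [_ hb] := asboolW (wtP b).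
  have rowE (i : 'I_n) : \sum_(j < n) (q (val i, val j) + diag_mu mu (val i == val j) i) =
      b i + (nth 0%N mu i)%:Z.
    rewrite big_split /= -hr (fsbigT_ord (n := n)); last by move=> j h; rewrite qn // h orbT.
    congr (_ + _); rewrite (bigD1 i) //= eqxx big1 ?addr0 // => j.
    by rewrite eq_sym -val_eqE /= => /negbTE ->.
  under eq_bigr do rewrite rowE.
  rewrite big_split /= -(fsbigT_ord (n := n) (f := b)); last first.
    move=> i h; rewrite -hr fsbig1 // => j _; apply: qn; by rewrite h.
  rewrite hb add0r sum_Posz; congr Posz; rewrite sumnE (big_nth 0%N) size_tuple big_mkord.
  rewrite /n addnC big_split_ord /= [X in (_ + X)%N]big1 ?addn0 // => i _.
  by rewrite nth_mu_default // leq_addr.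
pose w := [ffun m : 'I_(sumn mu) => (nth (0, 0)%N L m).2].
pose w' := [ffun m : 'I_(sumn mu) => (nth (0, 0)%N L m).1].
exists w, w'; apply/fsfunP => -[i j]; rewrite jmatE.
have -> : jcount w w' i j = s (i, j).
  rewrite -cL -(card_nth (0, 0)%N _ sL); apply: eq_card => m.
  by rewrite !inE !ffunE /= andbC -xpair_eqE -surjective_pairing.
by rewrite sE addrK.
Qed.

(** A ring map [R -> Z] through which the scalars [lambda_i] are specialised to a
    composition. *)
Record evaluation (l : nat) (R : comNzRingType) (phi : {rmorphism intpoly l -> R}) :=
  Evaluation {
    ev_mu : l.-tuple nat;
    ev_hom : {rmorphism R -> int};
    ev_homE : forall x, ev_hom (phi x) = ipeval ev_mu x }.

(** The evaluations at large compositions separate the scalars. *)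
Definition enough_evaluations (l : nat) (R : comNzRingType)
    (phi : {rmorphism intpoly l -> R}) : Prop :=
  forall (r : R) (N : nat),
    (forall E : evaluation phi, (forall i, (i < l)%N -> (N <= nth 0%N (ev_mu E) i)%N) ->
      ev_hom E r = 0) -> r = 0.

Lemma phi_id_enough l : enough_evaluations (phi_id l).
Proof.
move=> r N h; apply: (@intpoly_eq0 _ _ N) => mu hmu.
have e x : (ipeval mu : {rmorphism intpoly l -> int}) (phi_id l x) = ipeval mu x by [].
by apply: (h (Evaluation e)) => i il /=; have := hmu (Ordinal il); rewrite (tnth_nth 0%N).
Qed.

Lemma phi_sum_eval l (mu : l.-tuple nat) d x : sumn mu = d ->
  ipeval mu (phi_sum l x) = ipeval [tuple d] x.
Proof. exact: ipeval_sumsubst. Qed.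

Lemma phi_sum_enough l : enough_evaluations (phi_sum l.+1).
Proof.
move=> r N h; apply: (@intpoly_eq0 _ _ N) => mu hmu.
have e x : (ipeval mu : {rmorphism intpoly l.+1 -> int}) (phi_sum l.+1 x) =
    ipeval [tuple sumn mu] x by exact: phi_sum_eval.
apply: (h (Evaluation e)) => -[|//] _ /=.
apply: leq_trans (hmu ord0) _; rewrite (tnth_nth 0%N) /=.
by case: (mu) => -[|x s] //= _; rewrite leq_addr.
Qed.

Section Faithful.
Variables (l : nat) (R : comNzRingType) (phi : {rmorphism intpoly l -> R}).
Hypothesis Hphi : enough_evaluations phi.
Local Notation Cl := (C0 phi).

(** At an evaluation with [mu] large, the coefficient at [q] is the matrix entry at a pair of
    words with joint matrix [q]. *)
Lemma C0_faithful (a b : wt l) (f : {malg R[lmat a b]}) :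
  (forall (E : evaluation phi) (w w' : {ffun 'I_(sumn (ev_mu E)) -> nat}),
     has_type (ev_mu E) w a -> has_type (ev_mu E) w' b ->
     wmat (ev_mu E) (ev_hom E) f w w' = 0) -> f = 0.
Proof.
move=> h; apply/malgP => q; rewrite mcoeff0.
have [M qM] := fsfun_le q; apply: (Hphi (N := M)) => E muM.
have [|w [w' e]] := @realise_lmat l (ev_mu E) a b q.
  move=> i j; rewrite /spec_mat.
  have [q0 _ _] := asboolW (lmatP q).
  case: (boolP ((i == j) && (i < l)%N)) => [/andP[/eqP <- il]|ij].
    rewrite eqxx /=; move: (muM i il) (qM (i, i)); set y := q _; set z := nth _ _ _.
    by lia.
  by apply: addr_ge0 => //; apply: q0.
have [wa w'b] : has_type (ev_mu E) w a /\ has_type (ev_mu E) w' b.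
  by apply: lmat_jmat; rewrite e; exact: asboolW (lmatP q).
by have := h E w w' wa w'b; rewrite /wmat e coef_atE.
Qed.

Lemma C0_ext (a b : wt l) (f g : {malg R[lmat a b]}) :
  (forall (E : evaluation phi) (w w' : {ffun 'I_(sumn (ev_mu E)) -> nat}),
     has_type (ev_mu E) w a -> has_type (ev_mu E) w' b ->
     wmat (ev_mu E) (ev_hom E) f w w' = wmat (ev_mu E) (ev_hom E) g w w') -> f = g.
Proof.
move=> h; apply/eqP; rewrite -subr_eq0; apply/eqP/C0_faithful => E w w' wa w'b.
rewrite /wmat -scaleN1r addrC coef_at_linear rmorphD rmorphM rmorphN1 mulN1r.
by have := h E w w' wa w'b; rewrite /wmat => ->; rewrite addNr.
Qed.

Lemma spec_faithful (X Y : hull Cl) (f g : lhom X Y) :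
  (forall E : evaluation phi,
     fmap (spec (sumn (ev_mu E)) (ev_mu E) phi (ev_hom E)) f =
     fmap (spec (sumn (ev_mu E)) (ev_mu E) phi (ev_hom E)) g) -> f = g.
Proof.
move=> h; apply: dmatP => i j; apply: C0_ext => E w w' wj w'i.
have wj' : `[< has_type (ev_mu E) w (fam X j) >] by apply/asboolP.
have wi' : `[< has_type (ev_mu E) w' (fam Y i) >] by apply/asboolP.
pose v : fam_word (sumn (ev_mu E)) (ev_mu E) X := wtag (Word wj').
pose S := spec (sumn (ev_mu E)) (ev_mu E) phi (ev_hom E).
have := congr1 (fun F : sdhom (S X) (S Y) =>
  mcoeff (wtag (Word wi')) (sdfun F (<< v >> : {malg int[fam_word _ _ X]}))) (h E).
by rewrite /= !mlinU !mcoeff_spec_basis.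
Qed.

End Faithful.

Section LinearCategory.
Variables (l : nat) (R : comNzRingType) (phi : {rmorphism intpoly l -> R}).
Local Notation Cl := (C0 phi).

Lemma C0_compE (a b c : wt l) (g : lhom (b : lob Cl) c) (f : lhom (a : lob Cl) b) :
  lcomp g f = bext (fun r s => xi_comp phi r s) g f.
Proof. by []. Qed.

Lemma C0_linear_of_category : is_category Cl -> is_linear_category Cl.
Proof.
move=> H; split=> // [X Y Z x g g' f|X Y Z x g f f'].
  by rewrite !C0_compE bext_linearl.
by rewrite !C0_compE bext_linearr.
Qed.

(** Matrices over Z satisfy the axioms of a category, and morphisms are determined by their
    matrices. *)
Lemma C0_linear : enough_evaluations phi -> is_linear_category Cl.
Proof.
move=> Hphi; apply: C0_linear_of_category.
have wid (E : evaluation phi) (a : wt l) (w w' : {ffun 'I_(sumn (ev_mu E)) -> nat}) :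
    has_type (ev_mu E) w a -> has_type (ev_mu E) w' a ->
    wmat (ev_mu E) (ev_hom E) (lidm (a : lob Cl)) w w' = (w' == w)%:R.
  move=> wa w'a; rewrite wmat_relabel //; last by move=> n m m' -> ->.
  congr ((nat_of_bool _)%:R); apply/asboolP/eqP => [h|-> //].
  exact/ffunP.
have wordof (E : evaluation phi) (a : wt l) (w : {ffun 'I_(sumn (ev_mu E)) -> nat}) :
    has_type (ev_mu E) w a -> exists v : word (sumn (ev_mu E)) (spec_wt (ev_mu E) a), w = v.
  move=> wa; have wa' : `[< has_type (ev_mu E) w a >] by apply/asboolP.
  by exists (Word wa').
split.
- move=> X Y f; apply: (C0_ext Hphi) => E w w' wX w'Y.
  rewrite /comp /= wmat_comp //; last exact: ev_homE.
  have [v e] := wordof _ _ _ w'Y; subst w'.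
  rewrite (bigD1_seq v) ?in_words ?fset_uniq //= wid // eqxx mul1r big1 ?addr0 // => u uv.
  rewrite wid //; last exact: word_type.
  by case: eqP => [/val_inj e|]; [rewrite e eqxx in uv|rewrite mul0r].
- move=> X Y f; apply: (C0_ext Hphi) => E w w' wX w'Y.
  rewrite /comp /= wmat_comp //; last exact: ev_homE.
  have [v e] := wordof _ _ _ wX; subst w.
  rewrite (bigD1_seq v) ?in_words ?fset_uniq //= wid // eqxx mulr1 big1 ?addr0 // => u uv.
  rewrite wid //; last exact: word_type.
  by case: eqP => [/val_inj e|]; [rewrite e eqxx in uv|rewrite mulr0].
- move=> X Y Z T h g f; apply: (C0_ext Hphi) => E w w' wX w'T.
  rewrite /comp /= !(wmat_comp (@ev_homE _ _ _ E)) //.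
  transitivity (\sum_(v <- words _ (ev_mu E) Z) \sum_(u <- words _ (ev_mu E) Y)
      wmat (ev_mu E) (ev_hom E) h v w' *
      (wmat (ev_mu E) (ev_hom E) g u v * wmat (ev_mu E) (ev_hom E) f w u)).
    apply: eq_bigr => v _; rewrite (wmat_comp (@ev_homE _ _ _ E)) ?big_distrr //.
    exact: word_type.
  rewrite exchange_big /=; apply: eq_bigr => u _.
  rewrite (wmat_comp (@ev_homE _ _ _ E)) ?big_distrl //; last exact: word_type.
  by apply: eq_bigr => v _; rewrite mulrA.
Qed.

End LinearCategory.

(** * Finiteness of the sums defining the action *)

Definition unpos (l n : nat) : nat * nat :=
  if (n < l)%N then (0%N, n) else odflt (0%N, 0%N) (choice.unpickle (n - l)).

Lemma posK l : cancel (pos l) (unpos l).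
Proof.
case=> i j; rewrite /pos /unpos /=; case: (boolP (_ && _)) => [/andP[/eqP -> ->] //|_].
by rewrite ltnNge leq_addr /= addKn choice.pickleK.
Qed.

Lemma pos_inj l : injective (pos l). Proof. exact: can_inj (@posK l). Qed.

Lemma pos0 l j : (j < l)%N -> pos l (0%N, j) = j.
Proof. by rewrite /pos /= => ->. Qed.

Lemma pos_lt l i j : (pos l (i, j) < l)%N = (i == 0%N) && (j < l)%N.
Proof.
rewrite /pos /=; case: (boolP (_ && _)) => [h|_]; last by rewrite ltnNge leq_addr.
by case/andP: h.
Qed.

Lemma le_fsum_fset (K : choiceType) (D : {fset K}) (f : K -> int) k0 :
  (forall k, k \notin D -> f k = 0) -> (forall k, 0 <= f k) ->
  f k0 <= \sum_(k \in [set: K]) f k.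
Proof.
move=> fD f0; rewrite (fsbigTE D _ fD); case: (boolP (k0 \in D)) => [h|/fD ->]; last first.
  by apply: sumr_ge0.
by rewrite (bigD1_seq k0) ?fset_uniq //= lerDl; apply: sumr_ge0.
Qed.

(** Entries in other rows than [i0] or in columns outside [Jx] are bounded by the sum of their
    row or column; the remaining ones are then determined by their column. *)
Lemma marginals_bounded (I J : choiceType) (i0 : I) (Jx : {fset J})
    (r : {fsfun I -> int with 0}) (c : {fsfun J -> int with 0}) :
  exists (D : {fset I * J}) (M : nat), forall (S : {fset I * J}) (x : I * J -> int),
    (forall ij, ij \notin S -> x ij = 0) ->
    (forall i j, ~~ ((i == i0) && (j \in Jx)) -> 0 <= x (i, j)) ->
    (forall i, \sum_(j \in [set: J]) x (i, j) = r i) ->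
    (forall j, \sum_(i \in [set: I]) x (i, j) = c j) ->
    forall ij, (ij \notin D -> x ij = 0) /\ (`|x ij| <= M)%N.
Proof.
have [M1 rM] := fsfun_le r; have [M2 cM] := fsfun_le c.
pose DI := (i0 |` finsupp r)%fset; pose DJ := (Jx `|` finsupp c)%fset.
exists (DI `*` DJ)%fset, (M1 + M2 + #|` DI| * M1)%N => S x xS x0 xr xc.
have rowS i j : j \notin [fset ij.2 | ij in S]%fset -> x (i, j) = 0.
  by move=> h; apply: xS; apply: contra h => h; apply/imfsetP; exists (i, j).
have colS j i : i \notin [fset ij.1 | ij in S]%fset -> x (i, j) = 0.
  by move=> h; apply: xS; apply: contra h => h; apply/imfsetP; exists (i, j).
have rle i j : i != i0 -> 0 <= x (i, j) <= r i.
  move=> ii; have h j' : 0 <= x (i, j') by apply: x0; rewrite (negbTE ii).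
  by rewrite h -xr; apply: (le_fsum_fset (f := fun j => x (i, j)) (D := [fset ij.2 | ij in S]%fset)) => //; exact: rowS.
have cle i j : j \notin Jx -> 0 <= x (i, j) <= c j.
  move=> jj; have h i' : 0 <= x (i', j) by apply: x0; rewrite (negbTE jj) andbF.
  by rewrite h -xc; apply: (le_fsum_fset (f := fun i => x (i, j)) (D := [fset ij.1 | ij in S]%fset)) => //; exact: colS.
case=> i j; split.
  rewrite inE /= negb_and !inE !negb_or => /orP[/andP[ii ir]|/andP[jj jc]].
    by have := rle i j ii; rewrite fsfun_dflt // -eq_le => /eqP.
  by have := cle i j jj; rewrite (fsfun_dflt jc) -eq_le => /eqP.
have bound : forall y z : int, 0 <= y <= z -> (`|y| <= `|z|)%N.
  by move=> y z /andP[]; lia.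
case: (boolP (i == i0)) => [/eqP ->|ii]; last first.
  by apply: leq_trans (bound _ _ (rle i j ii)) _; rewrite (leq_trans (rM i)) // -addnA leq_addr.
case: (boolP (j \in Jx)) => jj; last first.
  by apply: leq_trans (bound _ _ (cle i0 j jj)) _; rewrite (leq_trans (cM j)) // addnAC addnC leq_addr.
have xI i' : i' \notin DI -> x (i', j) = 0.
  rewrite !inE negb_or => /andP[ii ir].
  by have := rle i' j ii; rewrite (fsfun_dflt ir) -eq_le => /eqP.
have := xc j; rewrite (fsbigTE DI _ xI) (bigD1_seq i0) ?fset_uniq ?inE ?eqxx //= => e.
have le : 0 <= \sum_(i' <- DI | i' != i0) x (i', j) <= (#|` DI| * M1)%N%:Z.
  have h i' : i' != i0 -> 0 <= x (i', j) <= M1%:Z.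
    move=> h; have /andP[h1 h2] := rle i' j h; rewrite h1 /=.
    by move: h1 h2 (rM i'); set y := x _; set z := r _; lia.
  rewrite sumr_ge0 => [|i' /h /andP[]//]; apply: (@le_trans _ _ (\sum_(i' <- DI) M1%:Z)).
    rewrite [X in _ <= X](bigID (fun i' => i' != i0)) /= -[X in X <= _]addr0 lerD //.
      by apply: ler_sum => i' /h /andP[].
    by apply: sumr_ge0.
  by rewrite sum_Posz big_const_seq count_predT iter_addn_0 mulnC.
have := cM j; move: (\sum_(_ <- _ | _) _) e le => S' e /andP[le1 le2].
by move: e; set y := x (i0, j); set z := c j; lia.
Qed.

Lemma fsum_pair (I J : choiceType) (S : {fset I * J}) (x : I * J -> int) :
  (forall ij, ij \notin S -> x ij = 0) ->
  \sum_(ij \in [set: I * J]) x ij =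
  \sum_(i \in [set: I]) \sum_(j \in [set: J]) x (i, j).
Proof.
move=> xS; pose DI := [fset ij.1 | ij in S]%fset; pose DJ := [fset ij.2 | ij in S]%fset.
have colS i j : i \notin DI -> x (i, j) = 0.
  by move=> h; apply: xS; apply: contra h => h; apply/imfsetP; exists (i, j).
have rowS i j : j \notin DJ -> x (i, j) = 0.
  by move=> h; apply: xS; apply: contra h => h; apply/imfsetP; exists (i, j).
have e i : \sum_(j \in [set: J]) x (i, j) = \sum_(j <- DJ) x (i, j).
  by apply: fsbigTE; exact: rowS.
rewrite (eq_fsbigr (fun i => \sum_(j <- DJ) x (i, j))) => [|i _]; last exact: e.
rewrite (fsbigTE DI) => [|i h]; last by rewrite big1 // => j _; exact: colS.
under eq_bigr do rewrite fsbig_seq ?fset_uniq //.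
rewrite fsbig_seq ?fset_uniq // pair_fsbig ?finite_fset //=.
apply/esym; rewrite (eq_fsbigr (fun ij => x ij)) => [|[i j] _] //.
apply: fsbig_widen => // -[i j] [_ /= h]; apply: contrapT => /eqP xij; apply: h.
split; apply: contrapT => /negP h; case/eqP: xij; [exact: colS|exact: rowS].
Qed.

Section ActionIndex.
Variable l : nat.

Lemma off_pos_ge n : (forall ij, n <> pos l ij) -> (l <= n)%N.
Proof. by move=> h; rewrite leqNgt; apply/negP => nl; apply: (h (0%N, n)); rewrite pos0. Qed.

Lemma pos_supp (f : {fsfun nat -> int with 0}) ij :
  ij \notin [fset unpos l n | n in finsupp f]%fset -> f (pos l ij) = 0.
Proof.
move=> h; apply: fsfun_dflt; apply: contra h => h; apply/imfsetP.
by exists (pos l ij); rewrite // posK.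
Qed.

(** The entries at numbers of matrix positions already sum to 0, like [a]; the remaining ones
    are nonnegative and sum to 0 as well. *)
Lemma act_index_off_pos (a : wt 1) (b v : wt l) n :
  act_index a b v -> (forall ij, n <> pos l ij) -> v n = 0.
Proof.
move=> [va vb] nn; have ln := off_pos_ge nn.
have [v0 v_sum] := asboolW (wtP v); have [_ a_sum] := asboolW (wtP a).
pose v' n := if pos l (unpos l n) == n then v n else 0.
have s1 : \sum_(n \in [set: nat]) v' n = 0.
  rewrite -[RHS]a_sum.
  transitivity (\sum_(i \in [set: nat]) \sum_(j \in [set: nat]) v (pos l (i, j))); last first.
    by apply: eq_fsbigr => i _; exact: va.
  rewrite -(@fsum_pair _ _ [fset unpos l n | n in finsupp v]%fset (fun ij => v (pos l ij))); last first.
    by move=> ij; exact: pos_supp.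
  have inj : set_inj [set: nat * nat] (pos l) by move=> x y _ _; exact: pos_inj.
  rewrite -(fsbig_image _ _ (fun n => v n) inj).
  rewrite [RHS]fsbig_mkcond; apply: eq_fsbigr => k _; rewrite /v' /patch.
  case: eqP => e; first by rewrite ifT // inE; exists (unpos l k).
  by rewrite ifF //; apply/negP; rewrite inE => -[ij _ e']; apply: e; rewrite -e' posK.
have supp k : k \notin finsupp v -> v k - v' k = 0.
  by move=> h; rewrite /v' fsfun_dflt //; case: ifP; rewrite subrr.
have s2 : \sum_(n \in [set: nat]) (v n - v' n) = 0.
  rewrite (@fsumB _ (finsupp v)) ?s1 ?v_sum ?subrr //.
    by move=> k h; rewrite fsfun_dflt.
  by move=> k h; rewrite /v' fsfun_dflt //; case: ifP.
have ge0 k : 0 <= v k - v' k.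
  rewrite /v'; case: eqP => e; first by rewrite subrr.
  rewrite subr0; apply: v0; apply: off_pos_ge => ij e'; apply: e.
  by rewrite e' posK.
have := le_fsum_fset n supp ge0; rewrite s2 /v'; case: eqP => [e|_]; first by case: (nn (unpos l n)).
by rewrite subr0 => h; apply/eqP; rewrite eq_le h v0.
Qed.

Lemma lmat_row0 (v v' : wt l) (u : lmat v v') n m : (l <= n)%N -> v' n = 0 -> u (n, m) = 0.
Proof.
move=> ln vn; have [u0 ur _] := asboolW (lmatP u).
have u0' k : 0 <= u (n, k) by apply: u0; rewrite negb_and -leqNgt ln orbT.
have := @le_fsum_fset _ [fset x.2 | x in finsupp u]%fset (fun k => u (n, k)) m.
rewrite ur vn => h; apply/eqP; rewrite eq_le u0' andbT h //.
by move=> k hk; apply: fsfun_dflt; apply: contra hk => hk; apply/imfsetP; exists (n, k).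
Qed.

Lemma lmat_col0 (v v' : wt l) (u : lmat v v') n m : (l <= m)%N -> v m = 0 -> u (n, m) = 0.
Proof.
move=> lm vm; have [u0 _ uc] := asboolW (lmatP u).
have u0' k : 0 <= u (k, m).
  by apply: u0; rewrite negb_and -leqNgt; case: eqP => [->|] //=; rewrite lm.
have := @le_fsum_fset _ [fset x.1 | x in finsupp u]%fset (fun k => u (k, m)) n.
rewrite uc vm => h; apply/eqP; rewrite eq_le u0' andbT h //.
by move=> k hk; apply: fsfun_dflt; apply: contra hk => hk; apply/imfsetP; exists (k, m).
Qed.

Lemma finite_act_index (a : wt 1) (b : wt l) : finite_set (act_index a b).
Proof.
have [D [M h]] := marginals_bounded 0%N [fset j | j in iota 0 l]%fset a b.
have fin := @finite_fsfun_box _ [fset pos l ij | ij in D]%fset M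
  [set f | exists2 v : wt l, act_index a b v & wtval v = f].
apply: (@sub_finite_set _ _ ((fun v : wt l => wtval v) @^-1`
  [set f | exists2 v : wt l, act_index a b v & wtval v = f])).
  by move=> v hv /=; exists v.
apply: finite_preimage; first by move=> v v' _ _; exact: val_inj.
apply: fin => _ [v hv <-] n; have [va vb] := hv; have [v0 _] := asboolW (wtP v).
have [[ij ->]|no] := pselect (exists ij, n = pos l ij); last first.
  by rewrite (act_index_off_pos hv) // => ij e; apply: no; exists ij.
have pos0 i j : ~~ ((i == 0%N) && (j \in [fset j | j in iota 0 l]%fset)) -> 0 <= v (pos l (i, j)).
  by rewrite inE mem_iota /= add0n -pos_lt -leqNgt => /v0.
have [h1 h2] := h _ (fun ij => v (pos l ij)) (@pos_supp v) pos0 va vb ij.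
split=> // hn; apply: h1; apply: contra hn => hn; apply/imfsetP.
by exists ij.
Qed.

(** The entries u_ijkj' as a matrix with rows (i, k) and columns (j, j'): its row sums are
    [p] and its column sums are [q]. *)
Definition tensor4 (u : {fsfun nat * nat -> int with 0}) (x : (nat * nat) * (nat * nat)) : int :=
  u (pos l (x.1.1, x.2.1), pos l (x.1.2, x.2.2)).

Lemma tensor4_supp (u : {fsfun nat * nat -> int with 0}) x :
  x \notin [fset (((unpos l nm.1).1, (unpos l nm.2).1), ((unpos l nm.1).2, (unpos l nm.2).2))
             | nm in finsupp u]%fset -> tensor4 u x = 0.
Proof.
case: x => -[i k] [j j'] h; apply: fsfun_dflt; apply: contra h => h; apply/imfsetP.
by exists (pos l (i, j), pos l (k, j')); rewrite //= !posK.
Qed.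

Lemma finite_act_tensor (a a' : wt 1) (b b' : wt l) (p : lmat a a') (q : lmat b b')
    (v v' : wt l) : act_index a b v -> act_index a' b' v' ->
  finite_set (@act_tensor l a a' b b' p q v v').
Proof.
move=> hv hv'.
have [D [M h]] := marginals_bounded (0%N, 0%N) [fset (j, j) | j in iota 0 l]%fset p q.
have fin := @finite_fsfun_box _
  [fset (pos l (x.1.1, x.2.1), pos l (x.1.2, x.2.2)) | x in D]%fset M
  [set f | exists2 u : lmat v v', act_tensor p q u & lmatval u = f].
apply: (@sub_finite_set _ _ ((fun u : lmat v v' => lmatval u) @^-1`
  [set f | exists2 u : lmat v v', act_tensor p q u & lmatval u = f])).
  by move=> u hu /=; exists u.
apply: finite_preimage; first by move=> u u' _ _; exact: val_inj.
apply: fin => _ [u [hp hq] <-] [n m].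
have off f : act_index a b v -> (forall ij, f <> pos l ij) -> v f = 0.
  exact: act_index_off_pos.
have [[ij nE]|no] := pselect (exists ij, n = pos l ij); last first.
  have nn ij : n <> pos l ij by move=> e; apply: no; exists ij.
  rewrite (lmat_row0 _ _ (off_pos_ge nn)) ?(act_index_off_pos hv') //.
have [[kj mE]|no] := pselect (exists ij, m = pos l ij); last first.
  have nn ij' : m <> pos l ij' by move=> e; apply: no; exists ij'.
  by rewrite (lmat_col0 _ _ (off_pos_ge nn)) ?(act_index_off_pos hv).
have [u0 _ _] := asboolW (lmatP u).
have t0 (ik jj : nat * nat) : ~~ ((ik == (0, 0)%N) && (jj \in [fset (j, j) | j in iota 0 l]%fset)) ->
    0 <= tensor4 u (ik, jj).
  move=> hh; apply: u0; apply: contra hh => /andP[/eqP/pos_inj[e1 e2]].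
  rewrite pos_lt => /andP[/eqP i0 jl]; case: ik jj e1 e2 i0 jl => [i k] [j j'] /= <- <- -> jl.
  by rewrite eqxx /=; apply/imfsetP; exists j; rewrite ?mem_iota.
have tp ik : \sum_(jj \in [set: nat * nat]) tensor4 u (ik, jj) = p ik.
  by case: ik => i k; exact: hp.
have tq jj : \sum_(ik \in [set: nat * nat]) tensor4 u (ik, jj) = q jj.
  by case: jj => j j'; exact: hq.
have [h1 h2] := h _ (tensor4 u) (@tensor4_supp u) t0 tp tq ((ij.1, kj.1), (ij.2, kj.2)).
move: h1 h2; rewrite /tensor4 /= -!surjective_pairing -nE -mE => h1 h2.
split=> // hn; apply: h1; apply: contra hn => hn; apply/imfsetP.
by exists ((ij.1, kj.1), (ij.2, kj.2)); rewrite //= -!surjective_pairing -nE -mE.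
Qed.

End ActionIndex.

(** * Words of pairs *)

Section Pairing.
Variables (l d : nat) (mu : l.-tuple nat).
Hypothesis mud : sumn mu = d.
Implicit Types w : {ffun 'I_d -> nat}.

(** The letter of a pair of words at a position is the number of the pair of letters. *)
Definition pairw w1 w2 : {ffun 'I_d -> nat} := [ffun m => pos l (w1 m, w2 m)].

Lemma mu_pos_default i j : ~~ ((i == 0%N) && (j < l)%N) -> nth 0%N mu (pos l (i, j)) = 0%N.
Proof. by rewrite -pos_lt -leqNgt => /nth_mu_default ->. Qed.

Lemma mu_total : \sum_(n \in [set: nat]) (nth 0%N mu n)%:Z = d%:Z.
Proof.
rewrite (fsbigT_ord (n := l)) => [|n h]; last by rewrite nth_mu_default.
by rewrite sum_Posz -mud sumnE [in RHS](big_nth 0%N) size_tuple big_mkord.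
Qed.

Lemma mu_sum_row i :
  \sum_(j \in [set: nat]) (nth 0%N mu (pos l (i, j)))%:Z = (nth 0%N [tuple d] i)%:Z.
Proof.
case: i => [|i] /=; last first.
  by rewrite nth_nil fsbig1 // => j _; rewrite mu_pos_default.
rewrite -mu_total; apply: eq_fsbigr => j _.
by case: (ltnP j l) => jl; [rewrite pos0|rewrite mu_pos_default ?nth_mu_default // -leqNgt].
Qed.

Lemma mu_sum_col j :
  \sum_(i \in [set: nat]) (nth 0%N mu (pos l (i, j)))%:Z = (nth 0%N mu j)%:Z.
Proof.
rewrite (fsum_single (k0 := 0%N)) => [|i i0]; last first.
  by rewrite mu_pos_default // negb_and i0.
by case: (ltnP j l) => jl; [rewrite pos0|rewrite mu_pos_default ?nth_mu_default // -leqNgt].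
Qed.

Lemma word_wt w : exists v : wt l, has_type mu w v.
Proof.
pose s := [seq w m | m : 'I_d] ++ iota 0 l.
pose F n : int := #|[pred m | w m == n]|%:Z - (nth 0%N mu n)%:Z.
have c0 n : n \notin s -> #|[pred m | w m == n]|%:Z = 0.
  rewrite mem_cat negb_or => /andP[h _]; congr Posz; apply/eqP/pred0P => m /=.
  by apply/negP => /eqP e; case/negP: h; rewrite -e; apply/mapP; exists m; rewrite ?mem_enum.
have m0 n : n \notin s -> (nth 0%N mu n)%:Z = 0.
  rewrite mem_cat negb_or mem_iota /= add0n -leqNgt => /andP[_ h].
  by rewrite nth_mu_default.
have F0 n : n \notin s -> F n = 0 by move=> h; rewrite /F c0 // m0.
pose f : {fsfun nat -> int with 0} := [fsfun n in [fset x | x in s]%fset => F n].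
have fE n : f n = F n by rewrite /f fsfun_seqE.
have fwt : `[< (forall i, (l <= i)%N -> 0 <= f i) /\ \sum_(i \in [set: nat]) f i = 0 >].
  apply/asboolP; split=> [i li|]; first by rewrite fE /F nth_mu_default // subr0.
  rewrite (eq_fsbigr F) => [|n _]; last by rewrite fE.
  apply: etrans (@sum_count_sub _ _ predT w [fset x | x in iota 0 l]%fset (fun n => (nth 0%N mu n)%:Z) _) _.
    by move=> n; rewrite inE mem_iota /= add0n -leqNgt => /nth_mu_default ->.
  by rewrite card_ord mu_total subrr.
by exists (Wt fwt) => n; rewrite /spec_wt /= fE /F addrC subrK.
Qed.

Lemma has_type_inj w (v v' : wt l) : has_type mu w v -> has_type mu w v' -> v = v'.
Proof.
move=> h h'; apply/val_inj/fsfunP => n; have := h n; rewrite h' /spec_wt.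
by move/addrI.
Qed.

Lemma pairw_count w1 w2 i j :
  #|[pred m | pairw w1 w2 m == pos l (i, j)]|%:Z = #|[pred m | (w1 m == i) && (w2 m == j)]|%:Z.
Proof. by apply: eq_cardZ => m /=; rewrite ffunE (inj_eq (@pos_inj l)). Qed.

Lemma mu_row_supp i j : j \notin [fset x | x in iota 0 l]%fset -> (nth 0%N mu (pos l (i, j)))%:Z = 0.
Proof.
by rewrite inE mem_iota /= add0n => h; rewrite mu_pos_default // negb_and h orbT.
Qed.

Lemma mu_col_supp j i : i \notin [fset 0%N]%fset -> (nth 0%N mu (pos l (i, j)))%:Z = 0.
Proof. by rewrite inE => h; rewrite mu_pos_default // negb_and h. Qed.

(** The entries of [mu] sit at the numbers of the positions (0, j), so they all contribute to
    row 0, whose total is [d]. *)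
Lemma pair_row w1 w2 (v : wt l) i : has_type mu (pairw w1 w2) v ->
  #|[pred m | w1 m == i]|%:Z =
  (nth 0%N [tuple d] i)%:Z + \sum_(j \in [set: nat]) v (pos l (i, j)).
Proof.
move=> h; apply/eqP; rewrite addrC -subr_eq -mu_sum_row; apply/eqP/esym.
rewrite -(sum_count_sub _ w2 (@mu_row_supp i)).
apply: eq_fsbigr => j _; rewrite -pairw_count h /spec_wt.
by rewrite addrC addKr.
Qed.

Lemma pair_col w1 w2 (v : wt l) j : has_type mu (pairw w1 w2) v ->
  #|[pred m | w2 m == j]|%:Z =
  (nth 0%N mu j)%:Z + \sum_(i \in [set: nat]) v (pos l (i, j)).
Proof.
move=> h; apply/eqP; rewrite addrC -subr_eq -(mu_sum_col j); apply/eqP/esym.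
rewrite -(sum_count_sub _ w1 (@mu_col_supp j)).
apply: eq_fsbigr => i _; rewrite (_ : #|_|%:Z = spec_wt mu v (pos l (i, j))).
  by rewrite /spec_wt addrC addKr.
by rewrite -h pairw_count; apply: eq_cardZ => m /=; rewrite andbC.
Qed.

Lemma pair_index (a : wt 1) (b v : wt l) w1 w2 :
  has_type [tuple d] w1 a -> has_type mu w2 b -> has_type mu (pairw w1 w2) v ->
  act_index a b v.
Proof.
move=> h1 h2 h; split=> [i|j]; apply/esym.
  by have := pair_row i h; rewrite h1 /spec_wt => /addrI.
by have := pair_col j h; rewrite h2 /spec_wt => /addrI.
Qed.

(** A word of type [v] only uses letters that are numbers of matrix positions, since the
    other entries of [v] vanish. *)
Lemma unpair (a : wt 1) (b v : wt l) w : act_index a b v -> has_type mu w v ->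
  exists w1 w2, [/\ w = pairw w1 w2, has_type [tuple d] w1 a & has_type mu w2 b].
Proof.
move=> hv wv.
pose w1 := [ffun m => (unpos l (w m)).1]; pose w2 := [ffun m => (unpos l (w m)).2].
have wE : w = pairw w1 w2.
  apply/ffunP => m; rewrite !ffunE -surjective_pairing.
  have [[ij ->]|no] := pselect (exists ij, w m = pos l ij); first by rewrite posK.
  have nn ij : w m <> pos l ij by move=> e; apply: no; exists ij.
  have := wv (w m); rewrite /spec_wt nth_mu_default ?(off_pos_ge nn) //.
  rewrite (act_index_off_pos hv nn) addr0 => -[] /eqP/pred0P/(_ m).
  by rewrite /= eqxx.
have hv' : has_type mu (pairw w1 w2) v by rewrite -wE.
have [va vb] := hv; exists w1, w2; split=> // [i|j].
  by rewrite (pair_row i hv') va.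
by rewrite (pair_col j hv') vb.
Qed.

(** As in [pair_row], the diagonal contributions of [mu] are concentrated in row 0. *)
Lemma jmat_pair_row w1 w1' w2 w2' i k :
  \sum_(jj \in [set: nat * nat])
     jmat mu (pairw w1 w2) (pairw w1' w2') (pos l (i, jj.1), pos l (k, jj.2)) =
  jmat [tuple d] w1 w1' (i, k).
Proof.
pose g (jj : nat * nat) : int := diag_mu mu ((i == k) && (jj.1 == jj.2)) (pos l (i, jj.1)).
have g0 jj : jj \notin [fset (j, j) | j in iota 0 l]%fset -> g jj = 0.
  case: jj => j j' h; rewrite /g /=; case: (j =P j') => [e|_]; last by rewrite andbF diag_mu_false.
  subst j'; rewrite /diag_mu; case: ifP => // _; rewrite mu_pos_default // negb_and.
  apply/orP; right; apply: contra h => h; apply/imfsetP; exists j; by rewrite ?mem_iota.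
apply: etrans (etrans _ (sum_count_sub [pred m | (w1 m == k) && (w1' m == i)]
  (fun m => (w2' m, w2 m)) g0)) _.
  apply: eq_fsbigr => -[j j'] _; rewrite jmatE /g /= (inj_eq (@pos_inj l)) xpair_eqE; congr (_ - _).
  rewrite /jcount; apply: eq_cardZ => m /=; rewrite !ffunE !(inj_eq (@pos_inj l)) !xpair_eqE.
  by rewrite andbACA -!andbA; do !bool_congr.
rewrite jmatE; congr (_ - _); rewrite (fsum_pair g0).
rewrite (eq_fsbigr (fun j => diag_mu mu (i == k) (pos l (i, j)))) => [|j _]; last first.
  rewrite (fsum_single (k0 := j)) /g /= ?eqxx ?andbT // => j' jj.
  by rewrite (eq_sym j) (negbTE jj) andbF diag_mu_false.
rewrite /diag_mu; case: (i == k); last by rewrite fsbig1.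
exact: mu_sum_row.
Qed.

Lemma jmat_pair_col w1 w1' w2 w2' j j' :
  \sum_(ik \in [set: nat * nat])
     jmat mu (pairw w1 w2) (pairw w1' w2') (pos l (ik.1, j), pos l (ik.2, j')) =
  jmat mu w2 w2' (j, j').
Proof.
pose g (ik : nat * nat) : int := diag_mu mu ((ik.1 == ik.2) && (j == j')) (pos l (ik.1, j)).
have g0 ik : ik \notin [fset (0, 0)%N]%fset -> g ik = 0.
  case: ik => i k; rewrite inE /g /= => h; case: (i =P k) => [e|_]; last by rewrite diag_mu_false.
  subst k; rewrite /diag_mu; case: ifP => // _; rewrite mu_pos_default // negb_and.
  by apply/orP; left; apply: contra h => /eqP ->.
apply: etrans (etrans _ (sum_count_sub [pred m | (w2 m == j') && (w2' m == j)]
  (fun m => (w1' m, w1 m)) g0)) _.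
  apply: eq_fsbigr => -[i k] _; rewrite jmatE /g /= (inj_eq (@pos_inj l)) xpair_eqE; congr (_ - _).
  rewrite /jcount; apply: eq_cardZ => m /=; rewrite !ffunE !(inj_eq (@pos_inj l)) !xpair_eqE.
  by rewrite -!andbA; case: (w1 m == k); case: (w2 m == j'); case: (w1' m == i); case: (w2' m == j).
rewrite jmatE; congr (_ - _); rewrite (fsum_pair g0).
rewrite (eq_fsbigr (fun i => diag_mu mu (j == j') (pos l (i, j)))) => [|i _]; last first.
  rewrite (fsum_single (k0 := i)) /g /= ?eqxx // => k ik.
  by rewrite (eq_sym i) (negbTE ik) diag_mu_false.
rewrite /diag_mu; case: (j == j'); last by rewrite fsbig1.
exact: mu_sum_col.
Qed.

Variables (R : comNzRingType) (ev : {rmorphism R -> int}).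

(** The joint matrix of two words of pairs has the joint matrices of the components as its
    marginals, and the 4-tensors occurring in the action of xi_p and xi_q are those with
    marginals [p] and [q]; hence the coefficient is a product. *)
Lemma wmat_act (a a' : wt 1) (b b' v v' : wt l)
    (f : {malg R[lmat a a']}) (g : {malg R[lmat b b']}) w1 w1' w2 w2' :
  has_type [tuple d] w1 a -> has_type [tuple d] w1' a' ->
  has_type mu w2 b -> has_type mu w2' b' ->
  has_type mu (pairw w1 w2) v -> has_type mu (pairw w1' w2') v' ->
  wmat mu ev (act_component f g v v') (pairw w1 w2) (pairw w1' w2') =
  wmat [tuple d] ev f w1 w1' * wmat mu ev g w2 w2'.
Proof.
move=> w1a w1a' w2b w2b' wv wv'; rewrite /wmat /act_component.
have Ql := jmat_lmat wv wv'.
have va := pair_index w1a w2b wv; have va' := pair_index w1a' w2b' wv'.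
have E (p : lmat a a') (q : lmat b b') :
    coef_at (\sum_(u \in @act_tensor l a a' b b' p q v v') (<< u >> : {malg R[lmat v v']}))
      (jmat mu (pairw w1 w2) (pairw w1' w2')) =
    (jmat [tuple d] w1 w1' == p)%:R * (jmat mu w2 w2' == q)%:R.
  have [u uQ ->] := coef_at_lmat
    (\sum_(u \in @act_tensor l a a' b b' p q v v') (<< u >> : {malg R[lmat v v']})) Ql.
  rewrite mcoeff_indicator; last exact: finite_act_tensor va va'.
  rewrite -natrM mulnb; congr ((nat_of_bool _)%:R); apply/asboolP/andP.
    case=> hp hq; split; apply/eqP/fsfunP => -[i k].
      rewrite -hp -(jmat_pair_row w1 w1' w2 w2').
      by apply: eq_fsbigr => jj _; rewrite uQ.
    rewrite -hq -(jmat_pair_col w1 w1' w2 w2').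
    by apply: eq_fsbigr => jj _; rewrite uQ.
  move=> [/eqP e1 /eqP e2]; split=> i k.
    rewrite -e1 -(jmat_pair_row w1 w1' w2 w2').
    by apply: eq_fsbigr => jj _; rewrite uQ.
  rewrite -e2 -(jmat_pair_col w1 w1' w2 w2').
  by apply: eq_fsbigr => jj _; rewrite uQ.
rewrite -rmorphM [coef_at f _]coef_at_supp [coef_at g _]coef_at_supp; congr (ev _).
rewrite coef_at_sum big_distrl /=; apply: eq_bigr => p _.
rewrite coef_at_sum big_distrr /=; apply: eq_bigr => q _.
by rewrite coef_atZ E mulrACA.
Qed.

End Pairing.

(** * Words of families and the action *)

Definition letters (l d : nat) (mu : l.-tuple nat) (R : comNzRingType)
    (phi : {rmorphism intpoly l -> R}) (X : hull (C0 phi)) (x : fam_word d mu X) :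
    {ffun 'I_d -> nat} := tagged x.

Lemma letters_type (l d : nat) (mu : l.-tuple nat) (R : comNzRingType)
    (phi : {rmorphism intpoly l -> R}) (X : hull (C0 phi)) (x : fam_word d mu X) :
  has_type mu (letters x) (fam X (tag x)).
Proof. exact: word_type. Qed.

Lemma fam_word_ext (l d : nat) (mu : l.-tuple nat) (R : comNzRingType)
    (phi : {rmorphism intpoly l -> R}) (X : hull (C0 phi)) (x y : fam_word d mu X) :
  tag x = tag y -> letters x = letters y -> x = y.
Proof.
case: x y => i w [j w'] /= e; subst j; rewrite /letters /= => e.
by congr existT; apply: val_inj.
Qed.

Lemma mcoeff_spec_basisE (l d : nat) (mu : l.-tuple nat) (R : comNzRingType)
    (phi : {rmorphism intpoly l -> R}) (ev : {rmorphism R -> int})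
    (X Y : hull (C0 phi)) (f : lhom X Y) (w : fam_word d mu X) (w' : fam_word d mu Y) :
  (spec_basis ev f w)@_w' = wmat mu ev (f (tag w') (tag w)) (letters w) (letters w').
Proof. by case: w' => i w'; exact: mcoeff_spec_basis. Qed.

Lemma biadditive_ext (K L : choiceType) (V : zmodType) (h h' : {malg int[K]} -> {malg int[L]} -> V) :
  (forall y, {morph h^~ y : x x' / x - x'}) -> (forall x, {morph h x : y y' / y - y'}) ->
  (forall y, {morph h'^~ y : x x' / x - x'}) -> (forall x, {morph h' x : y y' / y - y'}) ->
  (forall k j, h << k >> << j >> = h' << k >> << j >>) -> forall x y, h x y = h' x y.
Proof.
move=> h1 h2 h1' h2' e x y; apply: (malg_ext (h1 y) (h1' y)) => k.
exact: (malg_ext (h2 _) (h2' _)).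
Qed.

Section FamPair.
Variables (l d : nat) (mu : l.-tuple nat).
Hypothesis mud : sumn mu = d.
Variables (R : comNzRingType).
Variables (phi1 : {rmorphism intpoly 1 -> R}) (phi : {rmorphism intpoly l -> R}).
Variable (ev : {rmorphism R -> int}).
Local Notation Ct := (C0 phi1).
Local Notation Cl := (C0 phi).

Section Objects.
Variables (X : hull Ct) (Y : hull Cl).
Local Notation WX := (fam_word d [tuple d] X).
Local Notation WY := (fam_word d mu Y).
Local Notation WXY := (fam_word d mu (act_ob X Y)).

Lemma fpair_exists (x : WX) (y : WY) : exists z : WXY,
  tag (tag z) = (tag x, tag y) /\ letters z = pairw l (letters x) (letters y).
Proof.
have [v hv] := word_wt mud (pairw l (letters x) (letters y)).
have va := pair_index mud (letters_type x) (letters_type y) hv.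
have vin : v \in fset_set (act_index (fam X (tag x)) (fam Y (tag y))).
  by rewrite in_fset_set ?inE //; exact: finite_act_index.
have hv' : `[< has_type mu (pairw l (letters x) (letters y)) v >] by apply/asboolP.
pose i : fidx (act_ob X Y) := existT (fun ij : fidx X * fidx Y =>
  fset_set (act_index (fam X ij.1) (fam Y ij.2))) (tag x, tag y) (FSetSub vin).
by exists (wtag (X := act_ob X Y) (i := i) (Word hv')).
Qed.

Definition fpair (x : WX) (y : WY) : WXY := projT1 (cid (fpair_exists x y)).

Lemma fpair_tag x y : tag (tag (fpair x y)) = (tag x, tag y).
Proof. by rewrite /fpair; case: cid => z []. Qed.

Lemma fpair_letters x y : letters (fpair x y) = pairw l (letters x) (letters y).
Proof. by rewrite /fpair; case: cid => z []. Qed.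

(** The member of the family [act_ob X Y] containing a word of pairs is determined by the
    letters, since they determine the matrix of its type. *)
Lemma act_word_ext (z z' : WXY) :
  tag (tag z) = tag (tag z') -> letters z = letters z' -> z = z'.
Proof.
move=> e el; have := letters_type z; have := letters_type z'; rewrite -el.
case: z z' e el => [[ij v] w] [[ij' v'] w'] /= e; subst ij'; rewrite /letters /= => el h' h.
have vv : v = v' by apply: val_inj; exact: has_type_inj h h'.
by subst v'; congr existT; apply: val_inj.
Qed.

Lemma fpairE (z : WXY) (x : WX) (y : WY) : tag (tag z) = (tag x, tag y) ->
  letters z = pairw l (letters x) (letters y) -> z = fpair x y.
Proof. by move=> e el; apply: act_word_ext; rewrite ?fpair_tag ?fpair_letters. Qed.

Lemma fpair_surj (z : WXY) : exists x y, z = fpair x y.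
Proof.
have := letters_type z; move e : (letters z) => w.
case: z e => [[[i j] v] u] e; have := valP v; rewrite in_fset_set; last exact: finite_act_index.
rewrite inE => hv wv; have [w1 [w2 [wE h1 h2]]] := unpair mud hv wv.
have h1' : `[< has_type [tuple d] w1 (fam X i) >] by apply/asboolP.
have h2' : `[< has_type mu w2 (fam Y j) >] by apply/asboolP.
exists (wtag (Word h1')), (wtag (Word h2')); apply: fpairE => //.
by rewrite e wE.
Qed.

Lemma fpair_inj x y x' y' : fpair x y = fpair x' y' -> x = x' /\ y = y'.
Proof.
move=> e; have := fpair_tag x y; have := fpair_letters x y.
rewrite e fpair_tag fpair_letters => /ffunP el [e1 e2].
have {}el m : (letters x' m, letters y' m) = (letters x m, letters y m).
  by have := el m; rewrite !ffunE => /pos_inj.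
by split; apply: fam_word_ext => //; apply/ffunP => m; case: (el m).
Qed.

(** The bilinear extension of the pairing of words; together with [fpair_inj] and
    [fpair_surj] it identifies the span of the words of [act_ob X Y] with a tensor product. *)
Definition mpair (x : {malg int[WX]}) (y : {malg int[WY]}) : {malg int[WXY]} :=
  bext (fun k j => << fpair k j >>) x y.

Lemma mpairBl x x' y : mpair (x - x') y = mpair x y - mpair x' y.
Proof.
have -> : x - x' = (-1) *: x' + x by rewrite scaleN1r addrC.
by rewrite /mpair bext_linearl scaleN1r addrC.
Qed.

Lemma mpairBr x y y' : mpair x (y - y') = mpair x y - mpair x y'.
Proof.
have -> : y - y' = (-1) *: y' + y by rewrite scaleN1r addrC.
by rewrite /mpair bext_linearr scaleN1r addrC.
Qed.

Lemma mpairUU k j : mpair << k >> << j >> = << fpair k j >>.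
Proof.
rewrite /mpair /bext !msuppU !oner_eq0 !big_seq_fset1 !mcoeffUU mul1r.
exact: scale1r.
Qed.

Lemma mcoeff_mpair x y k j : (mpair x y)@_(fpair k j) = x@_k * y@_j.
Proof.
move: x y; apply: (biadditive_ext (h := fun x y => (mpair x y)@_(fpair k j))
  (h' := fun x y => x@_k * y@_j)) => [y x x'|x y y'|y x x'|x y y'|k' j'].
- by rewrite mpairBl mcoeffB.
- by rewrite mpairBr mcoeffB.
- by rewrite mcoeffB mulrBl.
- by rewrite mcoeffB mulrBr.
rewrite mpairUU !mcoeffU -natrM mulnb.
congr ((nat_of_bool _)%:R); apply/eqP/andP => [/fpair_inj[-> ->]|[/eqP -> /eqP ->]] //.
Qed.

Lemma mpair_ext (V : zmodType) (h h' : {malg int[WXY]} -> V) :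
  {morph h : x y / x - y} -> {morph h' : x y / x - y} ->
  (forall x y, h (mpair << x >> << y >>) = h' (mpair << x >> << y >>)) -> h =1 h'.
Proof.
move=> hB hB' e; apply: malg_ext => // z; have [x [y ->]] := fpair_surj z.
by rewrite -mpairUU e.
Qed.

End Objects.

Lemma wmat_act_map (X X' : hull Ct) (Y Y' : hull Cl) (f : lhom X X') (g : lhom Y Y')
    (z : fam_word d mu (act_ob X Y)) (z' : fam_word d mu (act_ob X' Y'))
    (x : fam_word d [tuple d] X) (y : fam_word d mu Y)
    (x' : fam_word d [tuple d] X') (y' : fam_word d mu Y') :
  tag (tag z) = (tag x, tag y) -> letters z = pairw l (letters x) (letters y) ->
  tag (tag z') = (tag x', tag y') -> letters z' = pairw l (letters x') (letters y') ->
  wmat mu ev (act_map f g (tag z') (tag z)) (letters z) (letters z') =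
  wmat [tuple d] ev (f (tag x') (tag x)) (letters x) (letters x') *
  wmat mu ev (g (tag y') (tag y)) (letters y) (letters y').
Proof.
move=> e h e' h'; have := letters_type z; have := letters_type z'.
have := letters_type x; have := letters_type x'; have := letters_type y; have := letters_type y'.
rewrite h h'; move: (letters x) (letters x') (letters y) (letters y').
case: x y x' y' e e' {h h'} => [i w1] [j w2] [i' w1'] [j' w2'] /=.
case: z => [[[k m] v] w] /= [e1 e2]; subst k m.
case: z' => [[[k m] v'] w'] /= [e1 e2]; subst k m.
move=> u1 u1' u2 u2' h1 h2 h3 h4 h5 h6; rewrite /act_map /=.
exact: wmat_act.
Qed.

(** Both sides are biadditive, and on words the coefficients agree by [wmat_act]. *)
Lemma spec_act (X X' : hull Ct) (Y Y' : hull Cl) (f : lhom X X') (g : lhom Y Y') x y :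
  mlin (spec_basis ev (act_map f g)) (mpair x y) =
  mpair (mlin (spec_basis ev f) x) (mlin (spec_basis ev g) y).
Proof.
move: x y; apply: (biadditive_ext (h := fun x y => mlin (spec_basis ev (act_map f g)) (mpair x y))
  (h' := fun x y => mpair (mlin (spec_basis ev f) x) (mlin (spec_basis ev g) y)))
  => [y x x'|x y y'|y x x'|x y y'|k j].
- by rewrite mpairBl raddfB.
- by rewrite mpairBr raddfB.
- by rewrite raddfB mpairBl.
- by rewrite raddfB mpairBr.
rewrite mpairUU !mlinU; apply/malgP => z'.
have [x' [y' ->]] := fpair_surj z'.
rewrite mcoeff_mpair !mcoeff_spec_basisE.
by apply: wmat_act_map; rewrite ?fpair_tag ?fpair_letters.
Qed.

End FamPair.

(** * The constraints on words *)

Section SpecLinear.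
Variables (l d : nat) (mu : l.-tuple nat) (R : comNzRingType).
Variables (phi : {rmorphism intpoly l -> R}) (ev : {rmorphism R -> int}).
Hypothesis evphi : forall x, ev (phi x) = ipeval mu x.
Local Notation Cl := (C0 phi).

Lemma spec_comp (X Y Z : hull Cl) (g : lhom Y Z) (f : lhom X Y) (x : {malg int[fam_word d mu X]}) :
  mlin (spec_basis ev (lcomp g f)) x = mlin (spec_basis ev g) (mlin (spec_basis ev f) x).
Proof.
exact: (congr1 (fun F : sdhom (spec d mu phi ev X) (spec d mu phi ev Z) => sdfun F x)
  (fmapM (spec_functor d evphi) g f)).
Qed.

Lemma spec_id (X : hull Cl) (x : {malg int[fam_word d mu X]}) :
  mlin (spec_basis ev (lidm X)) x = x.
Proof.
exact: (congr1 (fun F : sdhom (spec d mu phi ev X) (spec d mu phi ev X) => sdfun F x)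
  (fmap1 (spec_functor d evphi) X)).
Qed.

Definition relabel_mx (X Y : hull Cl) (P : fidx Y -> fidx X -> bool)
    (G : nat -> nat -> Prop) : lhom X Y :=
  fun y x => if P y x then relabel G (fam X x) (fam Y y) else 0.

(** A relabelling has coefficients 0 and 1 on words, so it sends [x] to the sum of the words
    related to it. *)
Lemma spec_relabel (X Y : hull Cl) (P : fidx Y -> fidx X -> bool) (G : nat -> nat -> Prop)
    (x : fam_word d mu X) (y : fam_word d mu Y) :
  (forall n m m', G n m -> G n m' -> m = m') -> (forall i, (i < l)%N -> G i i) ->
  (forall y' : fam_word d mu Y,
     (P (tag y') (tag x) /\ forall m, G (letters y' m) (letters x m)) <-> y' = y) ->
  mlin (spec_basis ev (relabel_mx P G)) << x >> = << y >>.
Proof.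
move=> Gf Gd h; rewrite mlinU; apply/malgP => y'; rewrite mcoeff_spec_basisE mcoeffU.
rewrite /relabel_mx; case: ifP => hP; last first.
  rewrite wmat0; case: eqP => // e; have [_ h2] := h y'; have [] := h2 (esym e).
  by rewrite hP.
rewrite wmat_relabel //; try exact: letters_type.
congr ((nat_of_bool _)%:R); apply/asboolP/eqP => [hG|e]; first by apply/esym/h.
by have [_ []] := h y'.
Qed.

End SpecLinear.

Lemma sumn_singleton d : sumn [tuple d] = d. Proof. exact: addn0. Qed.

Section Constraints.
Variables (l d : nat) (mu : l.-tuple nat).
Hypothesis mud : sumn mu = d.
Variables (R : comNzRingType).
Variables (phi1 : {rmorphism intpoly 1 -> R}) (phi : {rmorphism intpoly l -> R}).
Variable (ev : {rmorphism R -> int}).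
Local Notation Ct := (C0 phi1).
Local Notation Cl := (C0 phi).
Local Notation dd := (sumn_singleton d).
Local Notation sp f := (mlin (spec_basis ev f)).
Local Notation "x ** y" := (fpair mud x y) (at level 40).
Local Notation "x *1 y" := (fpair dd x y) (at level 40).

Definition assoc_graph (n m : nat) : Prop := exists i j k : nat,
  n = pos l (i, pos l (j, k)) /\ m = pos l (pos 1 (i, j), k).

Lemma assoc_graph_functional n m m' : assoc_graph n m -> assoc_graph n m' -> m = m'.
Proof.
move=> [i [j [k [-> ->]]]] [i' [j' [k' [e ->]]]].
by have [<- /(@pos_inj l)[<- <-]] := @pos_inj l _ _ e.
Qed.

Lemma assoc_graph_injective n n' m : assoc_graph n m -> assoc_graph n' m -> n = n'.
Proof.
move=> [i [j [k [-> ->]]]] [i' [j' [k' [-> e]]]].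
by have [/(@pos_inj 1)[<- <-] <-] := @pos_inj l _ _ e.
Qed.

Lemma assoc_graph_diag i : (i < l)%N -> assoc_graph i i.
Proof. by move=> il; exists 0%N, 0%N, i; rewrite !pos0. Qed.

Lemma assoc_graphE i j k i' j' k' :
  assoc_graph (pos l (i', pos l (j', k'))) (pos l (pos 1 (i, j), k)) ->
  [/\ i' = i, j' = j & k' = k].
Proof.
move=> [i0 [j0 [k0 [e e']]]]; have [-> /(@pos_inj l)[-> ->]] := @pos_inj l _ _ e.
by have [/(@pos_inj 1)[-> ->] ->] := @pos_inj l _ _ e'.
Qed.

Section Associator.
Variables (X Y : hull Ct) (Z : hull Cl).

Definition assoc_match (z : fidx (act_ob X (act_ob Y Z))) (x : fidx (act_ob (act_ob X Y) Z)) : bool :=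
  [&& (tag (tag x).1).1 == (tag z).1, (tag (tag x).1).2 == (tag (tag z).2).1
    & (tag x).2 == (tag (tag z).2).2].

Definition assoc_inv : lhom (act_ob X (act_ob Y Z) : lob (hull Cl)) (act_ob (act_ob X Y) Z) :=
  relabel_mx (fun x z => assoc_match z x) (fun n m => assoc_graph m n).

(** Both iterated pairings of words retain exactly the three words. *)
Lemma triple_words (x x' : fam_word d [tuple d] X) (y y' : fam_word d [tuple d] Y)
    (z z' : fam_word d mu Z) (t : fidx (act_ob (act_ob X Y) Z)) (s : fidx (act_ob X (act_ob Y Z))) :
  t = tag ((x *1 y) ** z) -> s = tag (x' ** (y' ** z')) ->
  assoc_match s t /\
  (forall m, assoc_graph (letters (x' ** (y' ** z')) m) (letters ((x *1 y) ** z) m)) <->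
  [/\ x' = x, y' = y & z' = z].
Proof.
move=> -> ->; rewrite /assoc_match !fpair_tag /=; split.
  case=> /and3P[/eqP e1 /eqP e2 /eqP e3] h.
  have {}h m : [/\ letters x' m = letters x m, letters y' m = letters y m
      & letters z' m = letters z m].
    have := h m; rewrite !fpair_letters !ffunE.
    exact: assoc_graphE.
  by split; apply: fam_word_ext => //; apply/ffunP => m; case: (h m).
move=> [-> -> ->]; rewrite !eqxx; split=> // m.
rewrite !fpair_letters !ffunE.
by exists (letters x m), (letters y m), (letters z m).
Qed.

Lemma spec_assoc x y z : sp (assoc_mx X Y Z) << (x *1 y) ** z >> = << x ** (y ** z) >>.
Proof.
apply: (@spec_relabel _ _ _ _ _ _ _ _ assoc_match assoc_graph); [exact: assoc_graph_functional|exact: assoc_graph_diag|].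
move=> w; have [x' [yz ->]] := fpair_surj mud w; have [y' [z' ->]] := fpair_surj mud yz.
have T := @triple_words x x' y y' z z' _ _ erefl erefl.
split=> [/T[-> -> ->] //|/fpair_inj[-> /fpair_inj[-> ->]]].
by apply/triple_words.
Qed.

Lemma spec_assoc_inv x y z : sp assoc_inv << x ** (y ** z) >> = << (x *1 y) ** z >>.
Proof.
apply: spec_relabel => [n m m' h h'|i il|]; [exact: assoc_graph_injective h h'|exact: assoc_graph_diag|].
move=> w; have [xy [z' ->]] := fpair_surj mud w; have [x' [y' ->]] := fpair_surj dd xy.
have T := @triple_words x' x y' y z' z _ _ erefl erefl.
split=> [/T[-> -> ->] //|/fpair_inj[/fpair_inj[-> ->] ->]].
by apply/triple_words.
Qed.

Lemma spec_assoc_mpair x y z :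
  sp (assoc_mx X Y Z) (mpair mud (mpair dd x y) z) = mpair mud x (mpair mud y z).
Proof.
pose L x y z := sp (assoc_mx X Y Z) (mpair mud (mpair dd x y) z).
pose M (x : {malg int[fam_word d [tuple d] X]}) (y : {malg int[fam_word d [tuple d] Y]})
  (z : {malg int[fam_word d mu Z]}) := mpair mud x (mpair mud y z).
rewrite -[LHS]/(L x y z) -[RHS]/(M x y z).
have L3 u v : {morph L u v : x y / x - y} by move=> a b; rewrite /L mpairBr raddfB.
have M3 u v : {morph M u v : x y / x - y} by move=> a b; rewrite /M !mpairBr.
move: x y; apply: (biadditive_ext (h := fun x y => L x y z) (h' := fun x y => M x y z))
  => [v a b|u a b|v a b|u a b|k i].
- by rewrite /L !mpairBl raddfB.
- by rewrite /L mpairBr mpairBl raddfB.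
- by rewrite /M mpairBl.
- by rewrite /M mpairBl mpairBr.
apply: (malg_ext (L3 << k >> << i >>) (M3 << k >> << i >>)) => j.
by rewrite /L /M !mpairUU spec_assoc.
Qed.

End Associator.

Section Unitors.

Definition unit_letter0 : {ffun 'I_d -> nat} := [ffun=> 0%N].

Lemma unit_word_exists : exists u : fam_word d [tuple d] (unit_ob phi1), True.
Proof.
have h : `[< has_type [tuple d] unit_letter0 (wt0 1) >].
  apply/asboolP => n; rewrite /spec_wt /= fsfunE addr0.
  rewrite (@eq_cardZ d _ [pred m | n == 0%N]) => [|m]; last by rewrite /= ffunE eq_sym.
  case: n => [|n] /=; last by rewrite nth_nil card0.
  by rewrite (eq_card (B := predT)) ?card_ord.
by exists (wtag (X := unit_ob phi1) (i := tt) (Word h)).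
Qed.

Definition unit_word : fam_word d [tuple d] (unit_ob phi1) := projT1 (cid unit_word_exists).

(** M^(t) specialises to the trivial module: its only word is constant. *)
Lemma unit_letters (u : fam_word d [tuple d] (unit_ob phi1)) m : letters u m = 0%N.
Proof.
case e : (letters u m) => [//|n]; have := letters_type u n.+1.
rewrite /spec_wt /= nth_nil fsfunE addr0 => -[] /eqP/pred0P/(_ m).
by rewrite /= e eqxx.
Qed.

Lemma unit_word_eq (u v : fam_word d [tuple d] (unit_ob phi1)) : u = v.
Proof.
apply: fam_word_ext; first by case: (tag u) (tag v) => -[].
by apply/ffunP => m; rewrite !unit_letters.
Qed.

Definition lunit_inv (Y : hull Cl) : lhom Y (act_ob (unit_ob phi1) Y : lob (hull Cl)) :=
  relabel_mx (fun (x : fidx (act_ob (unit_ob phi1) Y)) y => (tag x).2 == y) (fun n m => n = pos l (0%N, m)).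

Definition runit_inv (X : hull Ct) : lhom X (act_ob X (unit_ob phi1) : lob (hull Ct)) :=
  relabel_mx (fun (x : fidx (act_ob X (unit_ob phi1))) y => (tag x).1 == y) (fun n m => n = pos 1 (m, 0%N)).

Lemma pos1_0 i : (i < 1)%N -> i = pos 1 (i, 0%N).
Proof. by case: i. Qed.

Lemma spec_lunit (Y : hull Cl) u y : sp (lunit_mx phi1 Y) << u ** y >> = << y >>.
Proof.
apply: (@spec_relabel _ _ _ _ _ _ _ _ (fun y (x : fidx (act_ob (unit_ob phi1) Y)) => (tag x).2 == y) (fun n m => m = pos l (0%N, n))).
- by move=> n m m' -> ->.
- by move=> i il; rewrite pos0.
- move=> y'; rewrite fpair_tag fpair_letters /=; split=> [[/eqP e h]|->].
    apply: fam_word_ext => //; apply/ffunP => m.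
    by have := h m; rewrite ffunE => /pos_inj[_ ->].
  by rewrite eqxx; split=> // m; rewrite ffunE unit_letters.
Qed.

Lemma spec_lunit_inv (Y : hull Cl) y : sp (@lunit_inv Y) << y >> = << unit_word ** y >>.
Proof.
apply: spec_relabel.
- by move=> n m m' -> /pos_inj[].
- by move=> i il; rewrite pos0.
- move=> w; have [u [y' ->]] := fpair_surj mud w.
  rewrite fpair_tag fpair_letters (unit_word_eq u unit_word) /=.
  split=> [[/eqP e h]|/(fpair_inj (X := unit_ob phi1) (Y := Y)) h].
    suff -> : y' = y by [].
    apply: fam_word_ext => //; apply/ffunP => m.
    by have := h m; rewrite ffunE => /pos_inj[_ ->].
  by rewrite (proj2 h) eqxx; split=> // m; rewrite ffunE unit_letters.
Qed.

Lemma spec_runit (X : hull Ct) x u : sp (runit_mx X) << x *1 u >> = << x >>.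
Proof.
apply: (@spec_relabel _ _ _ _ _ _ _ _ (fun y (x : fidx (act_ob X (unit_ob phi1))) => (tag x).1 == y) (fun n m => m = pos 1 (n, 0%N))).
- by move=> n m m' -> ->.
- exact: pos1_0.
- move=> y'; rewrite fpair_tag fpair_letters /=; split=> [[/eqP e h]|->].
    apply: fam_word_ext => //; apply/ffunP => m.
    by have := h m; rewrite ffunE => /pos_inj[->].
  by rewrite eqxx; split=> // m; rewrite ffunE unit_letters.
Qed.

Lemma spec_runit_inv (X : hull Ct) x : sp (@runit_inv X) << x >> = << x *1 unit_word >>.
Proof.
apply: spec_relabel.
- by move=> n m m' -> /pos_inj[].
- by move=> i il; apply: pos1_0.
- move=> w; have [x' [u ->]] := fpair_surj dd w.
  rewrite fpair_tag fpair_letters (unit_word_eq u unit_word) /=.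
  split=> [[/eqP e h]|/(fpair_inj (X := X) (Y := unit_ob phi1)) h].
    suff -> : x' = x by [].
    apply: fam_word_ext => //; apply/ffunP => m.
    by have := h m; rewrite ffunE => /pos_inj[->].
  by rewrite (proj1 h) eqxx; split=> // m; rewrite ffunE unit_letters.
Qed.

Lemma spec_lunit_mpair (Y : hull Cl) u y : sp (lunit_mx phi1 Y) (mpair mud << u >> y) = y.
Proof.
pose L y := sp (lunit_mx phi1 Y) (mpair mud << u >> y).
have LB : {morph L : x y / x - y} by move=> a b; rewrite /L mpairBr raddfB.
by apply: (malg_ext LB (g := id)) => // j; rewrite /L mpairUU spec_lunit.
Qed.

Lemma spec_runit_mpair (X : hull Ct) u x : sp (runit_mx X) (mpair dd x << u >>) = x.
Proof.
pose L x := sp (runit_mx X) (mpair dd x << u >>).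
have LB : {morph L : x y / x - y} by move=> a b; rewrite /L mpairBl raddfB.
by apply: (malg_ext LB (g := id)) => // j; rewrite /L mpairUU spec_runit.
Qed.

End Unitors.

End Constraints.

(* Unification should compare objects [bob T X Y] through their arguments instead of the
   families they denote. *)
Strategy 1000 [act_ob act_map assoc_mx lunit_mx runit_mx relabel_mx fam_comp fam_id spec_basis].
Strategy -10 [bob bmap].

(** * The module category of formal direct sums *)

Section HullModule.
Variables (l : nat) (R : comNzRingType).
Variables (phi1 : {rmorphism intpoly 1 -> R}) (phi : {rmorphism intpoly l -> R}).
Hypothesis phi1E : forall x, phi1 x = phi (sumsubst l x).
Hypothesis Hphi : enough_evaluations phi.
Local Notation Ct := (C0 phi1).
Local Notation Cl := (C0 phi).

Lemma ev_hom1E (E : evaluation phi) x :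
  ev_hom E (phi1 x) = ipeval [tuple sumn (ev_mu E)] x.
Proof. by rewrite phi1E ev_homE; apply: ipeval_sumsubst. Qed.

(** The form in which faithfulness is used: equality of morphisms is tested on words.  The
    lemmas [hull_eq2] to [hull_eq4] specialise it to words of pairs, triples, quadruples. *)
Lemma hull_ext (X Y : hull Cl) (f g : lhom X Y) :
  (forall (E : evaluation phi) (x : {malg int[fam_word (sumn (ev_mu E)) (ev_mu E) X]}),
     mlin (spec_basis (ev_hom E) f) x = mlin (spec_basis (ev_hom E) g) x) -> f = g.
Proof.
move=> h; apply: (spec_faithful Hphi) => E; apply: sdhom_ext => x; exact: h.
Qed.

Lemma hull_category : is_category (hull Cl).
Proof. exact: lin_cat (hull_linear (C0_linear Hphi)). Qed.

Lemma action_functor : is_functor (action phi1 phi).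
Proof.
split.
- case=> X Y; apply: hull_ext => E; apply: (mpair_ext (mud := erefl)) => [x y|x y|x y]; try exact: raddfB.
  rewrite [LHS](spec_act erefl (ev_hom E)).
  by rewrite (spec_id (ev_hom1E E)) (spec_id (ev_homE E)) [RHS](spec_id (ev_homE E)).
- move=> [X Y] [X' Y'] [X'' Y''] [f' g'] [f g]; apply: hull_ext => E.
  apply: (mpair_ext (mud := erefl)) => [x y|x y|x y]; try exact: raddfB.
  rewrite [LHS](spec_act erefl (ev_hom E)).
  rewrite [RHS](spec_comp (ev_homE E)).
  rewrite [X in _ = mlin _ X](spec_act erefl (ev_hom E)).
  rewrite [RHS](spec_act erefl (ev_hom E)) /=.
  by rewrite -(spec_comp (ev_hom1E E)) -(spec_comp (ev_homE E)).
Qed.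

Local Notation A := (action phi1 phi).
Local Notation T := (action phi1 phi1).
Local Notation V1 E X := {malg int[fam_word (sumn (ev_mu E)) [tuple sumn (ev_mu E)] X]}.
Local Notation V2 E X := {malg int[fam_word (sumn (ev_mu E)) (ev_mu E) X]}.
Local Notation W1 E X := (fam_word (sumn (ev_mu E)) [tuple sumn (ev_mu E)] X).
Local Notation W2 E X := (fam_word (sumn (ev_mu E)) (ev_mu E) X).

(** [sp], [sp1], [mp], [mp1] restate linear extension and pairing with products of objects
    written [bob A X Y], as in the axioms of a module category, so that the laws below
    compose without unfolding. *)
Definition sp (E : evaluation phi) (X Y : hull Cl) (f : hom X Y) (x : V2 E X) : V2 E Y :=
  mlin (spec_basis (ev_hom E) f) x.
Definition sp1 (E : evaluation phi) (X Y : hull Ct) (f : hom X Y) (x : V1 E X) : V1 E Y :=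
  mlin (spec_basis (ev_hom E) f) x.
Definition mp (E : evaluation phi) (X : hull Ct) (Y : hull Cl) (x : V1 E X) (y : V2 E Y) :
  V2 E (bob A X Y) := mpair (erefl (sumn (ev_mu E))) x y.
Definition mp1 (E : evaluation phi) (X Y : hull Ct) (x : V1 E X) (y : V1 E Y) :
  V1 E (bob T X Y) := mpair (sumn_singleton (sumn (ev_mu E))) x y.

Lemma hull_eq2 (X : hull Ct) (Y Z : hull Cl) (f g : hom (bob A X Y) Z) :
  (forall (E : evaluation phi) (x : W1 E X) (y : W2 E Y),
     exists2 v, sp f (mp << x >> << y >>) = v & sp g (mp << x >> << y >>) = v) -> f = g.
Proof.
move=> h; apply: hull_ext => E; apply: (mpair_ext (mud := erefl)) => [x y|x y|x y].
- exact: raddfB.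
- exact: raddfB.
- by have [v h1 h2] := h E x y; exact: etrans h1 (esym h2).
Qed.

Lemma hull_eq3 (X Y : hull Ct) (Z W : hull Cl) (f g : hom (bob A (bob T X Y) Z) W) :
  (forall (E : evaluation phi) (x : W1 E X) (y : W1 E Y) (z : W2 E Z), exists2 v,
     sp f (mp (mp1 << x >> << y >>) << z >>) = v &
     sp g (mp (mp1 << x >> << y >>) << z >>) = v) -> f = g.
Proof.
move=> h; apply: hull_eq2 => E xy z; have [x [y ->]] := fpair_surj (sumn_singleton _) xy.
rewrite -(mpairUU (sumn_singleton _)); exact: h.
Qed.

Lemma hull_eq3r (X Y : hull Ct) (Z W : hull Cl) (f g : hom (bob A X (bob A Y Z)) W) :
  (forall (E : evaluation phi) (x : W1 E X) (y : W1 E Y) (z : W2 E Z), exists2 v,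
     sp f (mp << x >> (mp << y >> << z >>)) = v &
     sp g (mp << x >> (mp << y >> << z >>)) = v) -> f = g.
Proof.
move=> h; apply: hull_eq2 => E x yz; have [y [z e]] := fpair_surj (erefl (sumn (ev_mu E))) yz.
have e' : << yz >> = mp << y >> << z >> :> V2 E (bob A Y Z).
  by rewrite e; exact/esym/mpairUU.
rewrite e'; exact: h.
Qed.

Lemma hull_eq4 (X Y Z : hull Ct) (W V : hull Cl) (f g : hom (bob A (bob T (bob T X Y) Z) W) V) :
  (forall (E : evaluation phi) (x : W1 E X) (y : W1 E Y) (z : W1 E Z) (w : W2 E W), exists2 v,
     sp f (mp (mp1 (mp1 << x >> << y >>) << z >>) << w >>) = v &
     sp g (mp (mp1 (mp1 << x >> << y >>) << z >>) << w >>) = v) -> f = g.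
Proof.
move=> h; apply: hull_eq3 => E xy z w; have [x [y ->]] := fpair_surj (sumn_singleton _) xy.
rewrite -(mpairUU (sumn_singleton _)); exact: h.
Qed.

Lemma sp_comp (E : evaluation phi) (X Y Z : hull Cl) (g : hom Y Z) (f : hom X Y)
    (x : V2 E X) y z :
  sp f x = y -> sp g y = z -> sp (g \oc f) x = z.
Proof. by move=> <- <-; exact: (spec_comp (ev_homE E)). Qed.

Lemma sp_id (E : evaluation phi) (X : hull Cl) (x : V2 E X) : sp (idm X) x = x.
Proof. exact: (spec_id (ev_homE E)). Qed.

Lemma sp1_id (E : evaluation phi) (X : hull Ct) (x : V1 E X) : sp1 (idm X) x = x.
Proof. exact: (spec_id (ev_hom1E E)). Qed.

Lemma sp_act (E : evaluation phi) (X X' : hull Ct) (Y Y' : hull Cl) (f : hom X X') (g : hom Y Y')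
    (x : V1 E X) (y : V2 E Y) x' y' :
  sp1 f x = x' -> sp g y = y' -> sp (bmap A f g) (mp x y) = mp x' y'.
Proof. by move=> <- <-; exact: spec_act. Qed.

Lemma sp1_act (E : evaluation phi) (X X' Y Y' : hull Ct) (f : hom X X') (g : hom Y Y')
    (x : V1 E X) (y : V1 E Y) x' y' :
  sp1 f x = x' -> sp1 g y = y' -> sp1 (bmap T f g) (mp1 x y) = mp1 x' y'.
Proof. by move=> <- <-; exact: spec_act. Qed.

Definition assoc2 (X Y : hull Ct) (Z : hull Cl) : hom (bob A (bob T X Y) Z) (bob A X (bob A Y Z)) :=
  assoc_mx X Y Z.
Definition assoc1 (X Y Z : hull Ct) : hom (bob T (bob T X Y) Z) (bob T X (bob T Y Z)) :=
  assoc_mx X Y Z.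
Definition lunit2 (Y : hull Cl) : hom (bob A (unit_ob phi1) Y) Y := lunit_mx phi1 Y.
Definition runit1 (X : hull Ct) : hom (bob T X (unit_ob phi1)) X := runit_mx X.

Arguments assoc2 : clear implicits.
Arguments assoc1 : clear implicits.
Arguments lunit2 : clear implicits.
Arguments runit1 : clear implicits.

Lemma sp_assoc (E : evaluation phi) (X Y : hull Ct) (Z : hull Cl)
    (x : V1 E X) (y : V1 E Y) (z : V2 E Z) :
  sp (assoc2 X Y Z) (mp (mp1 x y) z) = mp x (mp y z).
Proof. exact: spec_assoc_mpair. Qed.

Lemma sp1_assoc (E : evaluation phi) (X Y Z : hull Ct) (x : V1 E X) (y : V1 E Y) (z : V1 E Z) :
  sp1 (assoc1 X Y Z) (mp1 (mp1 x y) z) = mp1 x (mp1 y z).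
Proof. exact: spec_assoc_mpair. Qed.

Lemma sp_lunit (E : evaluation phi) (Y : hull Cl) (u : W1 E (unit_ob phi1)) (y : V2 E Y) :
  sp (lunit2 Y) (mp << u >> y) = y.
Proof. exact: spec_lunit_mpair. Qed.

Lemma sp1_runit (E : evaluation phi) (X : hull Ct) (u : W1 E (unit_ob phi1)) (x : V1 E X) :
  sp1 (runit1 X) (mp1 x << u >>) = x.
Proof. exact: spec_runit_mpair. Qed.

Definition assoc2_inv (X Y : hull Ct) (Z : hull Cl) :
    hom (bob A X (bob A Y Z)) (bob A (bob T X Y) Z) := @assoc_inv l R phi1 phi X Y Z.
Definition lunit2_inv (Y : hull Cl) : hom Y (bob A (unit_ob phi1) Y) := @lunit_inv l R phi1 phi Y.

Arguments assoc2_inv : clear implicits.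
Arguments lunit2_inv : clear implicits.

Lemma sp_assoc_inv (E : evaluation phi) (X Y : hull Ct) (Z : hull Cl)
    (x : W1 E X) (y : W1 E Y) (z : W2 E Z) :
  sp (assoc2_inv X Y Z) (mp << x >> (mp << y >> << z >>)) = mp (mp1 << x >> << y >>) << z >>.
Proof. by rewrite /mp /mp1 !mpairUU; exact: spec_assoc_inv. Qed.

Lemma sp_lunit_inv (E : evaluation phi) (Y : hull Cl) (y : W2 E Y) :
  sp (lunit2_inv Y) << y >> = mp << unit_word (sumn (ev_mu E)) phi1 >> << y >>.
Proof. by rewrite /mp mpairUU; exact: spec_lunit_inv. Qed.

Lemma hull_assoc_iso (X Y : hull Ct) (Z : hull Cl) : is_iso (assoc2 X Y Z).
Proof.
exists (assoc2_inv X Y Z); split.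
- apply: (@hull_eq3 X Y Z) => E x y z; exists (mp (mp1 << x >> << y >>) << z >>); last exact: sp_id.
  exact: sp_comp (sp_assoc _ _ _) (sp_assoc_inv _ _ _).
- apply: (@hull_eq3r X Y Z) => E x y z; exists (mp << x >> (mp << y >> << z >>)); last exact: sp_id.
  exact: sp_comp (sp_assoc_inv _ _ _) (sp_assoc _ _ _).
Qed.

Lemma hull_lunit_iso (Y : hull Cl) : is_iso (lunit2 Y).
Proof.
exists (lunit2_inv Y); split.
- apply: (@hull_eq2 (unit_ob phi1) Y) => E u y; exists (mp << u >> << y >>); last exact: sp_id.
  rewrite (unit_word_eq u (unit_word _ _)).
  exact: sp_comp (sp_lunit _ _) (sp_lunit_inv _).
- apply: hull_ext => E; apply: malg_ext => [x y|x y|y]; try exact: raddfB.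
  rewrite -[LHS]/(sp _ << y >>) -[RHS]/(sp _ << y >>) sp_id.
  exact: sp_comp (sp_lunit_inv _) (sp_lunit _ _).
Qed.

(** On a word of pairs, triples or quadruples both sides of each axiom are evaluated by
    the rules [sp_comp], [sp_act], [sp_assoc], [sp_lunit]. *)
Lemma hull_module : is_module_category (C := hull Ct) (T := T) (U := unit_ob phi1)
  assoc1 runit1 (D := hull Cl) (A := A) assoc2 lunit2.
Proof.
split.
- exact: hull_category.
- exact: action_functor.
- exact: hull_assoc_iso.
- move=> X X' Y Y' M M' f g h; apply: (@hull_eq3 X Y M) => E x y z.
  exists (mp (sp1 f << x >>) (mp (sp1 g << y >>) (sp h << z >>))).
    exact: sp_comp (sp_act (sp1_act erefl erefl) erefl) (sp_assoc _ _ _).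
  exact: sp_comp (sp_assoc _ _ _) (sp_act erefl (sp_act erefl erefl)).
- exact: hull_lunit_iso.
- move=> M M' f; apply: (@hull_eq2 (unit_ob phi1) M) => E u y; exists (sp f << y >>).
    exact: sp_comp (sp_act (sp1_id _) erefl) (sp_lunit _ _).
  exact: sp_comp (sp_lunit _ _) erefl.
- move=> X Y Z M; apply: (@hull_eq4 X Y Z M) => E x y z w.
  exists (mp << x >> (mp << y >> (mp << z >> << w >>))).
    exact: sp_comp (sp_assoc _ _ _) (sp_assoc _ _ _).
  exact: sp_comp (sp_act (sp1_assoc _ _ _) (sp_id _))
    (sp_comp (sp_assoc _ _ _) (sp_act (sp1_id _) (sp_assoc _ _ _))).
- move=> X M; apply: (@hull_eq3 X (unit_ob phi1) M) => E x u y; exists (mp << x >> << y >>).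
    exact: sp_comp (sp_assoc _ _ _) (sp_act (sp1_id _) (sp_lunit _ _)).
  exact: sp_act (sp1_runit _ _) (sp_id _).
Qed.

End HullModule.

Section HullMonoidal.
Variables (R : comNzRingType) (phi : {rmorphism intpoly 1 -> R}).
Hypothesis Hphi : enough_evaluations phi.
Local Notation Ct := (C0 phi).
Local Notation T := (action phi phi).
Local Notation V d X := {malg int[fam_word d [tuple d] X]}.

(** For one variable the composition of an evaluation is determined by its size. *)
Lemma hull_ext1 (X Y : hull Ct) (f g : lhom X Y) :
  (forall d (ev : {rmorphism R -> int}), (forall x, ev (phi x) = ipeval [tuple d] x) ->
     forall x : V d X, mlin (spec_basis ev f) x = mlin (spec_basis ev g) x) -> f = g.
Proof.
move=> h; apply: (hull_ext Hphi) => -[mu ev evE] /=.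
have e : [tuple sumn mu] = mu.
  apply/eq_from_tnth => i; rewrite !(tnth_nth 0%N) ord1 /=.
  by case: (mu) => -[|a [|//]] //= _; rewrite addn0.
have evE' x : ev (phi x) = ipeval [tuple sumn mu] x by rewrite e.
by move: (sumn mu) (h _ ev evE') e => d + e; case: _ / e.
Qed.

Definition tmp d (X Y : hull Ct) (x : V d X) (y : V d Y) : V d (bob T X Y) :=
  mpair (sumn_singleton d) x y.

Definition tsp (ev : {rmorphism R -> int}) d (X Y : hull Ct) (f : hom X Y) (x : V d X) : V d Y :=
  mlin (spec_basis ev f) x.

Lemma hull_ext1_pair (X Y Z : hull Ct) (f g : hom (bob T X Y) Z) :
  (forall d (ev : {rmorphism R -> int}), (forall x, ev (phi x) = ipeval [tuple d] x) ->
     forall (x : fam_word d [tuple d] X) (y : fam_word d [tuple d] Y),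
     exists2 v, tsp ev f (tmp << x >> << y >>) = v & tsp ev g (tmp << x >> << y >>) = v) -> f = g.
Proof.
move=> h; apply: hull_ext1 => d ev evE.
apply: (mpair_ext (mud := sumn_singleton d)) => [x y|x y|x y].
- exact: raddfB.
- exact: raddfB.
- by have [v h1 h2] := h d ev evE x y; exact: etrans h1 (esym h2).
Qed.

Definition trunit (X : hull Ct) : hom (bob T X (unit_ob phi)) X := runit_mx X.
Definition trunit_inv (X : hull Ct) : hom X (bob T X (unit_ob phi)) := @runit_inv R phi X.
Arguments trunit : clear implicits.
Arguments trunit_inv : clear implicits.

Section FixEvaluation.
Variables (d : nat) (ev : {rmorphism R -> int}).
Hypothesis evE : forall x, ev (phi x) = ipeval [tuple d] x.

Lemma tsp_comp (X Y Z : hull Ct) (g : hom Y Z) (f : hom X Y) (x : V d X) y z :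
  tsp ev f x = y -> tsp ev g y = z -> tsp ev (g \oc f) x = z.
Proof. by move=> <- <-; exact: (spec_comp evE). Qed.

Lemma tsp_id (X : hull Ct) (x : V d X) : tsp ev (idm X) x = x.
Proof. exact: (spec_id evE). Qed.

Lemma tsp_act (X X' Y Y' : hull Ct) (f : hom X X') (g : hom Y Y') (x : V d X) (y : V d Y) x' y' :
  tsp ev f x = x' -> tsp ev g y = y' -> tsp ev (bmap T f g) (tmp x y) = tmp x' y'.
Proof. by move=> <- <-; exact: spec_act. Qed.

Lemma tsp_runit (X : hull Ct) (x : V d X) u : tsp ev (trunit X) (tmp x << u >>) = x.
Proof. exact: spec_runit_mpair. Qed.

Lemma tsp_runit_inv (X : hull Ct) (x : fam_word d [tuple d] X) :
  tsp ev (trunit_inv X) << x >> = tmp << x >> << unit_word d phi >>.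
Proof. by rewrite /tmp mpairUU; exact: spec_runit_inv. Qed.

End FixEvaluation.

Lemma hull_runit_iso (X : hull Ct) : is_iso (trunit X).
Proof.
exists (trunit_inv X); split.
- apply: (@hull_ext1_pair X (unit_ob phi)) => d ev evE x u; exists (tmp << x >> << u >>); last first.
    exact: tsp_id.
  rewrite (unit_word_eq u (unit_word _ _)).
  exact: tsp_comp (tsp_runit _ _ _) (tsp_runit_inv _ _).
- apply: hull_ext1 => d ev evE; apply: malg_ext => [x y|x y|x]; try exact: raddfB.
  rewrite -[LHS]/(tsp ev _ << x >>) -[RHS]/(tsp ev _ << x >>) tsp_id //.
  exact: tsp_comp (tsp_runit_inv _ _) (tsp_runit _ _ _).
Qed.

Lemma hull_runit_nat (X X' : hull Ct) (f : hom X X') :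
  trunit X' \oc bmap T f (idm (unit_ob phi)) = f \oc trunit X.
Proof.
apply: (@hull_ext1_pair X (unit_ob phi)) => d ev evE x u; exists (tsp ev f << x >>).
  exact: tsp_comp (tsp_act erefl (tsp_id _ _)) (tsp_runit _ _ _).
exact: tsp_comp (tsp_runit _ _ _) erefl.
Qed.

Lemma phi_sumsubst1 x : phi x = phi (sumsubst 1 x).
Proof. by rewrite sumsubst1. Qed.

Lemma hull_monoidal : is_monoidal (C := hull Ct) (T := T) (U := unit_ob phi)
  (@assoc_mx 1 R phi phi) (@lunit_mx 1 R phi phi) (@runit_mx R phi).
Proof.
have H := hull_module phi_sumsubst1 Hphi; split.
- exact: mod_cat H.
- exact: mod_functor H.
- exact: mod_assoc_iso H.
- exact: mod_assoc_nat H.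
- exact: mod_unit_iso H.
- exact: mod_unit_nat H.
- exact: hull_runit_iso.
- exact: hull_runit_nat.
- exact: mod_pentagon H.
- exact: mod_triangle H.
Qed.

End HullMonoidal.

(** * Change of scalars *)

(** An object is a vector whatever the scalars are; passing through [wt l] keeps this
    identification from being recomputed. *)
Definition as_wt (l : nat) (R : comNzRingType) (phi : {rmorphism intpoly l -> R})
  (a : lob (C0 phi)) : wt l := a.
Definition of_wt (l : nat) (R : comNzRingType) (phi : {rmorphism intpoly l -> R})
  (a : wt l) : lob (C0 phi) := a.

Strategy 1000 [xi_comp C0_comp act_component relabel bext lext].

Section BaseChange.
Variables (R R' : comNzRingType) (psi : {rmorphism R -> R'}).

(** When [psi] is surjective, morphisms lift, so identities between them pass to the new
    scalars. *)
Definition bc (K : choiceType) (f : {malg R[K]}) : {malg R'[K]} :=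
  \sum_(k <- msupp f) << psi f@_k *g k >>.

Strategy 1000 [bc].

Lemma bcE (K : choiceType) (f : {malg R[K]}) k : (bc f)@_k = psi f@_k.
Proof.
rewrite /bc raddf_sum /=.
transitivity (\sum_(j <- msupp f) psi f@_j *+ (j == k)).
  by apply: eq_bigr => j _; rewrite mcoeffU.
case: (boolP (k \in msupp f)) => h.
  by rewrite (bigD1_seq k) ?fset_uniq //= eqxx big1 ?addr0 // => j /negbTE ->.
rewrite (mcoeff_outdom h) rmorph0 big_seq big1 // => j hj.
by case: eqP => // e; rewrite -e hj in h.
Qed.

Lemma bc0 (K : choiceType) : bc (0 : {malg R[K]}) = 0.
Proof. by apply/malgP => k; rewrite bcE !mcoeff0 rmorph0. Qed.

Lemma bcD (K : choiceType) : {morph @bc K : f g / f + g}.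
Proof. by move=> f g; apply/malgP => k; rewrite !(bcE, mcoeffD) rmorphD. Qed.

Lemma bcZ (K : choiceType) x (f : {malg R[K]}) : bc (x *: f) = psi x *: bc f.
Proof. by apply/malgP => k; rewrite !(bcE, mcoeffZ) rmorphM. Qed.

Lemma bc_sum (K : choiceType) (I : Type) (r : seq I) (P : pred I) (F : I -> {malg R[K]}) :
  bc (\sum_(i <- r | P i) F i) = \sum_(i <- r | P i) bc (F i).
Proof. exact: (big_morph _ (@bcD K) (bc0 K)). Qed.

Lemma bc_supp (K : choiceType) (f : {malg R[K]}) : (msupp (bc f) `<=` msupp f)%fset.
Proof.
apply/fsubsetP => k; rewrite -!mcoeff_neq0 bcE; apply: contraNN => /eqP ->.
by rewrite rmorph0.
Qed.

Lemma bc_lext (K L : choiceType) (B : K -> {malg R[L]}) (B' : K -> {malg R'[L]}) f :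
  (forall k, bc (B k) = B' k) -> bc (lext B f) = lext B' (bc f).
Proof.
move=> BB; rewrite (lextEw B' (bc_supp f)) /lext bc_sum; apply: eq_bigr => k _.
by rewrite bcZ bcE BB.
Qed.

Lemma bc_bext (K K' L : choiceType) (B : K -> K' -> {malg R[L]}) (B' : K -> K' -> {malg R'[L]}) f g :
  (forall k j, bc (B k j) = B' k j) -> bc (bext B f g) = bext B' (bc f) (bc g).
Proof.
by move=> BB; rewrite !bextE; apply: bc_lext => k; apply: bc_lext => j; exact: BB.
Qed.

(** If [S] is infinite, both sums are 0 by convention. *)
Lemma bc_indicator (K : choiceType) (S : set K) :
  bc (\sum_(q \in S) (<< q >> : {malg R[K]})) = \sum_(q \in S) (<< q >> : {malg R'[K]}).
Proof.
have [fS|iS] := pselect (finite_set S).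
  by apply/malgP => k; rewrite bcE !mcoeff_indicator // rmorph_nat.
have inf (Q : comNzRingType) : \sum_(q \in S) (<< q >> : {malg Q[K]}) = 0.
  apply: fsbig_dflt; rewrite (_ : S `&` _ = S) //; apply/seteqP; split=> [q [] //|q Sq].
  by split=> //=; apply/eqP; rewrite monalgU_eq0 oner_eq0.
by rewrite !inf bc0.
Qed.

Lemma bc_relabel (l : nat) G (a b : wt l) :
  bc (relabel G a b : {malg R[lmat a b]}) = (relabel G a b : {malg R'[lmat a b]}).
Proof. exact: bc_indicator. Qed.

Hypothesis psi_surj : forall y, exists x, psi x = y.

Lemma bc_surj (K : choiceType) (g : {malg R'[K]}) : exists f, bc f = g.
Proof.
have [s sK] := choice psi_surj.
exists (\sum_(k <- msupp g) << s g@_k *g k >>); rewrite bc_sum [RHS]monalgE.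
by apply: eq_bigr => k _; apply/malgP => j; rewrite bcE !mcoeffU; case: eqP => _; rewrite ?sK ?rmorph0.
Qed.

Section Composition.
Variables (l : nat) (phi : {rmorphism intpoly l -> R}) (phi' : {rmorphism intpoly l -> R'}).
Hypothesis phiE : forall x, psi (phi x) = phi' x.

Lemma bc_comp (a b c : wt l) (g : {malg R[lmat b c]}) (f : {malg R[lmat a b]}) :
  bc (C0_comp phi g f) = C0_comp phi' (bc g) (bc f).
Proof.
apply: (bc_bext (B := fun r s => xi_comp phi r s) (B' := fun r s => xi_comp phi' r s)) => r s.
apply/malgP => q; apply: etrans (bcE _ _) _; apply: etrans (congr1 psi (xi_compE _ _ _ _)) _.
by rewrite phiE; exact/esym/xi_compE.
Qed.

Lemma bc_comp_eq (a b c : wt l) (g : {malg R[lmat b c]}) (f : {malg R[lmat a b]}) g' f' h :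
  bc g = g' -> bc f = f' -> C0_comp phi g f = h -> C0_comp phi' g' f' = bc h.
Proof. by move=> <- <- <-; exact/esym/bc_comp. Qed.

Hypothesis H : is_category (C0 phi).

Lemma C0_id_left_bc (a b : wt l) (f : {malg R'[lmat a b]}) : C0_comp phi' (relabel eq b b) f = f.
Proof.
have [g <-] := bc_surj f.
exact: bc_comp_eq (bc_relabel eq b b) erefl (@comp1m (C0 phi) H a b g).
Qed.

Lemma C0_id_right_bc (a b : wt l) (f : {malg R'[lmat a b]}) : C0_comp phi' f (relabel eq a a) = f.
Proof.
have [g <-] := bc_surj f.
exact: bc_comp_eq erefl (bc_relabel eq a a) (@compm1 (C0 phi) H a b g).
Qed.

Lemma C0_assoc_bc (a b c d : wt l) (h : {malg R'[lmat c d]}) (g : {malg R'[lmat b c]})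
    (f : {malg R'[lmat a b]}) :
  C0_comp phi' h (C0_comp phi' g f) = C0_comp phi' (C0_comp phi' h g) f.
Proof.
have [h1 <-] := bc_surj h; have [g1 <-] := bc_surj g; have [f1 <-] := bc_surj f.
apply: etrans (bc_comp_eq erefl (bc_comp _ _) (@compA (C0 phi) H a b c d h1 g1 f1)) _.
apply: etrans (bc_comp _ _) _; congr (C0_comp phi' _ _); exact: bc_comp.
Qed.

Lemma C0_category_bc : is_category (C0 phi').
Proof. split; [exact: C0_id_left_bc|exact: C0_id_right_bc|exact: C0_assoc_bc]. Qed.

End Composition.

Lemma bc_act (l : nat) (a a' : wt 1) (b b' v v' : wt l) (f : {malg R[lmat a a']}) (g : {malg R[lmat b b']}) :
  bc (act_component f g v v') = act_component (bc f) (bc g) v v'.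
Proof.
by apply: (bc_bext (B := fun p q => _) (B' := fun p q => _)) => p q; exact: bc_indicator.
Qed.

(** ** Monoidal structure *)

Variables (phi : {rmorphism intpoly 1 -> R}) (phi' : {rmorphism intpoly 1 -> R'}).
Hypothesis phiE : forall x, psi (phi x) = phi' x.
Local Notation C := (hull (C0 phi)).
Local Notation C' := (hull (C0 phi')).
Local Notation T := (action phi phi).
Local Notation T' := (action phi' phi').

Definition bc_ob (X : C) : C' := @Family R' (C0 phi') (fidx X) (fun i => of_wt phi' (as_wt (fam X i))).

Definition bc_hom (X Y : C) (f : hom X Y) : hom (bc_ob X) (bc_ob Y) := fun i j => bc (f i j).

Lemma bc_ob_surj (X : C') : exists Y, bc_ob Y = X.
Proof. by case: X => I F; exists (@Family R (C0 phi) I (fun i => of_wt phi (as_wt (F i)))). Qed.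

Lemma bc_hom_surj (X Y : C) (f : hom (bc_ob X) (bc_ob Y)) : exists g : hom X Y, bc_hom g = f.
Proof.
pose g : hom X Y := fun i j => projT1 (cid (bc_surj (f i j))).
by exists g; apply: dmatP => i j; rewrite /bc_hom /g; case: cid.
Qed.

Lemma bc_hom_comp (X Y Z : C) (g : hom Y Z) (f : hom X Y) : bc_hom (g \oc f) = bc_hom g \oc bc_hom f.
Proof.
apply: dmatP => i k; rewrite /bc_hom /comp /= /fam_comp bc_sum.
by apply: eq_bigr => j _; exact: bc_comp.
Qed.

Lemma bc_hom_id (X : C) : bc_hom (idm X) = idm (bc_ob X).
Proof.
apply: dmatP => i j; rewrite /bc_hom /idm /= /fam_id; case: eqP => [e|_]; last exact: bc0.
by subst j; exact: bc_indicator.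
Qed.

Lemma bc_hom_act (X X' Y Y' : C) (f : hom X X') (g : hom Y Y') :
  bc_hom (bmap T f g : hom (bob T X Y) (bob T X' Y')) =
  bmap T' (bc_hom f) (bc_hom g) :> hom (bob T' (bc_ob X) (bc_ob Y)) (bob T' (bc_ob X') (bc_ob Y')).
Proof.
apply: dmatP => i j.
exact: (@bc_act 1 (fam X (tag j).1) (fam X' (tag i).1) (fam Y (tag j).2) (fam Y' (tag i).2)
  (val (tagged j)) (val (tagged i)) (f _ _) (g _ _)).
Qed.

(** The equation [bc_ob (bob T X Y) = bob T' (bc_ob X) (bc_ob Y)] holds by computation, but
    iterating it inside the types of morphisms is prohibitive.  The relation [lifts] lets a
    morphism over [R'] be obtained from one over [R] up to such equations, one product at a
    time. *)
Inductive lifts (X Y : C) (f : hom X Y) : forall X' Y' : C', hom X' Y' -> Prop :=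
  Lifts : @lifts X Y f (bc_ob X) (bc_ob Y) (bc_hom f).

Definition hcast (X X' Y Y' : C') (eX : X = X') (eY : Y = Y') (f : hom X Y) : hom X' Y' :=
  ecast Z (hom X' Z) eY (ecast Z (hom Z Y) eX f).

Lemma liftsE (X Y : C) (f : hom X Y) (X' Y' : C') (f' : hom X' Y') :
  lifts f f' -> exists (eX : bc_ob X = X') (eY : bc_ob Y = Y'), hcast eX eY (bc_hom f) = f'.
Proof. by case; exists erefl, erefl. Qed.

(** Equations between morphisms over [R] yield equations between what they lift to; with
    [lifts_comp], [lifts_act] and the constraints this transfers every axiom. *)
Lemma lifts_eq (X Y : C) (f g : hom X Y) (X' Y' : C') (f' g' : hom X' Y') :
  lifts f f' -> lifts g g' -> f = g -> f' = g'.
Proof.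
move=> /liftsE[eX [eY <-]] /liftsE[eX1 [eY1 <-]] ->.
by rewrite (Prop_irrelevance eX eX1) (Prop_irrelevance eY eY1).
Qed.

Lemma lifts_comp (X Y Z : C) (g : hom Y Z) (f : hom X Y) (X' Y' Z' : C') (g' : hom Y' Z') (f' : hom X' Y') :
  lifts g g' -> lifts f f' -> lifts (g \oc f) (g' \oc f').
Proof.
move=> /liftsE[eY [eZ <-]] /liftsE[eX [eY1 <-]].
case: _ / eX; case: _ / eZ; case: _ / eY1 eY => eY.
by rewrite (Prop_irrelevance eY erefl); move: (Lifts (g \oc f)); rewrite bc_hom_comp.
Qed.

Lemma lifts_id (X : C) (X' : C') : bc_ob X = X' -> lifts (idm X) (idm X').
Proof. by case: _ /; move: (Lifts (idm X)); rewrite bc_hom_id. Qed.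

Lemma lifts_ex (X Y : C) (X' Y' : C') (f' : hom X' Y') : bc_ob X = X' -> bc_ob Y = Y' ->
  exists f : hom X Y, lifts f f'.
Proof.
move=> eX eY; case: _ / eX f'; case: _ / eY => f'.
by have [f <-] := bc_hom_surj f'; exists f.
Qed.

Lemma bc_ob_bob (X Y : C) : bc_ob (bob T X Y) = bob T' (bc_ob X) (bc_ob Y).
Proof. by []. Qed.

Lemma bc_ob_unit : bc_ob (unit_ob phi) = unit_ob phi'.
Proof. by []. Qed.

Definition arrow (X Y : C') (f : hom X Y) : {X' : C' & {Y' : C' & hom X' Y'}} :=
  existT _ X (existT _ Y f).

Lemma lifts_arrow (X Y : C) (f : hom X Y) (X' Y' : C') (f' : hom X' Y') :
  arrow (bc_hom f) = arrow f' -> lifts f f'.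
Proof.
exact: (@eq_ind _ (arrow (bc_hom f)) (fun A => lifts f (projT2 (projT2 A))) (Lifts f) (arrow f')).
Qed.

Lemma lifts_act (X X' Y Y' : C) (f : hom X X') (g : hom Y Y') (X1 X1' Y1 Y1' : C')
    (f1 : hom X1 X1') (g1 : hom Y1 Y1') :
  lifts f f1 -> lifts g g1 -> lifts (bmap T f g) (bmap T' f1 g1).
Proof.
case=> -[]; apply: lifts_arrow.
exact: (congr1 (fun h => @arrow (bob T' (bc_ob X) (bc_ob Y)) (bob T' (bc_ob X') (bc_ob Y')) h) (bc_hom_act f g)).
Qed.

(** The associator, with the families [X # Y] and [Y # Z] and the labelling of their members
    as parameters, so that base change need not look inside these families. *)
Definition assoc_gen (S : comNzRingType) (chi : {rmorphism intpoly 1 -> S}) (I J K : finType)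
    (X XY Z YZ : hull (C0 chi)) (h : fidx X -> I) (t : fidx XY -> I * J) (s : fidx YZ -> J * K)
    (k : fidx Z -> K) :
    hom (bob (action chi chi) XY Z) (bob (action chi chi) X YZ) :=
  fun z x =>
    if [&& (t (tag x).1).1 == h (tag z).1, (t (tag x).1).2 == (s (tag z).2).1
         & k (tag x).2 == (s (tag z).2).2]
    then relabel (fun n m => exists i j k,
           n = pos 1 (i, pos 1 (j, k)) /\ m = pos 1 (pos 1 (i, j), k)) _ _
    else 0.

Definition labelled (I : Type) : Type := {W : C' & fidx W -> I}.

Lemma bc_if (l : nat) (b : bool) G (v w : wt l) :
  bc (if b then relabel G v w else 0 : {malg R[lmat v w]}) =
  (if b then relabel G v w else 0 : {malg R'[lmat v w]}).
Proof. by case: b; [exact: bc_relabel|exact: bc0]. Qed.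

Definition bc_ob_lab (X : C) (I : Type) (t : fidx X -> I) : fidx (bc_ob X) -> I := t.
Strategy -10 [bc_ob_lab].

Definition to_bob (X Y Z W : C) (f : hom (bc_ob (bob T X Y)) (bc_ob (bob T Z W))) :
  hom (bob T' (bc_ob X) (bc_ob Y)) (bob T' (bc_ob Z) (bc_ob W)) := f.

Lemma arrow_to_bob (X Y Z W : C) (f : hom (bc_ob (bob T X Y)) (bc_ob (bob T Z W))) :
  arrow f = arrow (to_bob f).
Proof. by []. Qed.

Lemma bc_hom_assoc_gen (I J K : finType) (X XY Z YZ : C) (h : fidx X -> I) (t : fidx XY -> I * J)
    (s : fidx YZ -> J * K) (k : fidx Z -> K) :
  to_bob (bc_hom (assoc_gen (chi := phi) h t s k)) =
  assoc_gen (chi := phi') (X := bc_ob X) (XY := bc_ob XY) (Z := bc_ob Z) (YZ := bc_ob YZ)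
    (bc_ob_lab h) (bc_ob_lab t) (bc_ob_lab s) (bc_ob_lab k)
  :> hom (bob T' (bc_ob XY) (bc_ob Z)) (bob T' (bc_ob X) (bc_ob YZ)).
Proof.
apply: functional_extensionality_dep => z; apply: functional_extensionality_dep => x.
exact: (@bc_if 1 [&& (t (tag x).1).1 == h (tag z).1, (t (tag x).1).2 == (s (tag z).2).1
         & k (tag x).2 == (s (tag z).2).2] _ (val (tagged x)) (val (tagged z))).
Qed.

Definition act_lab (S : comNzRingType) (chi : {rmorphism intpoly 1 -> S}) (X Y : hull (C0 chi)) :
    fidx (bob (action chi chi) X Y) -> fidx X * fidx Y :=
  fun i : {ij : fidx X * fidx Y & fset_set (act_index (fam X ij.1) (fam Y ij.2))} => tag i.
Arguments act_lab {S chi} X Y.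
Definition of_lab (X Y : C) (I : Type) (t : I -> fidx (bc_ob X) * fidx (bc_ob Y)) : I -> fidx X * fidx Y := t.

Strategy -10 [of_lab act_lab].

Lemma bc_ob_bob_tag (X Y : C) :
  existT (fun W => fidx W -> fidx X * fidx Y) (bc_ob (bob T X Y)) (bc_ob_lab (act_lab X Y)) =
  existT (fun W => fidx W -> fidx X * fidx Y) (bob T' (bc_ob X) (bc_ob Y))
    (of_lab (act_lab (bc_ob X) (bc_ob Y))) :> labelled (fidx X * fidx Y).
Proof. by []. Qed.

Lemma lifts_assoc (X Y Z : C) :
  lifts (assoc_mx X Y Z : hom (bob T (bob T X Y) Z) (bob T X (bob T Y Z)))
    (assoc_mx (bc_ob X) (bc_ob Y) (bc_ob Z) :
       hom (bob T' (bob T' (bc_ob X) (bc_ob Y)) (bc_ob Z)) (bob T' (bc_ob X) (bob T' (bc_ob Y) (bc_ob Z)))).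
Proof.
apply: lifts_arrow.
pose G (W : labelled (fidx X * fidx Y)) (V : labelled (fidx Y * fidx Z)) :=
  arrow (assoc_gen (chi := phi') (X := bc_ob X) (XY := projT1 W) (Z := bc_ob Z) (YZ := projT1 V)
    (bc_ob_lab (X := X) id) (projT2 W) (projT2 V) (bc_ob_lab (X := Z) id)).
have e := congr2 G (bc_ob_bob_tag X Y) (bc_ob_bob_tag Y Z).
apply: etrans e.
pose u := bc_hom_assoc_gen (XY := bob T X Y) (YZ := bob T Y Z) (X := X) (Z := Z) id
  (act_lab X Y) (act_lab Y Z) id.
apply: etrans (congr1 (@arrow _ _) u).
apply: etrans (arrow_to_bob _).
by [].
Qed.

(** The unitors, with the unit object as parameter for the same reason. *)
Definition lunit_gen (S : comNzRingType) (chi : {rmorphism intpoly 1 -> S}) (U X : hull (C0 chi)) :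
    hom (bob (action chi chi) U X) X :=
  fun y x => if (tag x).2 == y then relabel (fun n m => m = pos 1 (0%N, n)) _ _ else 0.

Definition runit_gen (S : comNzRingType) (chi : {rmorphism intpoly 1 -> S}) (U X : hull (C0 chi)) :
    hom (bob (action chi chi) X U) X :=
  fun y x => if (tag x).1 == y then relabel (fun n m => m = pos 1 (n, 0%N)) _ _ else 0.
Arguments lunit_gen {S chi} U X : rename.
Arguments runit_gen {S chi} U X : rename.

Definition to_bobl (X Y Z : C) (f : hom (bc_ob (bob T X Y)) (bc_ob Z)) :
  hom (bob T' (bc_ob X) (bc_ob Y)) (bc_ob Z) := f.

Lemma arrow_to_bobl (X Y Z : C) (f : hom (bc_ob (bob T X Y)) (bc_ob Z)) :
  arrow f = arrow (to_bobl f).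
Proof. by []. Qed.

Lemma bc_hom_lunit_gen (U X : C) : to_bobl (bc_hom (lunit_gen U X)) = lunit_gen (bc_ob U) (bc_ob X).
Proof.
apply: functional_extensionality_dep => y; apply: functional_extensionality_dep => x.
exact: (@bc_if 1 ((tag x).2 == y) _ (val (tagged x)) (fam X y)).
Qed.

Lemma bc_hom_runit_gen (U X : C) : to_bobl (bc_hom (runit_gen U X)) = runit_gen (bc_ob U) (bc_ob X).
Proof.
apply: functional_extensionality_dep => y; apply: functional_extensionality_dep => x.
exact: (@bc_if 1 ((tag x).1 == y) _ (val (tagged x)) (fam X y)).
Qed.

Lemma lifts_lunit (X : C) :
  lifts (lunit_mx phi X : hom (bob T (unit_ob phi) X) X)
    (lunit_mx phi' (bc_ob X) : hom (bob T' (unit_ob phi') (bc_ob X)) (bc_ob X)).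
Proof.
apply: lifts_arrow.
have e : arrow (lunit_gen (bc_ob (unit_ob phi)) (bc_ob X)) = arrow (lunit_gen (unit_ob phi') (bc_ob X)).
  by rewrite bc_ob_unit.
apply: etrans e.
apply: etrans (congr1 (@arrow _ _) (bc_hom_lunit_gen (unit_ob phi) X)).
exact: arrow_to_bobl.
Qed.

Lemma lifts_runit (X : C) :
  lifts (runit_mx X : hom (bob T X (unit_ob phi)) X)
    (runit_mx (bc_ob X) : hom (bob T' (bc_ob X) (unit_ob phi')) (bc_ob X)).
Proof.
apply: lifts_arrow.
have e : arrow (runit_gen (bc_ob (unit_ob phi)) (bc_ob X)) = arrow (runit_gen (unit_ob phi') (bc_ob X)).
  by rewrite bc_ob_unit.
apply: etrans e.
apply: etrans (congr1 (@arrow _ _) (bc_hom_runit_gen (unit_ob phi) X)).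
exact: arrow_to_bobl.
Qed.

Lemma lifts_iso (X Y : C) (f : hom X Y) (X' Y' : C') (f' : hom X' Y') :
  lifts f f' -> is_iso f -> is_iso f'.
Proof.
case=> -[g [gf fg]]; exists (bc_hom g); split.
  exact: etrans (esym (bc_hom_comp g f)) (etrans (congr1 (@bc_hom X X) gf) (bc_hom_id X)).
exact: etrans (esym (bc_hom_comp f g)) (etrans (congr1 (@bc_hom Y Y) fg) (bc_hom_id Y)).
Qed.

Lemma lifts_idm (X : C) : lifts (idm X) (idm (bc_ob X)).
Proof. exact: lifts_id erefl. Qed.

Lemma lifts_idm_bob (X Y : C) : lifts (idm (bob T X Y)) (idm (bob T' (bc_ob X) (bc_ob Y))).
Proof. exact: lifts_id (bc_ob_bob X Y). Qed.

Lemma lifts_idm_unit : lifts (idm (unit_ob phi)) (idm (unit_ob phi')).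
Proof. exact: lifts_id bc_ob_unit. Qed.

Definition tensor_assoc (S : comNzRingType) (chi : {rmorphism intpoly 1 -> S}) (X Y Z : hull (C0 chi)) :
  hom (bob (action chi chi) (bob (action chi chi) X Y) Z) (bob (action chi chi) X (bob (action chi chi) Y Z)) :=
  assoc_mx X Y Z.
Definition tensor_lunit (S : comNzRingType) (chi : {rmorphism intpoly 1 -> S}) (X : hull (C0 chi)) :
  hom (bob (action chi chi) (unit_ob chi) X) X := lunit_mx chi X.
Definition tensor_runit (S : comNzRingType) (chi : {rmorphism intpoly 1 -> S}) (X : hull (C0 chi)) :
  hom (bob (action chi chi) X (unit_ob chi)) X := runit_mx X.
Arguments tensor_assoc {S chi} X Y Z : rename.
Arguments tensor_lunit {S chi} X : rename.
Arguments tensor_runit {S chi} X : rename.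

Lemma lifts_assocE (X Y Z : C) (X' Y' Z' : C') : bc_ob X = X' -> bc_ob Y = Y' -> bc_ob Z = Z' ->
  lifts (tensor_assoc X Y Z) (tensor_assoc X' Y' Z').
Proof. move=> <- <- <-; exact: lifts_assoc. Qed.

Lemma lifts_lunitE (X : C) : lifts (tensor_lunit X) (tensor_lunit (bc_ob X)).
Proof. exact: lifts_lunit. Qed.

Lemma lifts_runitE (X : C) : lifts (tensor_runit X) (tensor_runit (bc_ob X)).
Proof. exact: lifts_runit. Qed.

Lemma action_functor_bc : is_functor T -> is_functor T'.
Proof.
move=> H; split.
- move=> [X' Y']; have [X <-] := bc_ob_surj X'; have [Y <-] := bc_ob_surj Y'.
  exact: lifts_eq (lifts_act (lifts_idm X) (lifts_idm Y)) (lifts_idm_bob X Y) (fmap1 H (X, Y)).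
- move=> [X1 Y1] [X2 Y2] [X3 Y3] [g1 g2] [f1 f2].
  have [X eX] := bc_ob_surj X1; have [Y eY] := bc_ob_surj Y1.
  have [X' eX'] := bc_ob_surj X2; have [Y' eY'] := bc_ob_surj Y2.
  have [X'' eX''] := bc_ob_surj X3; have [Y'' eY''] := bc_ob_surj Y3.
  have [g lg] := lifts_ex g1 eX' eX''; have [h lh] := lifts_ex g2 eY' eY''.
  have [f lf] := lifts_ex f1 eX eX'; have [k lk] := lifts_ex f2 eY eY'.
  exact: lifts_eq (lifts_act (lifts_comp lg lf) (lifts_comp lh lk))
    (lifts_comp (lifts_act lg lh) (lifts_act lf lk))
    (@fmapM _ _ _ H (X, Y) (X', Y') (X'', Y'') (g, h) (f, k)).
Qed.

Lemma lifts_assoc1 (X Y Z : C) : lifts (tensor_assoc X Y Z) (tensor_assoc (bc_ob X) (bc_ob Y) (bc_ob Z)).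
Proof. exact: lifts_assocE. Qed.

Lemma hull_monoidal_bc : is_category (C0 phi) ->
  is_monoidal (C := C) (T := T) (U := unit_ob phi) tensor_assoc tensor_lunit tensor_runit ->
  is_monoidal (C := C') (T := T') (U := unit_ob phi') tensor_assoc tensor_lunit tensor_runit.
Proof.
move=> H0 H; split.
- exact: lin_cat (hull_linear (C0_linear_of_category (C0_category_bc phiE H0))).
- exact: action_functor_bc (mon_functor H).
- move=> X' Y' Z'; have [X <-] := bc_ob_surj X'; have [Y <-] := bc_ob_surj Y'.
  have [Z <-] := bc_ob_surj Z'.
  exact: lifts_iso (lifts_assoc1 X Y Z) (mon_assoc_iso H X Y Z).
- move=> X1 X2 Y1 Y2 Z1 Z2.
  have [X <-] := bc_ob_surj X1; have [Y <-] := bc_ob_surj Y1; have [Z <-] := bc_ob_surj Z1.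
  have [X' <-] := bc_ob_surj X2; have [Y' <-] := bc_ob_surj Y2; have [Z' <-] := bc_ob_surj Z2.
  move=> f g h; have [f1 <-] := bc_hom_surj f; have [g1 <-] := bc_hom_surj g.
  have [h1 <-] := bc_hom_surj h.
  exact: lifts_eq (lifts_comp (lifts_assoc1 X' Y' Z') (lifts_act (lifts_act (Lifts f1) (Lifts g1)) (Lifts h1)))
    (lifts_comp (lifts_act (Lifts f1) (lifts_act (Lifts g1) (Lifts h1))) (lifts_assoc1 X Y Z))
    (mon_assoc_nat H f1 g1 h1).
- move=> X'; have [X <-] := bc_ob_surj X'.
  exact: lifts_iso (lifts_lunitE X) (mon_lunit_iso H X).
- move=> X1 X2; have [X <-] := bc_ob_surj X1; have [X' <-] := bc_ob_surj X2.
  move=> f; have [f1 <-] := bc_hom_surj f.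
  exact: lifts_eq (lifts_comp (lifts_lunitE X') (lifts_act lifts_idm_unit (Lifts f1)))
    (lifts_comp (Lifts f1) (lifts_lunitE X)) (mon_lunit_nat H f1).
- move=> X'; have [X <-] := bc_ob_surj X'.
  exact: lifts_iso (lifts_runitE X) (mon_runit_iso H X).
- move=> X1 X2; have [X <-] := bc_ob_surj X1; have [X' <-] := bc_ob_surj X2.
  move=> f; have [f1 <-] := bc_hom_surj f.
  exact: lifts_eq (lifts_comp (lifts_runitE X') (lifts_act (Lifts f1) lifts_idm_unit))
    (lifts_comp (Lifts f1) (lifts_runitE X)) (mon_runit_nat H f1).
- move=> W1 X1 Y1 Z1.
  have [W <-] := bc_ob_surj W1.
  have [X <-] := bc_ob_surj X1; have [Y <-] := bc_ob_surj Y1; have [Z <-] := bc_ob_surj Z1.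
  exact: lifts_eq
    (lifts_comp (lifts_assocE erefl erefl (bc_ob_bob Y Z)) (lifts_assocE (bc_ob_bob W X) erefl erefl))
    (lifts_comp (lifts_comp (lifts_act (lifts_idm W) (lifts_assoc1 X Y Z))
        (lifts_assocE erefl (bc_ob_bob X Y) erefl))
      (lifts_act (lifts_assoc1 W X Y) (lifts_idm Z)))
    (mon_pentagon H W X Y Z).
- move=> X1 Y1; have [X <-] := bc_ob_surj X1; have [Y <-] := bc_ob_surj Y1.
  exact: lifts_eq
    (lifts_comp (lifts_act (lifts_idm X) (lifts_lunitE Y)) (lifts_assocE erefl bc_ob_unit erefl))
    (lifts_act (lifts_runitE X) (lifts_idm Y)) (mon_triangle H X Y).
Qed.

End BaseChange.

(** For [l > 0] the scalars [R_l] have enough evaluations; for [l = 0] they are a quotient of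
    [R_1]. *)
Lemma C0_sum_linear (l : nat) : is_linear_category (C0_sum l).
Proof.
case: l => [|l]; last exact: C0_linear (@phi_sum_enough l).
apply: C0_linear_of_category.
exact: (@C0_category_bc _ _ _ sumsubst0_surj _ (phi_id 1) (phi_sum 0) (fun x => erefl)
  (lin_cat (C0_linear (@phi_id_enough 1)))).
Qed.

Lemma hull_tensor_monoidal (l : nat) :
  is_monoidal (C := hull (C0_sum l)) (T := hull_tensor l) (U := unit_ob (phi_sum l))
    (@tensor_assoc _ (phi_sum l)) (@tensor_lunit _ (phi_sum l)) (@tensor_runit _ (phi_sum l)).
Proof.
case: l => [|l]; last exact: hull_monoidal (@phi_sum_enough l).
exact: (@hull_monoidal_bc _ _ _ sumsubst0_surj (phi_id 1) (phi_sum 0) (fun x => erefl)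
  (lin_cat (C0_linear (@phi_id_enough 1)))
  (hull_monoidal (@phi_id_enough 1))).
Qed.

Lemma hull_action_module (l : nat) :
  is_module_category (T := hull_tensor l) (U := unit_ob (phi_sum l))
    (@tensor_assoc _ (phi_sum l)) (@tensor_runit _ (phi_sum l))
    (A := hull_action l) (@assoc_mx l _ (phi_sum l) (phi_id l)) (@lunit_mx l _ (phi_sum l) (phi_id l)).
Proof. exact: (@hull_module l _ (phi_sum l) (phi_id l) (fun x => erefl) (@phi_id_enough l)). Qed.

(** * Idempotent completion *)

Section Cut.
Variables (R : comNzRingType) (C : linprecat R) (hC : is_linear_category C).
Local Notation K := (kar hC).

Definition kmap (X Y : K) (f : hom X Y) : hom (kcar X : C) (kcar Y) := kval f.
Definition idem (X : K) : hom (kcar X : C) (kcar X) := kidem X.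
(** The morphism between direct summands cut out by the idempotents.  On morphisms commuting
    with the idempotents this is compatible with composition. *)
Definition cut (X Y : K) (f : hom (kcar X : C) (kcar Y)) : hom X Y := kcut hC f.

Definition intertwines (X Y : K) (f : hom (kcar X : C) (kcar Y)) := idem Y \oc f = f \oc idem X.

Let cA := compA (lin_cat hC).
Let c1 := comp1m (lin_cat hC).
Let c2 := compm1 (lin_cat hC).

Lemma idemK (X : K) : idem X \oc idem X = idem X.
Proof. exact: kidemP. Qed.

Lemma kmap_inj (X Y : K) (f g : hom X Y) : kmap f = kmap g -> f = g.
Proof. exact: val_inj. Qed.

Lemma kmap_comp (X Y Z : K) (g : hom Y Z) (f : hom X Y) : kmap (g \oc f) = kmap g \oc kmap f.
Proof. by []. Qed.

Lemma kmap_cut (X Y : K) (f : hom (kcar X : C) (kcar Y)) : kmap (cut f) = idem Y \oc f \oc idem X.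
Proof. by []. Qed.

Lemma kmapE (X Y : K) (f : hom X Y) : idem Y \oc kmap f \oc idem X = kmap f.
Proof. by case: f => f /= /eqP. Qed.

Lemma kmap_intertwines (X Y : K) (f : hom X Y) : intertwines (X := X) (Y := Y) (kmap f).
Proof.
rewrite /intertwines -(kmapE f) -[RHS]cA idemK !cA idemK; by rewrite -cA.
Qed.

Lemma cut_kmap (X Y : K) (f : hom X Y) : cut (kmap f) = f.
Proof. by apply: kmap_inj; rewrite kmap_cut kmapE. Qed.

Lemma cut_id (X : K) : cut (idm (kcar X : C)) = idm X.
Proof. by apply: kmap_inj; rewrite kmap_cut c2 idemK. Qed.

Lemma comp_intertwines (X Y Z : K) (g : hom (kcar Y : C) (kcar Z)) (f : hom (kcar X : C) (kcar Y)) :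
  intertwines g -> intertwines f -> intertwines (X := X) (Y := Z) (g \oc f).
Proof. by rewrite /intertwines => hg hf; rewrite cA hg -cA hf cA. Qed.

Lemma cut_comp (X Y Z : K) (g : hom (kcar Y : C) (kcar Z)) (f : hom (kcar X : C) (kcar Y)) :
  intertwines f -> cut g \oc cut f = cut (X := X) (Y := Z) (g \oc f).
Proof.
move=> hf; apply: kmap_inj; rewrite kmap_comp !kmap_cut hf.
by rewrite -!cA idemK (cA (idem Y)) hf -!cA idemK.
Qed.

Lemma cut_compl (X Y Z : K) (g : hom (kcar Y : C) (kcar Z)) (f : hom (kcar X : C) (kcar Y)) :
  intertwines g -> cut g \oc cut f = cut (X := X) (Y := Z) (g \oc f).
Proof.
move=> hg; apply: kmap_inj; rewrite kmap_comp !kmap_cut hg.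
by rewrite -!cA (cA (idem Y) (idem Y)) idemK (cA (idem Y) (idem Y)) idemK (cA (idem Z)) hg -cA.
Qed.

Lemma idm_intertwines (X : K) : intertwines (X := X) (Y := X) (idm (kcar X : C)).
Proof. by rewrite /intertwines c1 c2. Qed.

(** The inverse of a morphism commuting with the idempotents commutes with them too. *)
Lemma cut_iso (X Y : K) (f : hom (kcar X : C) (kcar Y)) :
  intertwines f -> is_iso f -> is_iso (cut f).
Proof.
move=> hf [g [gf fg]]; have hg : intertwines (X := Y) (Y := X) g.
  have e : idem X = g \oc (idem Y \oc f) by rewrite hf cA gf c1.
  by rewrite /intertwines e -!cA fg c2.
exists (cut g); split; rewrite cut_comp //.
  by rewrite gf cut_id.
by rewrite fg cut_id.
Qed.

End Cut.

Section CutBifunctor.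
Variables (R : comNzRingType) (A B C : linprecat R).
Variables (hA : is_linear_category A) (hB : is_linear_category B) (hC : is_linear_category C).
Variables (T : prefunctor (prodcat A B) C) (HT : is_functor T).
Local Notation kT := (kbif hA hB hC HT).

Lemma bmap_comp (X Y Z : A) (X' Y' Z' : B) (g : hom Y Z) (f : hom X Y) (g' : hom Y' Z') (f' : hom X' Y') :
  bmap T (g \oc f) (g' \oc f') = bmap T g g' \oc bmap T f f'.
Proof. exact: (@fmapM _ _ T HT (X, X') (Y, Y') (Z, Z') (g, g') (f, f')). Qed.

(** The idempotent of a product of objects is the product of their idempotents, and [T]
    preserves composition. *)
Lemma cut_bmap (X Y : kar hA) (X' Y' : kar hB) (f : hom (kcar X : A) (kcar Y)) (f' : hom (kcar X' : B) (kcar Y')) :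
  bmap kT (cut f) (cut f') = cut (hC := hC) (X := bob kT X X') (Y := bob kT Y Y') (bmap T f f').
Proof.
apply: kmap_inj; rewrite kmap_cut.
by apply: etrans (bmap_comp _ _ _ _) _; rewrite bmap_comp.
Qed.

Lemma bmap_intertwines (X Y : kar hA) (X' Y' : kar hB) (f : hom (kcar X : A) (kcar Y)) (f' : hom (kcar X' : B) (kcar Y')) :
  intertwines f -> intertwines f' ->
  intertwines (hC := hC) (X := bob kT X X') (Y := bob kT Y Y') (bmap T f f').
Proof.
rewrite /intertwines => hf hf'.
by apply: etrans (esym (bmap_comp _ _ _ _)) _; rewrite hf hf' bmap_comp.
Qed.

Lemma kbif_functor : is_functor kT.
Proof.
split=> [[X Y]|[X X'] [Y Y'] [Z Z'] [g g'] [f f']]; apply: kmap_inj => //.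
exact: bmap_comp.
Qed.

Lemma kbif_bilinear : is_bilinear_functor T -> is_bilinear_functor kT.
Proof.
move=> H; split; first exact: kbif_functor.
- move=> X X' Y Y' a f f' g; apply: val_inj.
  exact: (bmapDl H a (kval f) (kval f') (kval g)).
- move=> X X' Y Y' a f g g'; apply: val_inj.
  exact: (bmapDr H a (kval f) (kval g) (kval g')).
Qed.

End CutBifunctor.

Section CutModule.
Variables (R : comNzRingType) (C D : linprecat R).
Variables (hC : is_linear_category C) (hD : is_linear_category D).
Variables (T : prefunctor (prodcat C C) C) (HT : is_functor T).
Variables (A : prefunctor (prodcat C D) D) (HA : is_functor A).
Variables (U : C) (a : forall X Y Z : C, hom (bob T (bob T X Y) Z) (bob T X (bob T Y Z))).
Variable ru : forall X : C, hom (bob T X U) X.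
Variable m : forall (X Y : C) (M : D), hom (bob A (bob T X Y) M) (bob A X (bob A Y M)).
Variable n : forall M : D, hom (bob A U M) M.
Hypothesis H : is_module_category (U := U) a ru m n.
Variable U1 : lcomp (lidm U) (lidm U) = lidm U.

Local Notation kT := (kbif hC hC hC HT).
Local Notation kA := (kbif hC hD hD HA).
Local Notation kU := (Kob U1 : kar hC).

Definition kar_assoc (X Y Z : kar hC) : hom (bob kT (bob kT X Y) Z) (bob kT X (bob kT Y Z)) :=
  kcut hC (X := bob kT (bob kT X Y) Z) (Y := bob kT X (bob kT Y Z)) (a (kcar X) (kcar Y) (kcar Z)).
Definition kar_runit (X : kar hC) : hom (bob kT X kU) X :=
  kcut hC (X := bob kT X kU) (Y := X) (ru (kcar X)).
Definition kar_act_assoc (X Y : kar hC) (Z : kar hD) : hom (bob kA (bob kT X Y) Z) (bob kA X (bob kA Y Z)) :=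
  kcut hD (X := bob kA (bob kT X Y) Z) (Y := bob kA X (bob kA Y Z)) (m (kcar X) (kcar Y) (kcar Z)).
Definition kar_act_lunit (M : kar hD) : hom (bob kA kU M) M :=
  kcut hD (X := bob kA kU M) (Y := M) (n (kcar M)).

(** Naturality of the constraint, applied to idempotents. *)
Lemma act_assoc_intertwines (X Y : kar hC) (Z : kar hD) :
  intertwines (hC := hD) (X := bob kA (bob kT X Y) Z) (Y := bob kA X (bob kA Y Z))
    (m (kcar X) (kcar Y) (kcar Z)).
Proof. exact: esym (mod_assoc_nat H (idem X) (idem Y) (idem Z)). Qed.

Lemma act_lunit_intertwines (M : kar hD) :
  intertwines (hC := hD) (X := bob kA kU M) (Y := M) (n (kcar M)).
Proof. exact: esym (mod_unit_nat H (idem M)). Qed.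

(** All morphisms involved are cut out of morphisms between the underlying objects; at least
    one factor of each composite commutes with the idempotents, so each axiom follows from
    the same axiom for the underlying objects. *)
Lemma kar_module : is_module_category (T := kT) (U := kU) kar_assoc kar_runit (A := kA) kar_act_assoc kar_act_lunit.
Proof.
have im := act_assoc_intertwines; have i_n := act_lunit_intertwines.
split.
- exact: lin_cat (kar_linear hD).
- exact: kbif_functor.
- move=> X Y Z; exact: cut_iso (im X Y Z) (mod_assoc_iso H _ _ _).
- move=> X X' Y Y' M M' f g h.
  rewrite -(cut_kmap f) -(cut_kmap g) -(cut_kmap h).
  rewrite !cut_bmap.
  apply: etrans (cut_comp _ _) _.
    apply: bmap_intertwines; last exact: kmap_intertwines.
    by apply: bmap_intertwines; exact: kmap_intertwines.
  apply: etrans _ (esym (cut_comp _ (im _ _ _))).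
  by congr (cut _); exact: (mod_assoc_nat H).
- move=> M; exact: cut_iso (i_n M) (mod_unit_iso H _).
- move=> M M' f; rewrite -(cut_kmap f) -(cut_kmap (idm kU)) cut_bmap.
  apply: etrans (cut_comp _ _) _.
    by apply: bmap_intertwines; exact: kmap_intertwines.
  apply: etrans _ (esym (cut_comp _ (i_n _))).
  by congr (cut _); exact: (mod_unit_nat H).
- move=> X Y Z M; rewrite -!cut_id.
  rewrite !cut_bmap.
  apply: etrans (cut_comp _ (im _ _ _)) _.
  apply: etrans _ (congr1 (fun f => f \oc _) (esym (cut_comp _ (im _ _ _)))).
  apply: etrans _ (esym (cut_compl _ _)).
    by congr (cut _); exact: (mod_pentagon H).
  by apply: comp_intertwines (im _ _ _); apply: bmap_intertwines => //; exact: idm_intertwines.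
- move=> X M; rewrite -!cut_id !cut_bmap.
  apply: etrans (cut_comp _ (im _ _ _)) _.
  by congr (cut _); exact: (mod_triangle H).
Qed.

End CutModule.
Arguments kar_assoc {R C} hC {T} HT a X Y Z.
Arguments kar_runit {R C} hC {T} HT {U} ru U1 X.
Arguments kar_act_assoc {R C D} hC hD {T} HT {A} HA m X Y Z.
Arguments kar_act_lunit {R C D} hC hD {A} HA {U} n U1 M.

Section CutMonoidal.
Variables (R : comNzRingType) (C : linprecat R) (hC : is_linear_category C).
Variables (T : prefunctor (prodcat C C) C) (HT : is_functor T).
Variables (U : C) (a : forall X Y Z : C, hom (bob T (bob T X Y) Z) (bob T X (bob T Y Z))).
Variables (lu : forall X : C, hom (bob T U X) X) (ru : forall X : C, hom (bob T X U) X).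
Hypothesis H : is_monoidal (U := U) a lu ru.
Variable U1 : lcomp (lidm U) (lidm U) = lidm U.

Local Notation kT := (kbif hC hC hC HT).
Local Notation kU := (Kob U1 : kar hC).

(** This reduces all but the right unitor to [kar_module]. *)
Lemma monoidal_module : is_module_category (U := U) a ru (A := T) a lu.
Proof. by case: H. Qed.

Lemma runit_intertwines (X : kar hC) :
  intertwines (hC := hC) (X := bob kT X kU) (Y := X) (ru (kcar X)).
Proof. exact: esym (mon_runit_nat H (idem X)). Qed.

Lemma kar_monoidal : is_monoidal (T := kT) (U := kU) (kar_assoc hC HT a) (kar_act_lunit hC hC HT lu U1)
  (kar_runit hC HT ru U1).
Proof.
have M := kar_module hC hC HT HT monoidal_module U1; split.
- exact: mod_cat M.
- exact: mod_functor M.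
- exact: mod_assoc_iso M.
- exact: mod_assoc_nat M.
- exact: mod_unit_iso M.
- exact: mod_unit_nat M.
- move=> X; exact: cut_iso (runit_intertwines X) (mon_runit_iso H _).
- move=> X X' f; rewrite -(cut_kmap f) -(cut_kmap (idm kU)) cut_bmap.
  apply: etrans (cut_comp _ _) _.
    by apply: bmap_intertwines; exact: kmap_intertwines.
  apply: etrans _ (esym (cut_comp _ (runit_intertwines _))).
  by congr (cut _); exact: (mon_runit_nat H).
- exact: mod_pentagon M.
- exact: mod_triangle M.
Qed.

End CutMonoidal.

Section ActionBilinear.
Variables (l : nat) (R : comNzRingType).

Lemma act_component_linearl (a a' : wt 1) (b b' v v' : wt l) x
    (f f' : {malg R[lmat a a']}) (g : {malg R[lmat b b']}) :
  act_component (x *: f + f') g v v' =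
  x *: act_component f g v v' + act_component f' g v v'.
Proof.
exact: (bext_linearl (fun (p : lmat a a') (q : lmat b b') =>
  \sum_(u \in act_tensor (v := v) (v' := v') p q) (<< u >> : {malg R[lmat v v']})) x).
Qed.

Lemma act_component_linearr (a a' : wt 1) (b b' v v' : wt l) x
    (f : {malg R[lmat a a']}) (g g' : {malg R[lmat b b']}) :
  act_component f (x *: g + g') v v' =
  x *: act_component f g v v' + act_component f g' v v'.
Proof.
exact: (bext_linearr (fun (p : lmat a a') (q : lmat b b') =>
  \sum_(u \in act_tensor (v := v) (v' := v') p q) (<< u >> : {malg R[lmat v v']})) x).
Qed.

Lemma action_bilinear (phi1 : {rmorphism intpoly 1 -> R}) (phi : {rmorphism intpoly l -> R}) :
  is_functor (action phi1 phi) -> is_bilinear_functor (action phi1 phi).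
Proof.
move=> HA; split=> //.
- move=> X X' Y Y' a f f' g; apply: functional_extensionality_dep => i.
  apply: functional_extensionality_dep => j.
  exact: (@act_component_linearl (fam X (tag j).1) (fam X' (tag i).1) (fam Y (tag j).2)
    (fam Y' (tag i).2) (val (tagged j)) (val (tagged i)) a (f _ _) (f' _ _) (g _ _)).
- move=> X X' Y Y' a f g g'; apply: functional_extensionality_dep => i.
  apply: functional_extensionality_dep => j.
  exact: (@act_component_linearr (fam X (tag j).1) (fam X' (tag i).1) (fam Y (tag j).2)
    (fam Y' (tag i).2) (val (tagged j)) (val (tagged i)) a (f _ _) (g _ _) (g' _ _)).
Qed.

End ActionBilinear.

(** * Comparison with the tensor product of modules *)

Local Open Scope quotient_scope.

Section TensorLift.
Variables (M N V : zmodType) (b : M -> N -> V).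
Hypotheses (bBl : forall m m' n, b (m - m') n = b m n - b m' n).
Hypotheses (bBr : forall m n n', b m (n - n') = b m n - b m n').

Definition tlift0 : {malg int[(M * N)%type]} -> V := mlin (fun mn => b mn.1 mn.2).

Lemma tlift0B x y : tlift0 (x - y) = tlift0 x - tlift0 y.
Proof. exact: raddfB. Qed.

Definition tlift (x : tensor M N) : V := tlift0 (repr x).

Lemma tlift0_rel x : bilin_rel x -> tlift0 x = 0.
Proof.
have b0l n : b 0 n = 0 by have := bBl 0 0 n; rewrite !subrr.
have b0r m : b m 0 = 0 by have := bBr m 0 0; rewrite !subrr.
have bDl m m' n : b (m + m') n = b m n + b m' n.
  by rewrite -{1}[m']opprK bBl -[- m']sub0r bBl b0l sub0r opprK.
have bDr m n n' : b m (n + n') = b m n + b m n'.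
  by rewrite -{1}[n']opprK bBr -[- n']sub0r bBr b0r sub0r opprK.
move=> /asboolP hx; apply: (hx [set y | tlift0 y = 0]); split => /=.
- exact: raddf0.
- by move=> y z Sy Sz; rewrite tlift0B Sy Sz subrr.
- by move=> m m' n; rewrite !tlift0B /tlift0 !mlinU /= bDl addrAC addrK subrr.
- by move=> m n n'; rewrite !tlift0B /tlift0 !mlinU /= bDr addrAC addrK subrr.
Qed.

Lemma tlift_pi x : tlift (\pi_(tensor M N) x) = tlift0 x.
Proof.
apply/eqP; rewrite -subr_eq0 /tlift -tlift0B; apply/eqP; apply: tlift0_rel.
by rewrite -[bilin_rel _]/(_ \in bilin_rel (N := N)) Quotient.idealrBE reprK.
Qed.

Lemma tliftB : {morph tlift : x y / x - y}.
Proof.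
move=> x y; rewrite -[x]reprK -[y]reprK -raddfB !tlift_pi.
exact: tlift0B.
Qed.

Lemma tlift_pure m n : tlift (tpure m n) = b m n.
Proof. by rewrite tlift_pi /tlift0 mlinU. Qed.

End TensorLift.

Lemma tpureDl (M N : zmodType) (m m' : M) (n : N) :
  tpure (m + m') n = tpure m n + tpure m' n.
Proof.
rewrite /tpure -raddfD; apply/eqP; rewrite -Quotient.idealrBE; apply/asboolP => S [_ _ h _].
by rewrite opprD addrA.
Qed.

Lemma tpureDr (M N : zmodType) (m : M) (n n' : N) :
  tpure m (n + n') = tpure m n + tpure m n'.
Proof.
rewrite /tpure -raddfD; apply/eqP; rewrite -Quotient.idealrBE; apply/asboolP => S [_ _ _ h].
by rewrite opprD addrA.
Qed.

Lemma tpureBl (M N : zmodType) (m m' : M) (n : N) :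
  tpure (m - m') n = tpure m n - tpure m' n.
Proof. by apply/eqP; rewrite eq_sym subr_eq -tpureDl subrK. Qed.

Lemma tpureBr (M N : zmodType) (m : M) (n n' : N) :
  tpure m (n - n') = tpure m n - tpure m n'.
Proof. by apply/eqP; rewrite eq_sym subr_eq -tpureDr subrK. Qed.

(** The comparison map is naturally defined on the tensor product, in the direction opposite
    to the one wanted. *)
Lemma naturally_isomorphic_sym (C D : precat) (F G : prefunctor C D) : is_category D ->
  naturally_isomorphic F G -> naturally_isomorphic G F.
Proof.
move=> HD [eta [iso nat]].
pose inv X := projT1 (cid (iso X)).
have invl X : inv X \oc eta X = idm _ by rewrite /inv; case: cid => ? [].
have invr X : eta X \oc inv X = idm _ by rewrite /inv; case: cid => ? [].
exists inv; split=> [X|X Y f]; first by exists (eta X).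
have cA := compA HD.
rewrite -[LHS](compm1 HD) -(invr X) cA -(cA _ _ _ _ _ _ (eta X)) -nat.
by rewrite !cA invl (comp1m HD).
Qed.

Lemma Sdmod_category d : is_category (Sdmod d).
Proof. by split=> *; apply: sdhom_ext. Qed.

(** The hypotheses say that [b X Y] is a universal biadditive map, with [t X Y] the inverse of
    the induced map, equivariant and natural in [X] and [Y].  The image of the idempotent
    [bmap A e e'] is then the tensor product of the images of [e] and [e'], because [t] and
    the map induced by [b] exchange it with e # e'. *)
Section TensorCompatibility.
Variables (d : nat) (R : comNzRingType) (C D : linprecat R).
Variables (hC : is_linear_category C) (hD : is_linear_category D).
Variables (A : prefunctor (prodcat C D) D) (HA : is_functor A).
Variables (F1 : prefunctor C (Sdmod d)) (HF1 : is_functor F1).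
Variables (F2 : prefunctor D (Sdmod d)) (HF2 : is_functor F2).

Local Notation M1 X := (F1 X : sdmod d).
Local Notation M2 X := (F2 X : sdmod d).

Variable b : forall (X : C) (Y : D), M1 X -> M2 Y -> M2 (bob A X Y).
Arguments b : clear implicits.
Hypotheses (bBl : forall X Y m m' n, b X Y (m - m') n = b X Y m n - b X Y m' n).
Hypotheses (bBr : forall X Y m n n', b X Y m (n - n') = b X Y m n - b X Y m n').
Hypothesis bJ : forall X Y g m n, b X Y (sdact g m) (sdact g n) = sdact g (b X Y m n).
Hypothesis b_nat : forall (X X' : C) (Y Y' : D) (f : hom X X') (g : hom Y Y') m n,
  b X' Y' (sdfun (fmap F1 f) m) (sdfun (fmap F2 g) n) = sdfun (fmap F2 (bmap A f g)) (b X Y m n).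
Variable t : forall (X : C) (Y : D), M2 (bob A X Y) -> tensor (M1 X) (M2 Y).
Arguments t : clear implicits.
Hypothesis tB : forall X Y, {morph t X Y : z w / z - w}.
Hypothesis tb : forall X Y m n, t X Y (b X Y m n) = tpure m n.
Hypothesis bt : forall X Y z, tlift (b X Y) (t X Y z) = z.

Local Notation kA := (kbif hC hD hD HA).
Local Notation K1 := (kext hC HF1).
Local Notation K2 := (kext hD HF2).

Section Component.
Variables (X : kar hC) (Y : kar hD).
Local Notation N1 := (K1 X : sdmod d).
Local Notation N2 := (K2 Y : sdmod d).
Local Notation N := (K2 (bob kA X Y) : sdmod d).

Definition fixv (Z : kar hC) (x : (K1 Z : sdmod d)) : M1 (kcar Z) := fixval x.
Definition fixw (Z : kar hD) (x : (K2 Z : sdmod d)) : M2 (kcar Z) := fixval x.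

Lemma fixvE (x : N1) : sdfun (fmap F1 (kidem X)) (fixv x) = fixv x.
Proof. by case: x => x /= /eqP. Qed.

Lemma fixwE (Z : kar hD) (x : (K2 Z : sdmod d)) : sdfun (fmap F2 (kidem Z)) (fixw x) = fixw x.
Proof. by case: x => x /= /eqP. Qed.

Lemma zpair_subproof (m : N1) (n : N2) :
  fixed_pred (fmap F2 (kidem (bob kA X Y))) (b (kcar X) (kcar Y) (fixv m) (fixw n)).
Proof.
apply/eqP; apply: etrans (esym (b_nat (idem X) (idem Y) (fixv m) (fixw n))) _.
by rewrite [X in b _ _ X _]fixvE [X in b _ _ _ X]fixwE.
Qed.

Definition zpair (m : N1) (n : N2) : N := Fixed (zpair_subproof m n).

Lemma fixw_inj (Z : kar hD) : injective (@fixw Z).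
Proof. exact: val_inj. Qed.

Lemma zpairBl m m' n : zpair (m - m') n = zpair m n - zpair m' n.
Proof. apply: fixw_inj; exact: bBl. Qed.

Lemma zpairBr m n n' : zpair m (n - n') = zpair m n - zpair m n'.
Proof. apply: fixw_inj; exact: bBr. Qed.

Definition zeta : tensor N1 N2 -> N := tlift zpair.

Lemma zetaB : {morph zeta : x y / x - y}.
Proof. exact: tliftB zpairBl zpairBr. Qed.

Lemma zeta_pure m n : zeta (tpure m n) = zpair m n.
Proof. exact: tlift_pure zpairBl zpairBr m n. Qed.

Lemma cutv_subproof (m : M1 (kcar X)) :
  fixed_pred (fmap F1 (kidem X)) (sdfun (fmap F1 (kidem X)) m).
Proof.
have := congr1 (fun h => sdfun h m) (fmapM HF1 (idem X) (idem X)).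
by rewrite (idemK X) => e; apply/eqP; exact: esym e.
Qed.

Lemma cutw_subproof (m : M2 (kcar Y)) :
  fixed_pred (fmap F2 (kidem Y)) (sdfun (fmap F2 (kidem Y)) m).
Proof.
have := congr1 (fun h => sdfun h m) (fmapM HF2 (idem Y) (idem Y)).
by rewrite (idemK Y) => e; apply/eqP; exact: esym e.
Qed.

Definition cutv (m : M1 (kcar X)) : N1 := Fixed (cutv_subproof m).
Definition cutw (m : M2 (kcar Y)) : N2 := Fixed (cutw_subproof m).

Lemma cutvB : {morph cutv : x y / x - y}.
Proof. move=> x y; apply: val_inj; exact: sdfunB. Qed.

Lemma cutwB : {morph cutw : x y / x - y}.
Proof. move=> x y; apply: val_inj; exact: sdfunB. Qed.

Lemma cutv_fixv (m : N1) : cutv (fixv m) = m.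
Proof. by apply: val_inj; exact: fixvE. Qed.

Lemma cutw_fixw (m : N2) : cutw (fixw m) = m.
Proof. by apply: val_inj; exact: fixwE. Qed.

Definition zinv (z : N) : tensor N1 N2 := tmap cutv cutw (t (kcar X) (kcar Y) (fixw z)).

Lemma zinvB : {morph zinv : z w / z - w}.
Proof.
by move=> z w; rewrite /zinv -(tmapB cutvB cutwB) -tB.
Qed.

Lemma zetaK : cancel zeta zinv.
Proof.
apply: tensor_ext => // [x y|m n]; first by rewrite zetaB zinvB.
by rewrite zeta_pure /zinv /zpair /fixw /= tb (tmap_pure _ _ cutvB cutwB) cutv_fixv cutw_fixw.
Qed.

(** On pure tensors this is the naturality of [b] at the idempotents. *)
Lemma fixw_zeta_tmap s : fixw (zeta (tmap cutv cutw s)) =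
  sdfun (fmap F2 (kidem (bob kA X Y))) (tlift (b (kcar X) (kcar Y)) s).
Proof.
have bB := tliftB (bBl (X := kcar X) (Y := kcar Y)) (bBr (X := kcar X) (Y := kcar Y)).
move: s; apply: tensor_ext => [x y|x y|m n].
- by rewrite (tmapB cutvB cutwB) zetaB.
- by rewrite bB sdfunB.
- rewrite (tmap_pure _ _ cutvB cutwB) zeta_pure tlift_pure //; exact: b_nat.
Qed.

Lemma zinvK : cancel zinv zeta.
Proof. by move=> z; apply: fixw_inj; rewrite fixw_zeta_tmap bt fixwE. Qed.

Lemma zetaJ g x : zeta (tmap (sdact g) (sdact g) x) = sdact g (zeta x).
Proof.
have aB := tmapB (@sdactB d N1 g) (@sdactB d N2 g).
move: x; apply: tensor_ext => [x y|x y|m n].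
- by rewrite aB zetaB.
- by rewrite zetaB sdactB.
- apply: etrans (congr1 zeta (tmap_pure m n (@sdactB d N1 g) (@sdactB d N2 g))) _.
  apply: etrans (zeta_pure _ _) _.
  apply: etrans _ (congr1 (@sdact d N g) (esym (zeta_pure m n))).
  apply: fixw_inj; exact: bJ.
Qed.

Definition zeta_hom : sdhom (sd_tensor_ob N1 N2) N :=
  @SdHom d (sd_tensor_ob N1 N2) N zeta zetaB zetaJ.

End Component.

(** The inverse of an equivariant bijection is equivariant. *)
Lemma sd_iso (M N : sdmod d) (f : sdhom M N) (g : N -> M) :
  cancel f g -> cancel g f -> is_iso (f : hom (M : Sdmod d) N).
Proof.
move=> fK gK.
have gB : {morph g : x y / x - y}.
  by move=> x y; apply: (can_inj fK); rewrite sdfunB !gK.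
have gJ h x : g (sdact h x) = sdact h (g x).
  by apply: (can_inj fK); rewrite sdfunJ !gK.
by exists (SdHom gB gJ); split; apply: sdhom_ext => x /=; rewrite ?fK ?gK.
Qed.

Lemma tensor_compatible :
  naturally_isomorphic (compfun K2 kA) (compfun (sd_tensor d) (prodfun K1 K2)).
Proof.
apply: naturally_isomorphic_sym; first exact: Sdmod_category.
exists (fun XY => zeta_hom XY.1 XY.2); split.
  move=> XY; exact: (@sd_iso _ _ (zeta_hom XY.1 XY.2) _ (@zetaK _ _) (@zinvK _ _)).
move=> [X Y] [X' Y'] [f g]; apply: sdhom_ext.
apply: tensor_ext => [x y|x y|m n].
- exact: sdfunB.
- exact: sdfunB.
- have fB := @sdfunB _ _ _ (fmap K1 f); have gB := @sdfunB _ _ _ (fmap K2 g).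
  apply: etrans (congr1 (@zeta X' Y') (tmap_pure m n fB gB)) _.
  apply: etrans (zeta_pure _ _) _.
  apply: etrans _ (congr1 (sdfun (fmap K2 (bmap kA f g))) (esym (zeta_pure m n))).
  apply: fixw_inj; exact: (b_nat (kmap f) (kmap g)).
Qed.

End TensorCompatibility.

Section PairingOfWords.
Variables (l d : nat) (mu : l.-tuple nat).
Hypothesis mud : sumn mu = d.
Variables (R : comNzRingType).
Variables (phi1 : {rmorphism intpoly 1 -> R}) (phi : {rmorphism intpoly l -> R}).
Local Notation Ct := (C0 phi1).
Local Notation Cl := (C0 phi).

Section Objects.
Variables (X : hull Ct) (Y : hull Cl).
Local Notation WX := (fam_word d [tuple d] X).
Local Notation WY := (fam_word d mu Y).
Local Notation WXY := (fam_word d mu (act_ob X Y)).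

Lemma fpair_act (g : 'S_d) (x : WX) (y : WY) :
  fpair mud (fam_word_act g x) (fam_word_act g y) = fam_word_act g (fpair mud x y).
Proof.
apply/esym/fpairE.
  exact: (fpair_tag mud x y).
apply/ffunP => m; have /ffunP/(_ (g m)) := fpair_letters mud x y.
by rewrite /letters /fam_word_act /= !ffunE.
Qed.

Lemma mpair_act (g : 'S_d) (x : {malg int[WX]}) (y : {malg int[WY]}) :
  mpair mud (perm_act (@fam_word_act _ d [tuple d] _ _ X) g x) (perm_act (@fam_word_act _ d mu _ _ Y) g y) =
  perm_act (@fam_word_act _ d mu _ _ (act_ob X Y)) g (mpair mud x y).
Proof.
have B (K : choiceType) (act : 'S_d -> K -> K) : {morph perm_act act g : x y / x - y}.
  exact: raddfB.
have E (K : choiceType) (act : 'S_d -> K -> K) k : perm_act act g << k >> = << act g k >>.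
  exact: mlinU.
move: x y; apply: biadditive_ext => [y x x'|x y y'|y x x'|x y y'|k j].
- by rewrite B mpairBl.
- by rewrite B mpairBr.
- by rewrite mpairBl B.
- by rewrite mpairBr B.
- by rewrite mpairUU !E mpairUU fpair_act.
Qed.

Lemma split_word (z : WXY) : {xy : WX * WY | z = fpair mud xy.1 xy.2}.
Proof. by apply: cid; have [x [y e]] := fpair_surj mud z; exists (x, y). Qed.

(** The inverse of the map induced by [mpair], sending a word of pairs to the pure tensor of
    its two components. *)
Definition unpair_tensor : {malg int[WXY]} -> tensor {malg int[WX]} {malg int[WY]} :=
  mlin (fun z => tpure << (sval (split_word z)).1 >> << (sval (split_word z)).2 >>).

Lemma unpair_tensorB : {morph unpair_tensor : x y / x - y}.
Proof. exact: raddfB. Qed.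

Lemma unpair_mpair x y : unpair_tensor (mpair mud x y) = tpure x y.
Proof.
move: x y; apply: biadditive_ext => [y x x'|x y y'|y x x'|x y y'|k j].
- by rewrite mpairBl unpair_tensorB.
- by rewrite mpairBr unpair_tensorB.
- exact: tpureBl.
- exact: tpureBr.
- rewrite mpairUU /unpair_tensor mlinU; case: split_word => -[x y] /= /fpair_inj[<- <-] //.
Qed.

Lemma mpair_unpair z : tlift (@mpair _ _ _ mud _ _ _ X Y) (unpair_tensor z) = z.
Proof.
have tB := tliftB (@mpairBl _ _ _ mud _ _ _ X Y) (@mpairBr _ _ _ mud _ _ _ X Y).
have idB : {morph @id {malg int[WXY]} : x y / x - y} by [].
move: z; apply: (malg_ext _ idB) => [x y|z]; first by rewrite unpair_tensorB tB.
have [x [y ->]] := fpair_surj mud z.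
rewrite -mpairUU unpair_mpair; apply: tlift_pure; first exact: mpairBl.
exact: mpairBr.
Qed.

End Objects.

Variable ev : {rmorphism R -> int}.
Hypotheses (hC : is_linear_category (hull Ct)) (hD : is_linear_category (hull Cl)).
Hypothesis HA : is_functor (action phi1 phi).
Hypothesis HF1 : is_functor (spec d [tuple d] phi1 ev).
Hypothesis HF2 : is_functor (spec d mu phi ev).

Lemma spec_tensor_compatible :
  naturally_isomorphic (compfun (kext hD HF2) (kbif hC hD hD HA))
    (compfun (sd_tensor d) (prodfun (kext hC HF1) (kext hD HF2))).
Proof.
apply: (@tensor_compatible d R (hull Ct) (hull Cl) hC hD (action phi1 phi) HA _ HF1 _ HF2
  (fun X Y => @mpair _ _ _ mud _ _ _ X Y) _ _ _ _ (fun X Y => @unpair_tensor X Y)).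
- by move=> X Y; exact: mpairBl.
- by move=> X Y; exact: mpairBr.
- by move=> X Y; exact: mpair_act.
- by move=> X X' Y Y' f g m n; apply/esym; exact: spec_act.
- by move=> X Y; exact: unpair_tensorB.
- by move=> X Y; exact: unpair_mpair.
- by move=> X Y; exact: mpair_unpair.
Qed.

End PairingOfWords.

Theorem proposition3p20 (l : nat) :
  exists (Ht : is_linear_category (C0_sum l)) (Hl : is_linear_category (C0_lambda l))
         (HT : is_functor (hull_tensor l)) (HA : is_functor (hull_action l)),
    let C_sum := karoubi Ht in
    let C_lambda := karoubi Hl in
    let T : prefunctor (prodcat C_sum C_sum) C_sum := kaction Ht Ht HT in
    let A : prefunctor (prodcat C_sum C_lambda) C_lambda := kaction Ht Hl HA in
    [/\ is_bilinear_functor T /\ is_bilinear_functor A,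
        is_monoidal (T := T) (U := kunit Ht)
          (kassoc Ht Ht HT HT) (klunit Ht Ht HT) (krunit Ht HT),
        is_module_category (T := T) (U := kunit Ht)
          (kassoc Ht Ht HT HT) (krunit Ht HT)
          (A := A) (kassoc Ht Hl HT HA) (klunit Ht Hl HA)
      & forall (d : nat) (mu : l.-tuple nat), sumn mu = d ->
        exists (HFd : is_functor (hull_Fd d mu)) (HFmu : is_functor (hull_Fmu d mu)),
          let Fd : prefunctor C_sum (Sdmod d) := kext (hull_linear Ht) HFd in
          let Fmu : prefunctor C_lambda (Sdmod d) := kext (hull_linear Hl) HFmu in
          naturally_isomorphic
            (compfun Fmu A)
            (compfun (sd_tensor d) (prodfun Fd Fmu))].
Proof.
pose Ht := C0_sum_linear l; pose Hl := C0_linear (@phi_id_enough l).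
have HM := hull_tensor_monoidal l; have HMod := hull_action_module l.
pose HT := mon_functor HM; pose HA := mod_functor HMod.
exists Ht, Hl, HT, HA => C_sum C_lambda T A; split.
- split; apply: kbif_bilinear; exact: action_bilinear.
- exact: (@kar_monoidal _ _ (hull_linear Ht) _ HT _ _ _ _ HM (kunit_subproof Ht)).
- exact: (@kar_module _ _ _ (hull_linear Ht) (hull_linear Hl) _ HT _ HA _ _ _ _ _ HMod (kunit_subproof Ht)).
- move=> d mu mud.
  have evE x : ipeval mu (phi_sum l x) = ipeval [tuple d] x by exact: ipeval_sumsubst.
  exists (spec_functor d evE), (spec_functor d (phi := phi_id l) (fun x => erefl)).
  exact: spec_tensor_compatible.
Qed.
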